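(* Let $k$ be an algebraically closed field, let $A$ be an affine noetherian $k$-algebra, and let $Z$ be an affine subalgebra of the centre of $A$ which is a domain whose nonzero elements are not zero divisors in $A$. Assume that Gelfand-Kirillov dimension over $k$ exists for all $A$-modules, takes values in the non-negative integers, and is exact and finitely partitive. Suppose that $A$ is Cohen-Macaulay. Suppose also that $Z$ has at least one smooth maximal ideal $\mathfrak{m}$ for which $\mathfrak{m}A\neq A$ and $$\mathrm{GKdim}_k(A/\mathfrak{m}A)\ \leq\ \mathrm{GKdim}_{Q(Z)}(A\otimes_Z Q(Z)).$$ (For example, such an $\mathfrak{m}$ exists if $A$ is finitely related and $k$ is uncountable.) Then $$\mathrm{GKdim}_k(A)\ =\ \mathrm{GKdim}_{Q(Z)}(Q(Z)\otimes_Z A)+\mathrm{GKdim}_k(Q(Z)).$$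
   Context: Affine means finitely generated as a $k$-algebra; finitely related means isomorphic to a quotient of a free $k$-algebra of finite rank by a finitely generated two-sided ideal. Modules are left modules. $\mathrm{GKdim}_K(-)$ denotes Gelfand-Kirillov dimension over a field $K$. Exactness means $\mathrm{GKdim}(M)=\max(\mathrm{GKdim}(M'),\mathrm{GKdim}(M''))$ for every short exact sequence $0\to M'\to M\to M''\to 0$; finitely partitive means that for each finitely generated $M$ there is a bound on the lengths $t$ of chains $M=M_0\supset M_1\supset\cdots\supset M_t$ with all $\mathrm{GKdim}(M_i/M_{i+1})=\mathrm{GKdim}(M)$. The grade $j_A(M)=j(M)$ of a finitely generated $A$-module $M$ is the least integer $j$ with $\mathrm{Ext}^j_A(M,A)\neq 0$, or $+\infty$ if there is none. $A$ is Cohen-Macaulay if $\mathrm{GKdim}_k(A)=j(M)+\mathrm{GKdim}_k(M)$ for all nonzero finitely generated (left) $A$-modules $M$. $Q(Z)$ is the field of fractions of $Z$, and $Q(Z)\otimes_Z A$ is viewed as a $Q(Z)$-algebra. A maximal ideal $\mathfrak{m}$ of $Z$ is smooth if $Z_{\mathfrak{m}}$ is a regular local ring. *)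

(* Defs.v *)
From HB Require Import structures.
From mathcomp Require Import all_boot all_order all_algebra fraction.
From mathcomp Require Import generic_quotient ring_quotient.
From mathcomp Require Import boolp classical_sets functions cardinality.
From mathcomp Require Import reals ereal.
From mathcomp Require Import topology normedtype sequences exp.
From mathcomp Require Import -(notations) monalg.

Set Implicit Arguments.
Unset Strict Implicit.
Unset Printing Implicit Defensive.

Import Order.TTheory GRing.Theory Num.Theory.
Local Open Scope ring_scope.
Local Open Scope quotient_scope.

Section Modules.
Variables (A : nzRingType) (M : lmodType A).

Lemma submod_zmod_closed (N : submodClosed M) : zmod_closed N.
Proof. exact: GRing.submod_closedB (submodClosedP N). Qed.

Definition submod_zmod (N : submodClosed M) : zmodClosed M :=
  HB.pack_for (zmodClosed M) (GRing.SubmodClosed.sort N)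
    (GRing.isZmodClosed.Build M (GRing.SubmodClosed.sort N)
       (submod_zmod_closed N)).

Record subm (N : submodClosed M) := Subm { subm_val : M; _ : subm_val \in N }.

HB.instance Definition _ N := [isSub for @subm_val N].
HB.instance Definition _ N := [Choice of subm N by <:].
HB.instance Definition _ (N : submodClosed M) :=
  GRing.SubChoice_isSubLmodule.Build A M (mem N) (subm N) (submodClosedP N).

Definition lquot (N : submodClosed M) : Type := (Quotient.quot (submod_zmod N)).

HB.instance Definition _ N := GRing.Zmodule.on (lquot N).

Section Lquot.
Variable N : submodClosed M.

Definition lquot_pi (x : M) : lquot N := \pi_(Quotient.quot (submod_zmod N)) x.
Definition lquot_scale (a : A) (q : lquot N) : lquot N :=
  lquot_pi (a *: repr (q : Quotient.quot (submod_zmod N))).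

Lemma lquot_pi_eq x y : (lquot_pi x = lquot_pi y) <-> (x - y \in N).
Proof.
rewrite -[x - y \in N]/(x - y \in submod_zmod N) Quotient.idealrBE.
by split=> [h|/eqP h]; [apply/eqP | ].
Qed.

Lemma lquot_piD : {morph lquot_pi : x y / x + y}.
Proof. exact: (raddfD (\pi_(Quotient.quot (submod_zmod N)))). Qed.

Lemma lquot_piK (q : lquot N) :
  lquot_pi (repr (q : Quotient.quot (submod_zmod N))) = q.
Proof. exact: reprK. Qed.

Lemma lquot_piZ a x : lquot_pi (a *: x) = lquot_scale a (lquot_pi x).
Proof.
apply/lquot_pi_eq; rewrite -scalerBr; apply: rpredZ.
by apply/lquot_pi_eq; rewrite lquot_piK.
Qed.

Lemma lquot_scalerA a b q :
  lquot_scale a (lquot_scale b q) = lquot_scale (a * b) q.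
Proof. by rewrite -[q]lquot_piK -!lquot_piZ scalerA. Qed.

Lemma lquot_scale1r : left_id 1 lquot_scale.
Proof. by move=> q; rewrite -[q]lquot_piK -lquot_piZ scale1r. Qed.

Lemma lquot_scalerDr : right_distributive lquot_scale +%R.
Proof.
move=> a p q; rewrite -[p]lquot_piK -[q]lquot_piK -lquot_piD -!lquot_piZ.
by rewrite scalerDr lquot_piD.
Qed.

Lemma lquot_scalerDl q : {morph lquot_scale^~ q : a b / a + b}.
Proof.
by move=> a b; rewrite -[q]lquot_piK -!lquot_piZ scalerDl lquot_piD.
Qed.

HB.instance Definition _ := GRing.Zmodule_isLmodule.Build A (lquot N)
  lquot_scalerA lquot_scale1r lquot_scalerDr lquot_scalerDl.

End Lquot.

Definition lspan (s : seq M) (x : M) : Prop :=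
  exists c : 'I_(size s) -> A, x = \sum_i c i *: s`_i.

Definition fin_gen : Prop := exists s : seq M, forall x, lspan s x.

End Modules.

Arguments lspan {A M} s x.
Arguments fin_gen {A} M.

Section Subquotient.
Variables (A : nzRingType) (M : lmodType A) (N N' : submodClosed M).

Definition relsub_pred : pred (subm N) := fun x : subm N => val x \in N'.

Lemma relsub_closed : submod_closed relsub_pred.
Proof.
split=> [|a x y Nx Ny]; rewrite /relsub_pred unfold_in /=; first exact: rpred0.
by apply: rpredD => //; apply: rpredZ.
Qed.

Definition relsub : submodClosed (subm N) :=
  HB.pack_for (submodClosed (subm N)) relsub_pred
    (GRing.isSubmodClosed.Build A (subm N) relsub_pred relsub_closed).

(* [N / (N' inter N)], that is [N / N'] when [N'] is contained in [N] *)
Definition subquot : lmodType A := lquot relsub.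

End Subquotient.

Definition left_noetherian (A : nzRingType) : Prop :=
  forall I : submodClosed A^o, exists s : seq A^o,
    forall x, x \in I <-> lspan s x.

Definition noetherian_ring (A : nzRingType) : Prop :=
  left_noetherian A /\ left_noetherian A^c.

Definition affine_algebra (k : fieldType) (B : algType k) : Prop :=
  exists s : seq B, forall S : {pred B},
    GRing.subalg_closed S -> {subset s <= S} -> forall x, x \in S.

Definition free_algebra (k : fieldType) (n : nat) : lalgType k :=
  malg (fmonom 'I_n) k.

Definition two_sided_span (F : nzRingType) (r : seq F) (x : F) : Prop :=
  exists t : seq (F * F * F),
    all (fun u => u.1.2 \in r) t /\ x = \sum_(u <- t) u.1.1 * u.1.2 * u.2.

Definition finitely_related (k : fieldType) (B : algType k) : Prop :=
  exists (n : nat) (f : {lrmorphism free_algebra k n -> B})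
         (r : seq (free_algebra k n)),
    (forall b, exists x, f x = b) /\
    (forall x, f x = 0 <-> two_sided_span r x).

Section GelfandKirillov.
Variables (R : realType) (K : fieldType) (A : algType K).

Definition lin_indep (M : lmodType A) (n : nat) (x : 'I_n -> M)
    (I : {set 'I_n}) : Prop :=
  forall c : 'I_n -> K,
    \sum_(i in I) (c i)%:A *: x i = 0 -> forall i, i \in I -> c i = 0.

(* The largest size of an independent subfamily of [s] is the dimension of its
   [K]-span. *)
Definition span_dim (M : lmodType A) (s : seq M) : nat :=
  \max_(I : {set 'I_(size s)} | `[< lin_indep (tnth (in_tuple s)) I >]) #|I|.

(* [words V F n] spans F + VF + ... + V^n F *)
Fixpoint words (M : lmodType A) (V : seq A) (F : seq M) (n : nat) : seq M :=
  if n is n'.+1 then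
    words V F n' ++ [seq a *: x | a <- V, x <- words V F n']
  else F.

(* Since [ln 0 = 0], the zero module has dimension 0. *)
Definition gk_growth (M : lmodType A) (V : seq A) (F : seq M) : \bar R :=
  limn_esup (fun n : nat =>
    (ln (span_dim (words V F n))%:R / ln n%:R : R)%:E).

Definition GKdim (M : lmodType A) : \bar R :=
  ereal_sup [set gk_growth VF.1 VF.2 | VF in [set: seq A * seq M]]%classic.

Definition GKdim_alg : \bar R :=
  ereal_sup [set gk_growth V [:: 1 : A^o] | V in [set: seq A]]%classic.

Definition GKdim_natural : Prop :=
  forall M : lmodType A, exists n : nat, GKdim M = n%:R%:E.

Definition GKdim_exact : Prop :=
  forall (M' M M'' : lmodType A) (f : {linear M' -> M}) (g : {linear M -> M''}),
    injective f -> (forall z, exists y, g y = z) ->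
    (forall y, g y = 0 <-> exists x, f x = y) ->
    GKdim M = maxe (GKdim M') (GKdim M'').

Definition GKdim_finitely_partitive : Prop :=
  forall M : lmodType A, fin_gen M ->
  exists b : nat, forall (t : nat) (C : nat -> submodClosed M),
    (forall x, x \in C 0) ->
    (forall i, (i < t)%N ->
       [/\ {subset C i.+1 <= C i}, exists2 x, x \in C i & x \notin C i.+1
         & GKdim (subquot (C i) (C i.+1)) = GKdim M]) ->
    (t <= b)%N.

End GelfandKirillov.

Arguments GKdim R {K A} M.
Arguments GKdim_alg R {K} A.
Arguments GKdim_natural R {K} A.
Arguments GKdim_exact R {K} A.
Arguments GKdim_finitely_partitive R {K} A.

Section Ext.
Variable A : nzRingType.

Definition projective (P : lmodType A) : Prop :=
  forall (X Y : lmodType A) (g : {linear X -> Y}) (f : {linear P -> Y}),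
    (forall y, exists x, g x = y) ->
    exists h : {linear P -> X}, forall p, g (h p) = f p.

Record proj_resolution (M : lmodType A) := ProjResolution {
  pr_mod :> nat -> lmodType A;
  pr_diff : forall n, {linear pr_mod n.+1 -> pr_mod n};
  pr_aug : {linear pr_mod 0 -> M};
  pr_projective : forall n, projective (pr_mod n);
  pr_surj : forall x, exists y, pr_aug y = x;
  pr_exact0 : forall y, pr_aug y = 0 <-> exists z, pr_diff 0 z = y;
  pr_exactS : forall n y, pr_diff n y = 0 <-> exists z, pr_diff n.+1 z = y
}.

Section Cohomology.
Variables (M N : lmodType A) (P : proj_resolution M).

Definition cocycle (j : nat) (f : {linear P j -> N}) : Prop :=
  forall z, f (pr_diff P j z) = 0.

Definition coboundary (j : nat) : {linear P j -> N} -> Prop :=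
  match j return {linear P j -> N} -> Prop with
  | 0 => fun f => forall y, f y = 0
  | i.+1 => fun f =>
      exists g : {linear P i -> N}, forall y, f y = g (pr_diff P i y)
  end.

End Cohomology.

(* [Ext_neq0 j M N] says that Ext^j(M, N), the [j]-th cohomology of Hom(P, N)
   for a projective resolution P of [M], is nonzero; up to isomorphism that
   cohomology does not depend on P. *)
Definition Ext_neq0 (j : nat) (M N : lmodType A) : Prop :=
  exists (P : proj_resolution M) (f : {linear P j -> N}),
    cocycle f /\ ~ coboundary f.

(* The infimum of the empty set is +oo. *)
Definition grade (R : realType) (M : lmodType A) : \bar R :=
  ereal_inf [set (j%:R : R)%:E | j in [set j : nat | Ext_neq0 j M A^o]]%classic.

End Ext.

Definition Cohen_Macaulay (R : realType) (K : fieldType) (A : algType K) :=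
  forall M : lmodType A, fin_gen M -> (exists x : M, x <> 0) ->
    GKdim_alg R A = (grade R M + GKdim R M)%E.

Section Commutative.
Variable R : comNzRingType.

Definition maximal_ideal (m : idealr R) : Prop :=
  forall J : idealr R, {subset m <= J} -> {subset J <= m}.

Definition prime_chain (n : nat) (C : nat -> prime_idealr R) : Prop :=
  forall i, (i < n)%N ->
    {subset C i <= C i.+1} /\ exists2 x, x \in C i.+1 & x \notin C i.

Definition krull_dim (n : nat) : Prop :=
  (exists C, prime_chain n C) /\
  forall n' C, prime_chain n' C -> (n' <= n)%N.

(* A noetherian local ring whose maximal ideal is generated by as many elements
   as the Krull dimension. *)
Definition regular_local_ring : Prop :=
  left_noetherian R /\
  exists M : idealr R,
    [/\ maximal_ideal M, forall M' : idealr R, maximal_ideal M' -> M' =i M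
      & exists s : seq R^o,
          krull_dim (size s) /\ forall x, x \in M <-> lspan s x].

End Commutative.

Section Localization.
Variables (D : idomainType) (p : prime_idealr D).

(* The localization of a domain is realized inside its field of fractions. *)
Definition loc_pred : {pred {fraction D}} :=
  fun q => `[< exists a s : D, s \notin p /\ q = tofrac a / tofrac s >].

Lemma loc_closed : subring_closed loc_pred.
Proof.
have one_p : 1 \notin p by rewrite idealr1.
have nz s : s \notin p -> tofrac s != 0.
  by move=> ps; rewrite tofrac_eq0; apply: contraNneq ps => ->; apply: rpred0.
split=> [|_ _ /asboolP[a [s [ps ->]]] /asboolP[b [t [pt ->]]]|
         _ _ /asboolP[a [s [ps ->]]] /asboolP[b [t [pt ->]]]].
- by apply/asboolP; exists 1, 1; rewrite tofrac1 divr1.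
- apply/asboolP; exists (a * t - b * s), (s * t).
  rewrite prime_idealrM negb_or ps pt; split=> //.
  by rewrite -mulNr addf_div ?nz // -!tofracM -tofracN -tofracM -tofracD mulNr.
- apply/asboolP; exists (a * b), (s * t).
  by rewrite prime_idealrM negb_or ps pt !tofracM mulf_div.
Qed.

Record local_ring :=
  LocalRing { loc_val : {fraction D}; _ : loc_val \in loc_pred }.

HB.instance Definition _ := [isSub for loc_val].
HB.instance Definition _ := [Choice of local_ring by <:].
HB.instance Definition _ :=
  GRing.SubChoice_isSubComNzRing.Build _ loc_pred local_ring loc_closed.

End Localization.

(* A subalgebra of the centre of [A] whose nonzero elements are not zero
   divisors in [A]; in particular it is a domain. *)
Record central_subdomain (k : fieldType) (A : algType k) := CentralSubdomain {
  csd_pred :> {pred A};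
  csd_subalg : GRing.subalg_closed csd_pred;
  csd_central : forall z a : A, z \in csd_pred -> z * a = a * z;
  csd_regular : forall z a : A,
    z \in csd_pred -> z != 0 -> z * a = 0 -> a = 0
}.

Section CentralSubdomain.
Variables (k : fieldType) (A : algType k) (Z : central_subdomain A).

(* [Z] as a ring; units and inverses are obtained by classical choice *)
Record csd := Csd { csd_val : A; _ : csd_val \in csd_pred Z }.

HB.instance Definition _ := [isSub for csd_val].
HB.instance Definition _ := [Choice of csd by <:].
HB.instance Definition _ :=
  GRing.SubChoice_isSubAlgebra.Build k A (mem (csd_pred Z)) csd (csd_subalg Z).

Lemma csd_mulC : @commutative csd csd *%R.
Proof.
move=> x y; apply: val_inj; rewrite !rmorphM.
exact: csd_central (valP x).
Qed.

HB.instance Definition _ := GRing.PzRing_hasCommutativeMul.Build csd csd_mulC.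

Definition csd_unit : {pred csd} := fun x => `[< exists y, y * x = 1 >].
Definition csd_inv (x : csd) : csd :=
  if pselect (exists y, y * x = 1) is left _
  then xget 0 [set y | y * x = 1]%classic else x.

Lemma csd_mulVx : {in csd_unit, left_inverse 1 csd_inv *%R}.
Proof.
move=> x /asboolP ex; rewrite /csd_inv; case: pselect => // -[y yx].
by case: xgetP => [z -> //|/(_ y)].
Qed.

Lemma csd_unitPl (x y : csd) : y * x = 1 -> csd_unit x.
Proof. by move=> yx; apply/asboolP; exists y. Qed.

Lemma csd_invr_out : {in [predC csd_unit], csd_inv =1 id}.
Proof. by move=> x /asboolPn nex; rewrite /csd_inv; case: pselect. Qed.

HB.instance Definition _ :=
  GRing.ComNzRing_hasMulInverse.Build csd csd_mulVx csd_unitPl csd_invr_out.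

Lemma csd_integral : GRing.integral_domain_axiom csd.
Proof.
move=> x y xy0; have [//|nx] /= := eqVneq x 0; apply/eqP/val_inj.
rewrite rmorph0; apply: (csd_regular (valP x)).
  by apply: contraNneq nx => vx; apply/eqP/val_inj; rewrite vx rmorph0.
by rewrite -rmorphM xy0 rmorph0.
Qed.

HB.instance Definition _ := GRing.ComUnitRing_isIntegral.Build csd csd_integral.

Definition csd_frac : Type := {fraction csd}.

HB.instance Definition _ := GRing.Field.on csd_frac.

Definition of_csd (z : csd) : csd_frac := tofrac z.
Definition csd_frac_scale (c : k) (q : csd_frac) : csd_frac := of_csd c%:A * q.

Lemma csd_frac_scalerA a b q :
  csd_frac_scale a (csd_frac_scale b q) = csd_frac_scale (a * b) q.
Proof.
rewrite /csd_frac_scale mulrA -[of_csd _ * of_csd _]tofracM.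
by rewrite -scalerAl mul1r scalerA.
Qed.

Lemma csd_frac_scale1r : left_id 1 csd_frac_scale.
Proof. by move=> q; rewrite /csd_frac_scale scale1r [of_csd 1]tofrac1 mul1r. Qed.

Lemma csd_frac_scalerDr : right_distributive csd_frac_scale +%R.
Proof. by move=> a p q; rewrite /csd_frac_scale mulrDr. Qed.

Lemma csd_frac_scalerDl q : {morph csd_frac_scale^~ q : a b / a + b}.
Proof.
by move=> a b; rewrite /csd_frac_scale scalerDl [of_csd (_ + _)]tofracD mulrDl.
Qed.

HB.instance Definition _ := GRing.Zmodule_isLmodule.Build k csd_frac
  csd_frac_scalerA csd_frac_scale1r csd_frac_scalerDr csd_frac_scalerDl.

Lemma csd_frac_scalerAl (c : k) (p q : csd_frac) : c *: (p * q) = c *: p * q.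
Proof. exact: mulrA. Qed.

HB.instance Definition _ :=
  GRing.Lmodule_isLalgebra.Build k csd_frac csd_frac_scalerAl.

Lemma csd_frac_scalerAr (c : k) (p q : csd_frac) : c *: (p * q) = p * (c *: q).
Proof. exact: mulrCA. Qed.

HB.instance Definition _ :=
  GRing.Lalgebra_isAlgebra.Build k csd_frac csd_frac_scalerAr.

Definition balanced (G : zmodType) (b : csd_frac -> A -> G) : Prop :=
  [/\ forall a p q, b (p + q) a = b p a + b q a,
      forall q a a', b q (a + a') = b q a + b q a'
    & forall z q a, b (of_csd z * q) a = b q (val z * a)].

Definition tens_eval (G : zmodType) (b : csd_frac -> A -> G)
    (s : seq (csd_frac * A)) : G := \sum_(x <- s) b x.1 x.2.

(* A list stands for the sum of the pure tensors [x.1 (x) x.2] over its entries;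
   two such sums are equal in the tensor product exactly when no balanced map
   separates them. *)
Definition tens_rel (s t : seq (csd_frac * A)) : bool :=
  `[< forall (G : zmodType) (b : csd_frac -> A -> G),
        balanced b -> tens_eval b s = tens_eval b t >].

Lemma tens_rel_equiv : equiv_class_of tens_rel.
Proof.
split=> [s|s t|t s u].
- exact/asboolP.
- by apply/asboolP/asboolP => h G b bb; rewrite h.
- move=> /asboolP h1 /asboolP h2; apply/asboolP => G b bb.
  by rewrite (h1 _ _ bb) h2.
Qed.

Canonical tens_equiv := EquivRelPack tens_rel_equiv.
Canonical tens_encModRel := defaultEncModRel tens_rel.

Definition frac_tensor : Type := {eq_quot tens_rel}.

HB.instance Definition _ := Choice.on frac_tensor.
HB.instance Definition _ := EqQuotient.on frac_tensor.

Local Notation pi := (\pi_frac_tensor).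

Lemma tens_piP s t :
  (forall (G : zmodType) b, @balanced G b -> tens_eval b s = tens_eval b t) <->
  pi s = pi t.
Proof.
split=> [h|/eqmodP/asboolP //].
by apply/eqmodP/asboolP.
Qed.

Lemma tens_evalE (G : zmodType) b s : @balanced G b ->
  tens_eval b (repr (pi s)) = tens_eval b s.
Proof. by move=> bb; have /tens_piP h := reprK (pi s); apply: h. Qed.

Lemma tens_eval_cat (G : zmodType) b s t :
  @tens_eval G b (s ++ t) = tens_eval b s + tens_eval b t.
Proof. exact: big_cat. Qed.

Definition scale_seq (c : csd_frac) (s : seq (csd_frac * A)) :=
  [seq (c * x.1, x.2) | x <- s].
Definition mul_seq (s t : seq (csd_frac * A)) :=
  [seq (x.1 * y.1, x.2 * y.2) | x <- s, y <- t].

Lemma tens_eval_scale (G : zmodType) b c s :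
  @tens_eval G b (scale_seq c s) = tens_eval (fun q => b (c * q)) s.
Proof. by rewrite /tens_eval big_map. Qed.

Lemma tens_eval_mul (G : zmodType) b s t : @tens_eval G b (mul_seq s t) =
  tens_eval (fun q a => tens_eval (fun q' a' => b (q * q') (a * a')) t) s.
Proof. by rewrite /tens_eval big_allpairs_dep. Qed.

Lemma balanced_scale (G : zmodType) b c :
  @balanced G b -> balanced (fun q => b (c * q)).
Proof.
by case=> bl br bz; split=> *; rewrite ?mulrDr ?bl ?br // mulrCA bz.
Qed.

Lemma balanced_mulr (G : zmodType) b q a :
  @balanced G b -> balanced (fun q' a' => b (q * q') (a * a')).
Proof.
case=> bl br bz; split=> *; rewrite ?mulrDr ?bl ?br // mulrCA bz.
by rewrite !mulrA (csd_central _ (valP _)).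
Qed.

Lemma balanced_mull (G : zmodType) b t : @balanced G b ->
  balanced (fun q a => tens_eval (fun q' a' => b (q * q') (a * a')) t).
Proof.
case=> bl br bz; split=> *; rewrite /tens_eval -?big_split; apply: eq_bigr => x _ /=.
- by rewrite mulrDl bl.
- by rewrite mulrDl br.
- by rewrite -mulrA bz mulrA.
Qed.

Definition tens_zero : frac_tensor := pi [::].
Definition tens_one : frac_tensor := pi [:: (1, 1)].
Definition tens_add (u v : frac_tensor) : frac_tensor := pi (repr u ++ repr v).
Definition tens_scale (c : csd_frac) (u : frac_tensor) : frac_tensor :=
  pi (scale_seq c (repr u)).
Definition tens_opp : frac_tensor -> frac_tensor := tens_scale (-1).
Definition tens_mul (u v : frac_tensor) : frac_tensor :=
  pi (mul_seq (repr u) (repr v)).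

Lemma tens_addE s t : tens_add (pi s) (pi t) = pi (s ++ t).
Proof. by apply/tens_piP => G b bb; rewrite !tens_eval_cat !tens_evalE. Qed.

Lemma tens_scaleE c s : tens_scale c (pi s) = pi (scale_seq c s).
Proof.
apply/tens_piP => G b bb; rewrite !tens_eval_scale tens_evalE //.
exact: balanced_scale.
Qed.

Lemma tens_eval_mulC (G : zmodType) b s t :
  tens_eval (fun q a => tens_eval (fun q' a' => b (q * q') (a * a')) t) s =
  @tens_eval G (fun q' a' => tens_eval (fun q a => b (q * q') (a * a')) s) t.
Proof. exact: exchange_big. Qed.

Lemma tens_mulE s t : tens_mul (pi s) (pi t) = pi (mul_seq s t).
Proof.
apply/tens_piP => G b bb; rewrite !tens_eval_mul tens_evalE; last exact: balanced_mull.
by apply: eq_bigr => x _; rewrite tens_evalE //; apply: balanced_mulr.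
Qed.

Lemma tens_addA : associative tens_add.
Proof.
elim/quotW=> s; elim/quotW=> t; elim/quotW=> u.
rewrite (tens_addE t u) (tens_addE s) (tens_addE s t) tens_addE.
by rewrite catA.
Qed.

Lemma tens_addC : commutative tens_add.
Proof.
elim/quotW=> s; elim/quotW=> t; rewrite !tens_addE; apply/tens_piP => G b bb.
by rewrite !tens_eval_cat addrC.
Qed.

Lemma tens_add0 : left_id tens_zero tens_add.
Proof. by elim/quotW=> s; rewrite tens_addE. Qed.

Lemma balanced0 (G : zmodType) b a : @balanced G b -> b 0 a = 0.
Proof. by case=> bl _ _; apply: (addrI (b 0 a)); rewrite -bl !addr0. Qed.

Lemma tens_addN : left_inverse tens_zero tens_opp tens_add.
Proof.
elim/quotW=> s; rewrite [tens_opp _]tens_scaleE tens_addE; apply/tens_piP => G b bb.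
rewrite tens_eval_cat tens_eval_scale /tens_eval big_nil -big_split big1 // => x _ /=.
by have [bl _ _] := bb; rewrite -bl mulN1r addNr balanced0.
Qed.

HB.instance Definition _ :=
  GRing.isZmodule.Build frac_tensor tens_addA tens_addC tens_add0 tens_addN.

Lemma tens_mulA : associative tens_mul.
Proof.
elim/quotW=> s; elim/quotW=> t; elim/quotW=> u.
rewrite (tens_mulE t u) (tens_mulE s) (tens_mulE s t) tens_mulE.
apply/tens_piP => G b bb; rewrite !tens_eval_mul.
apply: eq_bigr => x _; rewrite !tens_eval_mul; apply: eq_bigr => y _.
by apply: eq_bigr => z _; rewrite !mulrA.
Qed.

Lemma tens_mul1 : left_id tens_one tens_mul.
Proof.
elim/quotW=> s; rewrite tens_mulE; congr pi.
by rewrite /mul_seq /= cats0 -[RHS]map_id; apply: eq_map => -[q a]; rewrite !mul1r.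
Qed.

Lemma tens_mulr1 : right_id tens_one tens_mul.
Proof.
elim/quotW=> s; rewrite tens_mulE; apply/tens_piP => G b bb.
rewrite tens_eval_mul; apply: eq_bigr => x _.
by rewrite /tens_eval big_seq1 !mulr1.
Qed.

Lemma tens_mulDl : left_distributive tens_mul +%R.
Proof.
elim/quotW=> s; elim/quotW=> t; elim/quotW=> u.
rewrite -[pi s + _]/(tens_add _ _) (tens_addE s t) !(tens_mulE, tens_mulE _ u).
rewrite -[RHS]/(tens_add _ _) tens_addE.
by apply/tens_piP => G b bb; rewrite tens_eval_cat !tens_eval_mul tens_eval_cat.
Qed.

Lemma tens_mulDr : right_distributive tens_mul +%R.
Proof.
elim/quotW=> s; elim/quotW=> t; elim/quotW=> u.
rewrite -[pi t + _]/(tens_add _ _) (tens_addE t u) (tens_mulE s) !(tens_mulE s _).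
rewrite -[RHS]/(tens_add _ _) tens_addE.
apply/tens_piP => G b bb; rewrite tens_eval_cat !tens_eval_mul /tens_eval -big_split.
by apply: eq_bigr => x _; rewrite big_cat.
Qed.


(* The balanced map sending [q (x) a] to the germ of [t |-> (t q) a], on
   multiples [t] of a denominator of [q], shows that [1 (x) 1] is nonzero. *)
Definition germ0 : pred (csd -> A) :=
  fun f => `[< exists2 s, s != 0 & forall t, f (s * t) = 0 >].

Lemma germ0_closed : zmod_closed (germ0 : {pred (csd -> A)}).
Proof.
split=> [|f g /asboolP[s s0 fs] /asboolP[t t0 gt]]; apply/asboolP.
  by exists 1; rewrite ?oner_neq0.
exists (s * t) => [|u]; first by rewrite mulf_neq0.
by rewrite -mulrA fctE fs mulrCA opprfctE gt subr0.
Qed.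

Definition germ_zmod : zmodClosed (csd -> A) :=
  HB.pack_for (zmodClosed (csd -> A)) germ0
    (GRing.isZmodClosed.Build (csd -> A) germ0 germ0_closed).

Definition germ (f : csd -> A) : Quotient.quot germ_zmod :=
  \pi_(Quotient.quot germ_zmod) f.

Definition germ_num (q : csd_frac) (t : csd) : csd :=
  xget 0 [set z | of_csd z = of_csd t * q]%classic.

Lemma of_csd_inj : injective of_csd.
Proof. by move=> x y /eqP; rewrite tofrac_eq => /eqP. Qed.

Lemma germ_numE q t z : of_csd z = of_csd t * q -> germ_num q t = z.
Proof.
move=> zq; rewrite /germ_num; case: xgetP => [y _ /= yq|/(_ z) //].
by apply: of_csd_inj; rewrite zq.
Qed.

Lemma csd_fracP (q : csd_frac) :
  exists d n, d != 0 /\ of_csd n = of_csd d * q.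
Proof.
elim/quotW: q => x; exists x.2, x.1; split; first exact: denom_ratioP.
rewrite /of_csd; unlock FracField.tofrac.
rewrite -[RHS]FracField.pi_mul; apply/eqmodP => /=.
rewrite FracField.equivfE /FracField.mulf !numden_Ratio ?mulf_neq0 ?oner_eq0 //.
- by rewrite !mul1r mulrC.
- exact: denom_ratioP.
- exact: denom_ratioP.
Qed.

Definition germ_map (q : csd_frac) (a : A) : Quotient.quot germ_zmod :=
  germ (fun t => val (germ_num q t) * a).

Lemma germP f g s : s != 0 -> (forall t, f (s * t) = g (s * t)) ->
  germ f = germ g.
Proof.
move=> s0 fg; apply/eqP; rewrite -Quotient.idealrBE.
by apply/asboolP; exists s => // t; rewrite !fctE fg subrr.
Qed.

Lemma germ_map_balanced : balanced germ_map.
Proof.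
split=> [a p q|q a a'|z q a].
- have [d [n [d0 dp]]] := csd_fracP p; have [e [m [e0 eq]]] := csd_fracP q.
  rewrite -[RHS](raddfD \pi_(Quotient.quot germ_zmod)).
  apply: (@germP _ _ (d * e)) => [|t]; first by rewrite mulf_neq0.
  rewrite fctE -mulrDl -rmorphD; congr (val _ * _).
  have hp : of_csd (n * (e * t)) = of_csd (d * e * t) * p.
    by rewrite [of_csd _]tofracM -/(of_csd n) dp mulrAC -[RHS]/(_ * p) -tofracM mulrA.
  have hq : of_csd (m * (d * t)) = of_csd (d * e * t) * q.
    by rewrite [of_csd _]tofracM -/(of_csd m) eq mulrAC -[RHS]/(_ * q) -tofracM mulrA [e * d]mulrC.
  rewrite (germ_numE hp) (germ_numE hq); apply: germ_numE.
  by rewrite mulrDr -hp -hq; apply: tofracD.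
- rewrite -[RHS](raddfD \pi_(Quotient.quot germ_zmod)).
  by congr germ; apply/funext => t; rewrite fctE mulrDr.
- have [d [n [d0 dq]]] := csd_fracP q.
  apply: (@germP _ _ d) => // t.
  have hq : of_csd (n * t) = of_csd (d * t) * q.
    by rewrite [of_csd _]tofracM -/(of_csd n) dq mulrAC -[RHS]/(_ * q) -tofracM.
  have hz : of_csd (z * (n * t)) = of_csd (d * t) * (of_csd z * q).
    by rewrite [of_csd _]tofracM -/(of_csd (n * t)) hq mulrCA.
  rewrite (germ_numE hq) (germ_numE hz) rmorphM mulrA.
  by rewrite (csd_central _ (valP z)).
Qed.

Lemma tens_one_neq0 : tens_one != 0.
Proof.
apply/eqP => /tens_piP/(_ _ _ germ_map_balanced).
rewrite /tens_eval big_seq1 big_nil -(raddf0 \pi_(Quotient.quot germ_zmod)).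
move/eqP; rewrite -Quotient.idealrBE => /asboolP[s s0 /(_ 1)].
rewrite !fctE subr0 !mulr1 (@germ_numE _ _ s) ?mulr1 // => vs.
by move/eqP: s0; apply; apply: val_inj; rewrite vs rmorph0.
Qed.

HB.instance Definition _ := GRing.Zmodule_isNzRing.Build frac_tensor
  tens_mulA tens_mul1 tens_mulr1 tens_mulDl tens_mulDr tens_one_neq0.

Lemma tens_scalerA c d u : tens_scale c (tens_scale d u) = tens_scale (c * d) u.
Proof.
elim/quotW: u => s; rewrite (tens_scaleE d s) (tens_scaleE c) (tens_scaleE _ s); congr pi.
by rewrite /scale_seq -map_comp; apply: eq_map => x /=; rewrite mulrA.
Qed.

Lemma tens_scale1r : left_id 1 tens_scale.
Proof.
elim/quotW=> s; rewrite !tens_scaleE; congr pi.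
by rewrite /scale_seq -[RHS]map_id; apply: eq_map => -[q a]; rewrite mul1r.
Qed.

Lemma tens_scalerDr : right_distributive tens_scale +%R.
Proof.
move=> c; elim/quotW=> s; elim/quotW=> t.
rewrite -[_ + _]/(tens_add _ _) tens_addE !tens_scaleE -[RHS]/(tens_add _ _) tens_addE.
by rewrite /scale_seq map_cat.
Qed.

Lemma tens_scalerDl u : {morph tens_scale^~ u : c d / c + d}.
Proof.
elim/quotW: u => s c d; rewrite !tens_scaleE -[RHS]/(tens_add _ _) tens_addE.
apply/tens_piP => G b [bl _ _]; rewrite tens_eval_cat !tens_eval_scale.
by rewrite /tens_eval -big_split; apply: eq_bigr => x _; rewrite mulrDl bl.
Qed.

HB.instance Definition _ := GRing.Zmodule_isLmodule.Build csd_frac frac_tensor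
  tens_scalerA tens_scale1r tens_scalerDr tens_scalerDl.

Lemma tens_scalerAl (c : csd_frac) (u v : frac_tensor) : c *: (u * v) = c *: u * v.
Proof.
elim/quotW: u => s; elim/quotW: v => t.
rewrite -[LHS]/(tens_scale c (tens_mul _ _)) -[RHS]/(tens_mul (tens_scale c _) _).
rewrite tens_mulE !tens_scaleE tens_mulE; apply/tens_piP => G b bb.
rewrite tens_eval_scale !tens_eval_mul tens_eval_scale.
by do 2!apply: eq_bigr => ? _; rewrite mulrA.
Qed.

HB.instance Definition _ :=
  GRing.Lmodule_isLalgebra.Build csd_frac frac_tensor tens_scalerAl.

Lemma tens_scalerAr (c : csd_frac) (u v : frac_tensor) : c *: (u * v) = u * (c *: v).
Proof.
elim/quotW: u => s; elim/quotW: v => t.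
rewrite -[LHS]/(tens_scale c (tens_mul _ _)) -[RHS]/(tens_mul _ (tens_scale c _)).
rewrite tens_mulE !tens_scaleE tens_mulE; apply/tens_piP => G b bb.
rewrite tens_eval_scale !tens_eval_mul; apply: eq_bigr => x _.
by rewrite tens_eval_scale; apply: eq_bigr => y _; rewrite mulrCA.
Qed.

HB.instance Definition _ :=
  GRing.Lalgebra_isAlgebra.Build csd_frac frac_tensor tens_scalerAr.

Section Extension.
Variable m : idealr csd.

Definition ext_pred : pred A^o := fun x =>
  `[< exists s : seq (csd * A),
        all (fun y => y.1 \in m) s /\ x = \sum_(y <- s) val y.1 * y.2 >].

Lemma ext_closed : submod_closed ext_pred.
Proof.
split=> [|c _ _ /asboolP[s [sm ->]] /asboolP[t [tm ->]]]; apply/asboolP.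
  by exists [::]; rewrite big_nil.
exists ([seq (y.1, c * y.2) | y <- s] ++ t); split.
  by rewrite all_cat all_map tm andbT.
rewrite big_cat big_map /= -[c *: _]/(c * _) mulr_sumr; congr (_ + _).
by apply: eq_bigr => y _; rewrite !mulrA (csd_central _ (valP y.1)).
Qed.

Definition ext_ideal : submodClosed A^o :=
  HB.pack_for (submodClosed A^o) ext_pred
    (GRing.isSubmodClosed.Build A A^o ext_pred ext_closed).

End Extension.

End CentralSubdomain.

(* A maximal ideal is prime, so nothing is lost by taking [m] in the type of
   prime ideals, at which [csd Z] can be localized. *)
Definition good_ideal (R : realType) (k : fieldType) (A : algType k)
    (Z : central_subdomain A) (m : prime_idealr (csd Z)) : Prop :=
  [/\ maximal_ideal m, regular_local_ring (local_ring m),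
      exists a : A, a \notin ext_ideal m
    & (GKdim R (lquot (ext_ideal m)) <= GKdim_alg R (frac_tensor Z))%E].

(* Main.v *)
(** Let [d] be the transcendence degree of [Z] over [k], which is also the
    GK dimension of its field of fractions [Q(Z)].

    Lower bound.  Monomials in [d] algebraically independent elements of [Z]
    times a [Q(Z)]-basis of the span of the words of length [n] are linearly
    independent over [k], so GKdim A >= GKdim (A (x) Q(Z)) + d.

    Upper bound.  By the Cohen-Macaulay property of [M = A/mA] it is enough to
    show that its grade is at most [d].  Take a maximal [A]-regular sequence
    [x_1, ..., x_r] in [m].  Along the quotients [L_i = A/(x_1, ..., x_i)A] the
    annihilators in [Z] form a chain of ideals along which a polynomial relation
    between the [x_i] can be divided down to a nonzero constant, so the [x_i] are
    algebraically independent and [r <= d].  Every element of [m] has a kernel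
    on [L_r], hence (noetherianity and a Vandermonde argument) some nonzero
    element of [L_r] is killed by [m]; thus Hom(M, L_r) <> 0, and the long exact
    sequences for 0 -> L_i -> L_i -> L_(i+1) -> 0 give Ext^j(M, A) <> 0 for some
    [j <= r].

    Existence of [m].  Let [t] be a separating transcendence basis of [Z].  For a
    point [la] of [k^d] outside countably many hypersurfaces, going up over the
    primes (t_1 - la_1, ..., t_i - la_i) of [k[t]] yields a chain of primes of
    [Z] ending in a maximal ideal [m] such that [m Z_m] is generated by the
    [t_i - la_i].  Extracting greedily a [Q(Z)]-basis from an enumeration of the
    words in generators of [A] bounds the growth of [A/mA], and gives a [Z]-linear
    map from [A] to [Z_m] sending 1 to 1, which shows that [m A <> A] and that
    [Z_m] inherits noetherianity from [A]. *)

Require Import Defs.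
From HB Require Import structures.
From mathcomp Require Import all_boot all_order all_algebra fraction.
From mathcomp Require Import generic_quotient ring_quotient.
From mathcomp Require Import boolp classical_sets functions cardinality reals ereal.
From mathcomp Require Import topology normedtype sequences exp.
From mathcomp Require Import -(notations) finmap.
From mathcomp Require Import -(notations) monalg.
From mathcomp Require Import -(notations) mpoly.
From mathcomp Require Import zify ring lra.

Set Implicit Arguments.
Unset Strict Implicit.
Unset Printing Implicit Defensive.

Import Order.TTheory GRing.Theory Num.Theory.
Local Open Scope ring_scope.
Local Open Scope quotient_scope.

(** * Growth and dimensions of spans *)

(** Both dimension bounds for [Z] come from one notion, [regular_chain]. The annihilators of the
    successive quotients of [A] form such a chain, and so do the contractions to [Z] of a chain of
    primes of a localization; [regular_chain_algindep] therefore bounds the grade as well as the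
    Krull dimension of [Z_m]. The obstacle in the upper bound is the end of the regular sequence.
    Each single element of [m] kills some nonzero vector of [L_r], a common one is wanted, and [L_r]
    need not be finitely generated over [Z]. Along the curve [sum la^i m_i] noetherianity forces two
    disjoint finite sets of parameters [la] to share a killed vector, so the number of parameters
    killing one vector can be doubled until it reaches the number of generators [m_i]. Fraction
    fields and localizations are mostly handled with denominators cleared ([algebraic_elt],
    [locgen], [integral_outside], [dependent], [in_loc]). Every denominator is then an element of
    [k[t]] or of [Z] that a point can avoid; for the existence of [m] there are countably many of
    them, one for each word of [A], which is where an uncountable [k] enters. *)

Section LinearAlgebra.
Variables (K : fieldType) (A : algType K) (M : lmodType A).
Implicit Types (s t : seq M) (x y : M).

(** Modules carry only an action of [A], so scalars of [K] act through [c%:A]. Coefficients are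
    indexed by [nat] so that they can be chosen without reference to the length of the list. *)
Definition kspan s x : Prop :=
  exists c : nat -> K, x = \sum_(i < size s) (c i)%:A *: s`_i.

Lemma kspan0 s : kspan s 0.
Proof. by exists (fun=> 0); rewrite big1 // => i _; rewrite !scale0r. Qed.

Lemma kspanD s x y : kspan s x -> kspan s y -> kspan s (x + y).
Proof.
move=> [c ->] [d ->]; exists (fun i => c i + d i); rewrite -big_split /=.
by apply: eq_bigr => i _; rewrite !scalerDl.
Qed.

Lemma kspanZ s (a : K) x : kspan s x -> kspan s (a%:A *: x).
Proof.
move=> [c ->]; exists (fun i => a * c i); rewrite scaler_sumr.
by apply: eq_bigr => i _; rewrite scalerA -scalerAl mul1r scalerA.
Qed.

Lemma kspan_sum s (I : Type) (r : seq I) (P : pred I) (F : I -> M) :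
  (forall i, P i -> kspan s (F i)) -> kspan s (\sum_(i <- r | P i) F i).
Proof. by move=> h; apply: big_ind; [exact: kspan0|exact: kspanD|]. Qed.

Lemma kspan_mem s x : x \in s -> kspan s x.
Proof.
move=> xs; have ix : (index x s < size s)%N by rewrite index_mem.
exists (fun i => (i == index x s)%:R).
rewrite (bigD1 (Ordinal ix)) //= eqxx !scale1r nth_index //.
by rewrite big1 ?addr0 // => j; rewrite -val_eqE /= => /negbTE ->; rewrite !scale0r.
Qed.

Lemma kspan_ind s (P : M -> Prop) :
  P 0 -> (forall x y, P x -> P y -> P (x + y)) ->
  (forall (a : K) x, P x -> P (a%:A *: x)) -> {in s, forall x, P x} ->
  forall x, kspan s x -> P x.
Proof.
move=> P0 PD PZ Ps x [c ->]; apply: big_ind => // i _.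
by apply: PZ; apply: Ps; apply: mem_nth.
Qed.

Lemma kspan_trans s t : {in s, forall x, kspan t x} ->
  forall x, kspan s x -> kspan t x.
Proof.
by move=> h; apply: kspan_ind => //; [exact: kspan0|exact: kspanD|exact: kspanZ].
Qed.

Lemma sub_kspan s t : {subset s <= t} -> forall x, kspan s x -> kspan t x.
Proof. by move=> st; apply: kspan_trans => x /st/kspan_mem. Qed.

Definition indep n (x : 'I_n -> M) : Prop :=
  forall c : 'I_n -> K, \sum_i (c i)%:A *: x i = 0 -> forall i, c i = 0.

(** If the bound failed, the coordinates of the [x i] in [s] would form a matrix with more rows than
    columns, and a nonzero vector of its left kernel would be a relation. *)
Lemma indep_le_size n (x : 'I_n -> M) s :
  indep x -> (forall i, kspan s (x i)) -> (n <= size s)%N.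
Proof.
move=> ix xs; rewrite leqNgt; apply/negP => ns.
have [c cE] := choice xs.
pose C := \matrix_(i < n, j < size s) c i j.
have : kermx C != 0.
  by rewrite kermx_eq0 /row_free; apply/eqP => rC; have := rank_leq_col C; lia.
case/rowV0Pn => v /sub_kermxP vC v0.
have vz : forall i, v 0 i = 0.
  apply: ix; rewrite (eq_bigr (fun i => \sum_(j < size s) (v 0 i * c i j)%:A *: s`_j)).
    rewrite exchange_big /= big1 // => j _; rewrite -scaler_suml.
    suff -> : \sum_(i < n) (v 0 i * c i j)%:A = 0 :> A by rewrite scale0r.
    rewrite -scaler_suml; suff -> : \sum_(i < n) v 0 i * c i j = 0 by rewrite scale0r.
    move/matrixP/(_ 0 j): vC; rewrite !mxE => vC; rewrite -[RHS]vC.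
    by apply: eq_bigr => i _; rewrite mxE.
  move=> i _; rewrite {1}cE scaler_sumr; apply: eq_bigr => j _.
  by rewrite scalerA -scalerAl mul1r scalerA.
by move/eqP: v0; apply; apply/rowP => i; rewrite vz mxE.
Qed.

Lemma lin_indep_enum s (I : {set 'I_(size s)}) :
  lin_indep (tnth (in_tuple s)) I ->
  indep (fun i : 'I_#|I| => s`_(enum_val i)).
Proof.
move=> li c h i.
pose d (j : 'I_(size s)) :=
  if insub (index j (enum I)) is Some u then c u else 0 : K.
have dE u : d (enum_val u) = c u.
  rewrite /d (enum_val_nth (enum_val u)) index_uniq ?enum_uniq -?cardE //.
  by case: insubP => [v _ /val_inj ->|]; rewrite ?ltn_ord.
have := li d; rewrite big_enum_val.
under eq_bigr => u _ do rewrite dE (tnth_nth 0) /=.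
by move=> /(_ h) /(_ (enum_val i) (enum_valP i)); rewrite dE.
Qed.

Lemma span_dim_le s t : {in s, forall x, kspan t x} ->
  (span_dim s <= size t)%N.
Proof.
move=> st; apply/bigmax_leqP => I /asboolP /lin_indep_enum /indep_le_size; apply.
by move=> i; apply: st; apply: mem_nth.
Qed.

(** A largest independent subfamily spans: adjoining an index [j] outside it creates a relation,
    whose coefficient at [j] is nonzero because the rest is independent. *)
Lemma span_dim_basis s : exists2 I : {set 'I_(size s)},
  #|I| = span_dim s & forall x, kspan s x ->
    kspan [seq s`_(i : 'I__) | i <- enum I] x.
Proof.
pose P (I : {set 'I_(size s)}) := `[< lin_indep (tnth (in_tuple s)) I >].
have P0 : P finset.set0 by apply/asboolP => c _ i; rewrite finset.in_set0.
case: (@arg_maxnP _ finset.set0 P (fun I : {set 'I_(size s)} => #|I|) P0) => I PI Imax.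
exists I.
  apply/eqP; rewrite eqn_leq (@leq_bigmax_cond _ P (fun I : {set 'I_(size s)} => #|I|)) //=.
  by apply/bigmax_leqP => J PJ; apply: Imax.
apply: kspan_trans => x xs; pose j := Ordinal (etrans (index_mem x s) xs : is_true _).
have sj : s`_j = x by rewrite nth_index.
have [jI|jI] := boolP (j \in I).
  by apply: kspan_mem; rewrite -sj; apply/mapP; exists j; rewrite ?mem_enum.
have nP : ~~ P (j |: I).
  by apply/negP => /Imax; rewrite cardsU1 jI /= add1n ltnn.
have [c [cs [i ij ci]]] : exists c : 'I_(size s) -> K,
    \sum_(i in (j |: I)) (c i)%:A *: tnth (in_tuple s) i = 0 /\
    exists2 i, i \in (j |: I) & c i <> 0.
  move/asboolPn: nP => /existsNP[c /not_implyP[cs /existsNP[i /not_implyP[ii ci]]]].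
  by exists c; split=> //; exists i.
have cj : c j != 0.
  apply: contra_notN ci => /eqP cj0; move: cs; rewrite big_setU1 //= cj0 !scale0r add0r.
  move/asboolP: PI => /[apply]; move: ij.
  by rewrite in_setU1 => /orP[/eqP -> //|iI /(_ i iI)].
move: cs; rewrite big_setU1 //= (tnth_nth 0) /= sj => /eqP.
rewrite addr_eq0 => /eqP cx.
have -> : x = (- (c j)^-1)%:A *: (\sum_(i in I) (c i)%:A *: tnth (in_tuple s) i).
  rewrite -[X in _ *: X]opprK -cx scaleNr scaleNr scalerN opprK scalerA -scalerAl mul1r.
  by rewrite scalerA mulVf // !scale1r.
apply: kspanZ; apply: kspan_sum => i' iI; apply: kspanZ; apply: kspan_mem.
by apply/mapP; exists i'; rewrite ?mem_enum // (tnth_nth 0).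
Qed.

Lemma span_dim_ge s n (x : 'I_n -> M) :
  indep x -> (forall i, kspan s (x i)) -> (n <= span_dim s)%N.
Proof.
have [I <- sI] := span_dim_basis s => ix xs.
rewrite cardE -(size_map (fun i : 'I_(size s) => s`_i)).
by apply: indep_le_size ix _ => i; apply/sI/xs.
Qed.

End LinearAlgebra.

Section Growth.
Variable R : realType.
Implicit Types (u : nat -> \bar R) (D E : nat -> nat).

Lemma limn_esup_le_near u (y : \bar R) N :
  (forall n, (N <= n)%N -> (u n <= y)%E) -> (limn_esup u <= y)%E.
Proof.
move=> h; apply: (@le_trans _ _ (ereal_sup [set u x | x in [set n | (N <= n)%N]]%classic)).
  apply: ereal_inf_lbound; exists [set n | (N <= n)%N]%classic => //.
  by exists N.
by apply/ereal_supP => _ [n Nn <-]; apply: h.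
Qed.

Lemma limn_esup_ge u (y : \bar R) :
  (forall (S : \bar R) N, (forall n, (N <= n)%N -> (u n <= S)%E) -> (y <= S)%E) ->
  (y <= limn_esup u)%E.
Proof.
move=> h; apply/ereal_infP => _ [V [N _ NV] <-]; apply: (h _ N) => n Nn.
by apply: ereal_sup_ubound; exists n => //; apply: NV.
Qed.

Lemma ln_nat_unbounded (c : R) : exists2 N, (1 < N)%N &
  forall n, (N <= n)%N -> c <= ln n%:R.
Proof.
have [N hN] : exists N : nat, expR c <= N%:R.
  by exists (Num.bound (expR c)); apply/ltW/archi_boundP/expR_ge0.
exists (maxn N 2) => [|n]; first by rewrite leq_max orbT.
rewrite geq_max => /andP[Nn n2]; rewrite -[c]expRK ler_ln ?posrE ?expR_gt0 ?ltr0n //; last by lia.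
by apply: le_trans hN _; rewrite ler_nat.
Qed.

Definition growth D : \bar R :=
  limn_esup (fun n => (ln (D n)%:R / ln n%:R : R)%:E).

Lemma ln_nat_ge0 n : 0 <= ln (n%:R : R).
Proof. by case: n => [|n]; [rewrite ln0|apply: ln_ge0; rewrite ler1n]. Qed.

Lemma ler_ln_nat m n : (m <= n)%N -> ln (m%:R : R) <= ln n%:R.
Proof.
case: m => [|m] mn; first by rewrite ln0 // ln_nat_ge0.
by rewrite ler_ln ?ler_nat // posrE ltr0n //; lia.
Qed.

Lemma growth_ge0 D : (0 <= growth D)%E.
Proof.
apply: limn_esup_ge => S N /(_ N (leqnn N)); apply: le_trans.
by rewrite lee_fin divr_ge0 ?ln_nat_ge0.
Qed.

(** For [n >= 1] one has [a * n + b <= (a + b) * n], so the logarithm grows by a constant only,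
    which a small multiple of [ln n] eventually absorbs. *)
Lemma ln_affine_near (a b : nat) (s e : R) : 0 <= s -> 0 < e ->
  exists2 N, (1 < N)%N & forall n, (N <= n)%N ->
    0 < ln n%:R :> R /\ s * ln (a * n + b)%:R <= (s + e) * ln n%:R.
Proof.
move=> s0 e0; have [N N1 hN] := ln_nat_unbounded (Num.max 1 (s * ln (a + b)%:R / e)).
exists N => // n Nn; have := hN _ Nn; rewrite ge_max => /andP[n1 n2].
have n0 : 0 < ln n%:R :> R by apply: lt_le_trans n1.
split=> //; rewrite mulrDl; apply: (@le_trans _ _ (s * (ln (a + b)%:R + ln n%:R))).
  apply: ler_wpM2l => //; case: (posnP (a + b)) => ab.
    have -> : (a * n + b = 0)%N by lia.
    by rewrite ln0 // addr_ge0 // ln_nat_ge0.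
  rewrite -lnM ?posrE ?ltr0n //; last by lia.
  by rewrite -natrM; apply: ler_ln_nat; nia.
rewrite mulrDr addrC lerD2l; move: n2; rewrite ler_pdivrMr // mulrC => /le_trans; apply.
by rewrite mulrC.
Qed.

(** A change of generators stretches word lengths affinely; this lemma makes the growth exponent
    insensitive to it. *)
Lemma growth_le_affine D E a b : (0 < a)%N ->
  (forall n, (D n <= E (a * n + b))%N) -> (growth D <= growth E)%E.
Proof.
move=> a0 DE; apply: limn_esup_ge => -[s||] N hs; last 2 first.
- exact: leey.
- by have := hs N (leqnn N); rewrite leeNy_eq => /eqP.
have s0 : 0 <= s.
  have := hs N (leqnn N); rewrite lee_fin; apply: le_trans.
  by rewrite divr_ge0 ?ln_nat_ge0.
apply/lee_addgt0Pr => e e0; have [N' N1 hN] := ln_affine_near a b s0 e0.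
apply: (@limn_esup_le_near _ _ (maxn N N')) => n; rewrite geq_max => /andP[Nn N'n].
have [n0 le2] := hN _ N'n; rewrite -EFinD lee_fin ler_pdivrMr //.
apply: le_trans (ler_ln_nat (DE n)) _; apply: le_trans le2.
have := hs (a * n + b)%N; rewrite lee_fin ler_pdivrMr; first by apply; nia.
by apply: lt_le_trans n0 _; apply: ler_ln_nat; nia.
Qed.

(** The factor [n.+1 ^ d] contributes at least [d * ln n]. Since [ln 0 = 0], positivity of [E n] is
    what lets the logarithm of the product split. *)
Lemma growth_add D E a d : (0 < a)%N -> (forall n, (0 < E n)%N) ->
  (forall n, (n.+1 ^ d * E n <= D (a * n))%N) ->
  (d%:R%:E + growth E <= growth D)%E.
Proof.
move=> a0 E0 DE; apply: limn_esup_ge => -[s||] N hs; last 2 first.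
- exact: leey.
- by have := hs N (leqnn N); rewrite leeNy_eq => /eqP.
have s0 : 0 <= s.
  have := hs N (leqnn N); rewrite lee_fin; apply: le_trans.
  by rewrite divr_ge0 ?ln_nat_ge0.
rewrite addeC -leeBrDr //; apply/lee_addgt0Pr => e e0.
have [N' N1 hN] := ln_affine_near a 0 s0 e0.
apply: (@limn_esup_le_near _ _ (maxn N N')) => n; rewrite geq_max => /andP[Nn N'n].
have [n0 le2] := hN _ N'n.
rewrite -EFinB -EFinD lee_fin ler_pdivrMr // addrAC mulrBl lerBrDl.
rewrite addn0 in le2; apply: le_trans le2.
apply: (@le_trans _ _ (ln (D (a * n)%N)%:R)).
  apply: le_trans (ler_ln_nat (DE n)).
  rewrite natrM lnM ?posrE ?ltr0n ?expn_gt0 // lerD2r natrX lnXn ?ltr0n // mulr_natl.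
  by rewrite lerMn2r ler_ln_nat ?orbT.
have := hs (a * n)%N; rewrite lee_fin ler_pdivrMr; first by apply; apply: leq_trans Nn (leq_pmull _ a0).
by apply: lt_le_trans n0 _; apply: ler_ln_nat; apply: leq_pmull.
Qed.

Lemma growth_poly D (C B d : nat) :
  (forall n, (D n <= C * (B * n + 1) ^ d)%N) -> (growth D <= d%:R%:E)%E.
Proof.
move=> DC; apply/lee_addgt0Pr => e e0.
(* One half of [e] absorbs [ln C], the other the passage from [ln (B * n + 1)] to [ln n]. *)
have e2 : 0 < e / 2 by apply: divr_gt0.
have [N1 N1g h1] := ln_nat_unbounded (Num.max 1 (ln C%:R / (e / 2))).
have [N2 _ h2] := ln_affine_near B 1 (ler0n R d) e2.
apply: (@limn_esup_le_near _ _ (maxn N1 N2)) => n; rewrite geq_max => /andP[/h1 + /h2].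
rewrite ge_max ler_pdivrMr // => /andP[_ c1] [n0 c2].
rewrite -EFinD lee_fin ler_pdivrMr //; apply: le_trans (ler_ln_nat (DC n)) _.
case: (posnP C) => [->|C0].
  by rewrite mul0n ln0 // mulr_ge0 ?addr_ge0 // ltW.
have -> : (d%:R + e) * ln n%:R = ln n%:R * (e / 2) + (d%:R + e / 2) * ln n%:R by field.
have B0 : (0 < B * n + 1)%N by rewrite addn1.
rewrite natrM lnM ?posrE ?ltr0n ?expn_gt0 ?B0 // natrX lnXn ?ltr0n // -[X in _ + X]mulr_natl.
exact: lerD.
Qed.

End Growth.

#[local] Arguments words : simpl never.

Section Words.
Variables (K : fieldType) (A : algType K) (M : lmodType A).
Implicit Types (V : seq A) (F : seq M) (x y : M).

Lemma scale_inalgC (a : A) (c : K) x : a *: (c%:A *: x) = c%:A *: (a *: x).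
Proof. by rewrite !scalerA -scalerAr mulr1 -scalerAl mul1r. Qed.

Lemma wordsS V F n :
  words V F n.+1 = words V F n ++ [seq a *: x | a <- V, x <- words V F n].
Proof. by []. Qed.

Lemma words_incl V F n m : (n <= m)%N -> {subset words V F n <= words V F m}.
Proof.
elim: m => [|m IH]; first by rewrite leqn0 => /eqP ->.
rewrite leq_eqVlt => /orP[/eqP -> //|nm] x xn.
by rewrite mem_cat IH.
Qed.

Lemma words_base V F n : {subset F <= words V F n}.
Proof. exact: (@words_incl V F 0 n). Qed.

Lemma kspan_wordsS V F n v x : v \in V ->
  kspan (words V F n) x -> kspan (words V F n.+1) (v *: x).
Proof.
move=> vV; move: x; apply: kspan_ind => [|x y|a x|x xn].
- by rewrite scaler0; apply: kspan0.
- by rewrite scalerDr; apply: kspanD.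
- by rewrite scale_inalgC; apply: kspanZ.
- apply: kspan_mem; rewrite mem_cat; apply/orP; right.
  by apply/allpairsP; exists (v, x).
Qed.

Lemma kspan_words_leq V F n m x : (n <= m)%N ->
  kspan (words V F n) x -> kspan (words V F m) x.
Proof. by move=> nm; apply: sub_kspan; apply: words_incl. Qed.

End Words.

Section WordsMul.
Variables (K : fieldType) (A : algType K) (M : lmodType A).
Implicit Types (V : seq A) (F : seq M) (x y : M).

Definition awords V n : seq A^o := words V [:: 1 : A^o] n.

Lemma kspan_words_mul V F m n (a : A^o) x :
  kspan (awords V m) a -> kspan (words V F n) x ->
  kspan (words V F (m + n)) (a *: x).
Proof.
move=> + xn; move: a; apply: kspan_ind => [|a b|c a|].
- by rewrite scale0r; apply: kspan0.
- by rewrite scalerDl; apply: kspanD.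
- by rewrite -[_ *: a]/(_ * a) -scalerA; apply: kspanZ.
elim: m => [|m IH] a.
  by rewrite inE => /eqP ->; rewrite scale1r.
rewrite /awords wordsS mem_cat => /orP[/IH|/allpairsP[[v w] /= [vV wm ->]]].
  by rewrite addSn; apply: kspan_words_leq; apply: leqnSn.
rewrite addSn; have -> : (v *: w) *: x = v *: ((w : A) *: x) by rewrite scalerA.
by apply: kspan_wordsS => //; apply: IH.
Qed.

(** Each letter of [V'] costs [a] letters of [V] and each starting vector costs [b]; hence the
    affine argument in [growth_le_affine]. *)
Lemma kspan_words_change V V' F F' a b n x :
  {in V', forall v, kspan (awords V a) v} -> {in F', forall y, kspan (words V F b) y} ->
  kspan (words V' F' n) x -> kspan (words V F (a * n + b)) x.
Proof.
move=> Va Fb; move: x; elim: n => [|n IH]; apply: kspan_trans => x.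
  by rewrite muln0 => /Fb.
rewrite mem_cat => /orP[xn|/allpairsP[[v w] /= [vV wn ->]]].
  by apply: (@kspan_words_leq _ _ _ _ _ (a * n + b)); [lia|apply/IH/kspan_mem].
rewrite mulnS -addnA; apply: kspan_words_mul; first exact: Va.
exact/IH/kspan_mem.
Qed.

End WordsMul.

Section AWords.
Variables (K : fieldType) (A : algType K).
Implicit Types (V : seq A) (x y : A).

Lemma kspan_awords1 V n : kspan (awords V n) 1.
Proof. by apply/kspan_mem/words_base; rewrite inE. Qed.

Lemma kspan_awords_mul V m n x y : kspan (awords V m) x -> kspan (awords V n) y ->
  kspan (awords V (m + n)) (x * y).
Proof. exact: (@kspan_words_mul _ _ A^o). Qed.

Lemma kspan_awords_gen V n v : (0 < n)%N -> v \in V -> kspan (awords V n) v.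
Proof.
move=> n0 vV; apply: (@kspan_words_leq _ _ _ _ _ 1) => //.
have -> : v = v *: (1 : A^o) by exact/esym/mulr1.
by apply: (@kspan_wordsS _ _ A^o) => //; apply: (kspan_awords1 V 0).
Qed.

Lemma kspan_awords_exp V m n x : kspan (awords V m) x ->
  kspan (awords V (m * n)) (x ^+ n).
Proof.
move=> xm; elim: n => [|n IH]; first by rewrite muln0; apply: kspan_awords1.
by rewrite exprS mulnS; apply: kspan_awords_mul.
Qed.

Lemma kspan_awords_prod V (I : Type) (r : seq I) (P : pred I) (n : I -> nat) (f : I -> A) :
  (forall i, P i -> kspan (awords V (n i)) (f i)) ->
  kspan (awords V (\sum_(i <- r | P i) n i)%N) (\prod_(i <- r | P i) f i).
Proof.
move=> h; elim/big_rec2: _ => [|i m y Pi]; first exact: kspan_awords1.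
by apply: kspan_awords_mul; apply: h.
Qed.

Lemma affine_awords : affine_algebra A ->
  exists V, forall x, exists n, kspan (awords V n) x.
Proof.
move=> [V genV]; exists V => x.
(* The elements reached by words of some length form a subalgebra containing the generators. *)
pose S : {pred A} := fun x => `[< exists n, kspan (awords V n) x >].
have SP y : reflect (exists n, kspan (awords V n) y) (y \in S) by exact: asboolP.
apply/SP/genV => [|v vV]; last by apply/SP; exists 1%N; apply: kspan_awords_gen.
split=> [|c u v /SP[m um] /SP[n vn]|u v /SP[m um] /SP[n vn]]; apply/SP.
- by exists 0%N; apply: kspan_awords1.
- exists (m + n)%N; apply: kspanD.
    rewrite -[u]mul1r scalerAl.
    by apply/kspanZ/(kspan_words_leq (leq_addr _ _)).
  exact/(kspan_words_leq (leq_addl _ _)).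
- by exists (m + n)%N; apply: kspan_awords_mul.
Qed.

Lemma affine_awords_seq V : (forall x : A, exists n, kspan (awords V n) x) ->
  forall s : seq A, exists n, {in s, forall x, kspan (awords V n) x}.
Proof.
move=> h; elim=> [|x s [n IH]]; first by exists 0%N.
have [m xm] := h x; exists (maxn m n) => y; rewrite inE => /orP[/eqP ->|ys].
  exact/(kspan_words_leq (leq_maxl _ _)).
exact/(kspan_words_leq (leq_maxr _ _))/IH.
Qed.

End AWords.

Section GK.
Variables (R : realType) (K : fieldType) (A : algType K).

Lemma gk_growthE (M : lmodType A) V (F : seq M) :
  gk_growth R V F = growth R (fun n => span_dim (words V F n)).
Proof. by []. Qed.

Lemma growth_le_GKdim_alg (V : seq A) :
  (growth R (fun n => span_dim (awords V n)) <= GKdim_alg R A)%E.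
Proof. by apply: ereal_sup_ubound; exists V. Qed.

Lemma growth1 : growth R (fun=> 1%N) = 0%E.
Proof.
apply/eqP; rewrite eq_le growth_ge0 andbT.
have -> : 0%E = (0%:R : R)%:E by [].
by apply: (@growth_poly _ _ 1 0 0) => n; rewrite expn0.
Qed.

Lemma GKdim_alg_ge (V : seq A) a d : (0 < a)%N ->
  (forall n, (n.+1 ^ d <= span_dim (awords V (a * n)))%N) ->
  (d%:R%:E <= GKdim_alg R A)%E.
Proof.
move=> a0 h; apply: le_trans (growth_le_GKdim_alg V).
rewrite -[X in (X <= _)%E]adde0 -growth1.
by apply: (growth_add R a0) => // n; rewrite muln1.
Qed.

End GK.

(** * Algebraic independence and algebraic elements *)

Section AlgebraicIndependence.
Variables (k : fieldType) (D : comNzRingType) (kappa : {rmorphism k -> D}).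

Definition algindep n (x : 'I_n -> D) : Prop :=
  forall p : mpoly n k, mmap kappa x p = 0 -> p = 0.

Lemma algindep_inj n (x : 'I_n -> D) : algindep x -> injective (mmap kappa x).
Proof.
by move=> ix p q pq; apply/eqP; rewrite -subr_eq0; apply/eqP/ix; rewrite raddfB /= pq subrr.
Qed.

Lemma mmap_const n (mu : 'I_n -> k) p : mmap kappa (kappa \o mu) p = kappa (meval mu p).
Proof.
rewrite /meval /mmap rmorph_sum; apply: eq_bigr => m _ /=; rewrite rmorphM; congr (_ * _).
by rewrite /mmap1 rmorph_prod; apply: eq_bigr => i _; rewrite rmorphXn.
Qed.

Definition monomial n (x : 'I_n -> D) (m : 'I_n -> nat) : D :=
  \prod_i x i ^+ m i.

Lemma algindep_monomials n (x : 'I_n -> D) N (c : {ffun 'I_n -> 'I_N} -> k) :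
  algindep x ->
  \sum_(a : {ffun 'I_n -> 'I_N}) kappa (c a) * monomial x (fun i => a i) = 0 ->
  forall a, c a = 0.
Proof.
move=> ix; pose mon (a : {ffun 'I_n -> 'I_N}) : multinom n :=
  Multinom [tuple (a i : nat) | i < n].
have monE a i : mon a i = a i :> nat by rewrite multinomE tnth_mktuple.
have mon_inj : injective mon.
  by move=> a b ab; apply/ffunP => i; apply: ord_inj; rewrite -!monE ab.
pose p := \sum_a c a *: mpolyX k (mon a).
move=> h a; have p0 : p = 0.
  apply: ix; rewrite -[RHS]h raddf_sum; apply: eq_bigr => b _ /=.
  rewrite mmapZ mmapX /mmap1; congr (_ * _); apply: eq_bigr => i _.
  by rewrite monE.
have := congr1 (mcoeff (mon a)) p0; rewrite mcoeff0 raddf_sum (bigD1 a) //=.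
rewrite mcoeffZ mcoeffX eqxx mulr1 big1 ?addr0 // => b ba.
by rewrite mcoeffZ mcoeffX (inj_eq mon_inj) (negbTE ba) mulr0.
Qed.

Definition ideal_prop (I : D -> Prop) : Prop :=
  [/\ I 0, forall a b, I a -> I b -> I (a + b) & forall a b, I b -> I (a * b)].

Definition prime_prop (m : D -> Prop) : Prop :=
  [/\ ideal_prop m, ~ m 1 & forall a b, m (a * b) -> m a \/ m b].

Lemma ideal_propB I a b : ideal_prop I -> I a -> I b -> I (a - b).
Proof. by case=> _ ID IM Ia Ib; apply: ID => //; rewrite -mulN1r; apply: IM. Qed.

Lemma ideal_prop_sum I (T : eqType) (r : seq T) (P : pred T) (F : T -> D) :
  ideal_prop I -> (forall i, i \in r -> P i -> I (F i)) -> I (\sum_(i <- r | P i) F i).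
Proof.
by case=> I0 ID _ h; rewrite big_seq_cond; apply: big_ind => // i /andP[]; apply: h.
Qed.

(** [I i.+1] has to contain [I i] and [x i] but need not be generated by them. This leaves room for
    annihilators of successive module quotients and for ascending chains of primes alike. *)
Definition regular_chain n (x : nat -> D) (I : nat -> D -> Prop) : Prop :=
  [/\ forall i, (i <= n)%N -> ideal_prop (I i),
      forall i, (i < n)%N -> [/\ forall a, I i (x i * a) -> I i a,
        forall a, I i a -> I i.+1 a & I i.+1 (x i)]
    & ~ I n 1].

(* Dividing a relation modulo [I i] by the least power of [x i] and reducing
   modulo [I i.+1] keeps the monomials of least degree in [x i]; in the end
   the lexicographically least monomial of the relation has coefficient 0. *)
Lemma regular_chain_algindep n (x : nat -> D) I :
  regular_chain n x I -> algindep (fun i : 'I_n => x i).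
Proof.
move=> [Iid Ireg I1] p px; apply/eqP/negPn/negP => p0.
(* Invariant of the induction: the surviving monomials [S] agree in the variables before [i], which
   have been divided out, so that only [tail i] remains. At [i = n] a single monomial is left and
   its nonzero scalar coefficient lies in [I n]. *)
pose tail (i : nat) (m : multinom n) : D := \prod_(j < n | (i <= j)%N) x j ^+ m j.
have [S [S0 uS Sp Seq IS]] : exists S : seq (multinom n),
    [/\ S != [::], uniq S, {subset S <= msupp p},
        {in S &, forall m m' : multinom n, forall j : 'I_n, (j < n)%N -> m j = m' j}
      & I n (\sum_(m <- S) kappa (mcoeff m p) * tail n m)].
  suff: forall i, (i <= n)%N -> exists S : seq (multinom n),
    [/\ S != [::], uniq S, {subset S <= msupp p},
        {in S &, forall m m' : multinom n, forall j : 'I_n, (j < i)%N -> m j = m' j}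
      & I i (\sum_(m <- S) kappa (mcoeff m p) * tail i m)] by apply.
  elim=> [_|i IH lt_in].
    exists (msupp p); split=> //; rewrite ?msupp_uniq ?msupp_eq0 //.
    by have [I0 _ _] := Iid 0%N (leq0n n); move: px; rewrite /mmap /mmap1 => ->.
  have [S [S0 uS Sp Seq IS]] := IH (ltnW lt_in).
  pose o := Ordinal lt_in; have [/= reg sub xi] := Ireg i lt_in.
  have idi := Iid i (ltnW lt_in); have idi1 := Iid i.+1 lt_in.
  have tailE m : tail i m = x i ^+ m o * tail i.+1 m.
    rewrite /tail (bigD1 o) //=; congr (_ * _); apply: eq_bigl => j.
    by rewrite -val_eqE /= ltn_neqAle andbC eq_sym.
  have [m0 m0S m0min] : exists2 m0 : multinom n, m0 \in S & forall m : multinom n, m \in S -> (m0 o <= m o)%N.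
    have [m mS] : exists m, m \in S by case: (S) S0 => // m s _; exists m; rewrite mem_head.
    have exn : exists e, has (fun m : multinom n => m o == e) S.
      by exists (m o); apply/hasP; exists m.
    case: (ex_minnP exn) => e /hasP[m0 m0S /eqP <-] emin; exists m0 => // m' m'S.
    by apply: emin; apply/hasP; exists m'.
  pose q (m : multinom n) := (m o - m0 o)%N.
  have regX e a : I i (x i ^+ e * a) -> I i a.
    by elim: e => [|e IHe]; rewrite ?expr0 ?mul1r // exprS -mulrA => /reg.
  have IS1 : I i (\sum_(m <- S) kappa (mcoeff m p) * (x i ^+ q m * tail i.+1 m)).
    move: IS; under eq_big_seq => m mS.
      rewrite tailE -(subnKC (m0min m mS)) exprD -!mulrA mulrCA; over.
    by rewrite -mulr_sumr => /regX.
  pose P (m : multinom n) := m o == m0 o.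
  exists [seq m <- S | P m]; split.
  - by rewrite -has_filter; apply/hasP; exists m0 => //; apply: eqxx.
  - exact: filter_uniq.
  - by move=> m; rewrite mem_filter => /andP[_ /Sp].
  - move=> m m'; rewrite !mem_filter => /andP[/eqP mo mS] /andP[/eqP m'o m'S] j.
    rewrite ltnS leq_eqVlt => /orP[/eqP ji|]; last exact: Seq.
    have -> : j = o by apply: ord_inj.
    by rewrite mo m'o.
  move/sub: IS1; rewrite (bigID P) /= => IS1.
  rewrite big_filter.
  suff I2 : I i.+1 (\sum_(m <- S | ~~ P m) kappa (mcoeff m p) * (x i ^+ q m * tail i.+1 m)).
    have := ideal_propB idi1 IS1 I2; rewrite addrK.
    rewrite (eq_bigr (fun m => kappa (mcoeff m p) * tail i.+1 m)) // => m /eqP mo.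
    by rewrite /q mo subnn mul1r.
  apply: ideal_prop_sum => // m mS mo.
  have : (0 < q m)%N by rewrite subn_gt0 ltn_neqAle eq_sym mo m0min.
  case: (q m) => // e _; have [_ _ IM] := idi1.
  rewrite exprS -mulrA mulrCA [x i * _]mulrC; exact: IM.
case: S S0 uS Sp Seq IS => // m [|m' S] _ uS Sp Seq; last first.
  have mm' : m = m'.
    by apply/mnmP => j; apply: Seq; rewrite ?ltn_ord // !inE eqxx ?orbT.
  by move: uS; rewrite /= mm' mem_head.
rewrite big_seq1 /tail big_pred0 => [|j]; last by rewrite leqNgt ltn_ord.
rewrite mulr1 => Ic; apply: I1; have [_ _ IM] := Iid n (leqnn n).
have := IM (kappa (mcoeff m p)^-1) _ Ic; rewrite -rmorphM mulVf ?rmorph1 //.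
by rewrite -mcoeff_msupp Sp ?mem_head.
Qed.

End AlgebraicIndependence.

Section FinIndep.
Variables (K : fieldType) (A : algType K) (M : lmodType A).

Lemma indep_enum (T : finType) (x : T -> M) :
  (forall c : T -> K, \sum_t (c t)%:A *: x t = 0 -> forall t, c t = 0) ->
  indep (fun i : 'I_#|T| => x (enum_val i)).
Proof.
move=> h c c0 i; have := h (fun t => c (enum_rank t)).
rewrite (reindex (@enum_val T T)) /=; last first.
  by exists enum_rank => t _; rewrite ?enum_rankK ?enum_valK.
under eq_bigr do rewrite enum_valK.
by move=> /(_ c0 (enum_val i)); rewrite enum_valK.
Qed.

End FinIndep.

Section GKcommutative.
Variables (R : realType) (k : fieldType) (D : comAlgType k).

Lemma algindep_GKdim n (x : 'I_n -> D) :
  algindep (in_alg D) x -> (n%:R%:E <= GKdim_alg R D)%E.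
Proof.
move=> ix; pose V := codom x.
(* Length [n * N] would do; the factor [n.+1] stays positive when [n = 0]. *)
apply: (@GKdim_alg_ge _ _ _ V n.+1) => // N.
have -> : (N.+1 ^ n)%N = #|{: {ffun 'I_n -> 'I_N.+1}}| by rewrite card_ffun !card_ord.
pose f (a : {ffun 'I_n -> 'I_N.+1}) := monomial x (fun i => a i) : D^o.
apply: (@span_dim_ge _ _ _ _ _ (fun i => f (enum_val i))).
  apply: indep_enum => c c0; apply: (algindep_monomials ix).
  by rewrite -[RHS]c0; apply: eq_bigr.
move=> i; apply: (@kspan_words_leq _ _ _ _ _ (\sum_(j < n) 1 * N)).
  by rewrite sum_nat_const card_ord mul1n mulSn leq_addl.
apply: (@kspan_awords_prod k D) => j _; apply: (@kspan_words_leq _ _ _ _ _ (1 * enum_val i j)).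
  by rewrite leq_mul2l -ltnS ltn_ord.
by apply: kspan_awords_exp; apply: kspan_awords_gen => //; apply: codom_f.
Qed.

End GKcommutative.

(** * Algebraic elements over a subdomain *)

Section AlgebraicOverDomain.
Variables (R D : idomainType) (iota : {rmorphism R -> D}).
Hypothesis iota_inj : injective iota.

Lemma iota_neq0 c : c != 0 -> iota c != 0.
Proof. by apply: contra_neq => h; apply: iota_inj; rewrite h rmorph0. Qed.

(** Divide the monic equation of [a] by ['X] until its constant term is nonzero; that term is then a
    multiple of [a]. It does the work of a norm. *)
Lemma integral_multiple a : integralOver iota a -> a != 0 ->
  exists2 b, integralOver iota b & exists2 r, r != 0 & a * b = iota r.
Proof.
move=> ia a0; have [p mp pa] := ia; move: mp pa; elim/poly_ind: p => [|q c IH].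
  by rewrite monicE lead_coef0 eq_sym oner_eq0.
have [->|c0] := eqVneq c 0.
  rewrite addr0 monicE lead_coefMX -monicE => /IH {}IH.
  by rewrite rmorphM /= map_polyX rootM rootX (negbTE a0) orbF.
move=> _; rewrite rmorphD rmorphM /= map_polyX map_polyC /= /root !hornerE => /eqP qa.
exists (- (map_poly iota q).[a]).
  apply/integral_opp/integral_horner => //; apply/integral_poly => i.
  by rewrite coef_map; apply: integral_id.
by exists c => //; rewrite mulrN mulrC; apply/eqP; rewrite eqr_oppLR -addr_eq0 qa.
Qed.

(** Algebraicity over the fraction field of [R] with the denominator cleared, so that the closure
    properties of integral elements apply directly. *)
Definition algebraic_elt x : Prop :=
  exists2 c, c != 0 & integralOver iota (iota c * x).

Lemma algebraic_integral x : integralOver iota x -> algebraic_elt x.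
Proof. by move=> ix; exists 1; rewrite ?oner_neq0 ?rmorph1 ?mul1r. Qed.

Lemma algebraic_iota r : algebraic_elt (iota r).
Proof. exact/algebraic_integral/integral_id. Qed.

Lemma integral_iotaM c x : integralOver iota x -> integralOver iota (iota c * x).
Proof. by apply: integral_mul; apply: integral_id. Qed.

Lemma algebraic_add x y : algebraic_elt x -> algebraic_elt y -> algebraic_elt (x + y).
Proof.
move=> [c c0 cx] [d d0 dy]; exists (c * d); first by rewrite mulf_neq0.
rewrite mulrDr rmorphM; apply: integral_add; last by rewrite -mulrA; apply: integral_iotaM.
by rewrite mulrAC mulrC; apply: integral_iotaM.
Qed.

Lemma algebraic_mul x y : algebraic_elt x -> algebraic_elt y -> algebraic_elt (x * y).
Proof.
move=> [c c0 cx] [d d0 dy]; exists (c * d); first by rewrite mulf_neq0.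
by rewrite rmorphM mulrACA; apply: integral_mul.
Qed.

Lemma algebraic_common_denominator n (x : nat -> D) :
  (forall i, algebraic_elt (x i)) ->
  exists2 c, c != 0 & forall i, (i < n)%N -> integralOver iota (iota c * x i).
Proof.
move=> ax; elim: n => [|n [c c0 IH]]; first by exists 1; rewrite ?oner_neq0.
have [d d0 dx] := ax n; exists (c * d) => [|i]; first by rewrite mulf_neq0.
rewrite ltnS leq_eqVlt => /orP[/eqP ->|/IH cx].
  by rewrite rmorphM -mulrA; apply: integral_iotaM.
by rewrite rmorphM mulrAC mulrC; apply: integral_iotaM.
Qed.

Lemma algebraic_multiple x : algebraic_elt x -> x != 0 ->
  exists2 b, algebraic_elt b & exists2 r, r != 0 & x * b = iota r.
Proof.
move=> [c c0 cx] x0; have [|b ib [r r0 rb]] := integral_multiple cx.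
  by rewrite mulf_neq0 // iota_neq0.
exists (iota c * b); first exact/algebraic_integral/integral_iotaM.
by exists r => //; rewrite -rb mulrCA mulrA.
Qed.

(* If the leading coefficient [a] of a polynomial of size [n.+1] is integral
   and [u] is a root, [a * u] is a root of a monic polynomial. *)
Lemma algebraic_root (g : {poly D}) u : g != 0 ->
  (forall i, algebraic_elt g`_i) -> root g u -> algebraic_elt u.
Proof.
move=> g0 ag gu; have [c c0 icg] := algebraic_common_denominator (size g) ag.
pose h := iota c *: g; have ih i : integralOver iota h`_i.
  rewrite coefZ; case: (ltnP i (size g)) => [/icg //|/leq_sizeP ->//].
  by rewrite mulr0; apply: integral0.
have h0 : h != 0 by rewrite /h -mul_polyC mulf_neq0 // polyC_eq0 iota_neq0.
have hu : root h u by rewrite /root hornerZ (eqP gu) mulr0.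
pose a := lead_coef h; have a0 : a != 0 by rewrite lead_coef_eq0.
have ia : integralOver iota a by apply: ih.
have [n sh] : exists n, size h = n.+2.
  case E : (size h) (root_size_gt1 h0 hu) => [|[|n]] // _; by exists n.
have iau : integralOver iota (a * u).
  pose q := 'X^(n.+1) + \poly_(i < n.+1) (a ^+ (n - i) * h`_i).
  apply: (@integral_root_monic _ _ _ _ q).
  - by rewrite monicE lead_coefDl ?lead_coefXn // size_polyXn ltnS size_poly.
  - have : a ^+ n * h.[u] = 0 by rewrite (eqP hu) mulr0.
    rewrite horner_coef sh big_ord_recr mulrDr /= => hu0.
    apply/eqP; rewrite hornerD hornerXn horner_poly addrC -[RHS]hu0; congr (_ + _).
      rewrite mulr_sumr; apply: eq_bigr => i _; rewrite exprMn mulrACA -exprD.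
      by rewrite subnK ?mulrA // -ltnS.
    by rewrite exprMn [a ^+ n.+1]exprSr -mulrA /a lead_coefE sh.
  - apply/integral_poly => i; rewrite coefD coefXn coef_poly; apply: integral_add.
      exact: integral_nat.
    case: ifP => _; last exact: integral0.
    apply: integral_mul => //; elim: (n - i)%N => [|m IH]; first exact: integral1.
    by rewrite exprS; apply: integral_mul.
have [b ib [r r0 ab]] := integral_multiple ia a0.
by exists r => //; rewrite -ab [a * b]mulrC -mulrA; apply: integral_mul.
Qed.

End AlgebraicOverDomain.

(** * Finite modules with coefficients of bounded degree, and the growth of [Q(Z)] *)

Section CoefficientSpan.
Variables (R D : comNzRingType) (iota : {rmorphism R -> D}).
Implicit Types (P Q : R -> Prop) (U : seq D).

(** [P] restricts the coefficients, in practice their degrees. As an element of [U] may occur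
    repeatedly, sums can be formed whatever [P] is. *)
Inductive cspan P U : D -> Prop :=
| cspan0 : cspan P U 0
| cspanS r u x : P r -> u \in U -> cspan P U x -> cspan P U (iota r * u + x).

Lemma cspan_mem P U r u : P r -> u \in U -> cspan P U (iota r * u).
Proof. by move=> Pr uU; rewrite -[_ * _]addr0; apply: cspanS => //; apply: cspan0. Qed.

Lemma cspanD P U x y : cspan P U x -> cspan P U y -> cspan P U (x + y).
Proof.
move=> + yU; elim=> [|r u z Pr uU _ IH]; first by rewrite add0r.
by rewrite -addrA; apply: cspanS.
Qed.

Lemma cspan_sub P Q U U' x : (forall r, P r -> Q r) -> {subset U <= U'} ->
  cspan P U x -> cspan Q U' x.
Proof.
move=> PQ UU'; elim=> [|r u z Pr uU _ IH]; first exact: cspan0.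
by apply: cspanS => //; [apply: PQ | apply: UU'].
Qed.

Lemma cspanM P Q U U' a x :
  (forall r u, P r -> u \in U -> cspan Q U' (iota r * (a * u))) ->
  cspan P U x -> cspan Q U' (a * x).
Proof.
move=> h; elim=> [|r u z Pr uU _ IH]; first by rewrite mulr0; apply: cspan0.
by rewrite mulrDr mulrCA; apply: cspanD IH; apply: h.
Qed.

Lemma cspanZ P Q U r x : (forall r', P r' -> Q (r' * r)) ->
  cspan P U x -> cspan Q U (iota r * x).
Proof.
move=> PQ; apply: cspanM => r' u Pr uU; rewrite mulrA -rmorphM.
by apply: cspan_mem => //; apply: PQ.
Qed.

Definition anyr : R -> Prop := fun=> True.

Lemma cspan_sum U (I : Type) (r : seq I) (p : pred I) (F : I -> D) :
  (forall i, p i -> cspan anyr U (F i)) -> cspan anyr U (\sum_(i <- r | p i) F i).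
Proof. by move=> h; apply: big_ind => //; [apply: cspan0|apply: cspanD]. Qed.

(** [U] consists of the products of powers of the [ys] below the degrees of their monic equations; a
    further factor [y] is reduced by the equation of [y]. *)
Lemma integral_module (ys : seq D) : {in ys, forall y, integralOver iota y} ->
  exists2 U : seq D, 1 \in U &
    forall y u, y \in ys -> u \in U -> cspan anyr U (y * u).
Proof.
elim: ys => [_|y ys IH iys]; first by exists [:: 1]; rewrite ?mem_head.
have [|U U1 hU] := IH; first by move=> z zys; apply: iys; rewrite inE zys orbT.
have [p mp py] := iys y (mem_head _ _).
have p0 : p != 0 by apply: monic_neq0.
have se : (size (map_poly iota p)) = size p by rewrite size_map_poly_id0 // (monicP mp) rmorph1 oner_eq0.
have [e sp] : exists e, size p = e.+2.
  have := @root_size_gt1 _ y (map_poly iota p); rewrite se => /(_ _ py).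
  rewrite -size_poly_eq0 se size_poly_eq0 => /(_ p0).
  by case: (size p) => [|[|e]] // _; exists e.
pose U' := [seq y ^+ l * u | l <- seq.iota 0 e.+1, u <- U].
have memU' l u : (l <= e)%N -> u \in U -> y ^+ l * u \in U'.
  by move=> le uU; apply: (allpairs_f (fun l u => y ^+ l * u)); rewrite ?mem_iota.
have mulU' l x : (l <= e)%N -> cspan anyr U x -> cspan anyr U' (y ^+ l * x).
  move=> le; apply: cspanM => r u _ uU; apply: cspan_mem => //; exact: memU'.
exists U'; first by rewrite -[1]mulr1 -[X in X * _](expr0 y); apply: memU'.
move=> z w + /allpairsP[[l u] [+ + ->]].
rewrite mem_iota /= add0n ltnS => + le uU; rewrite inE => /orP[/eqP ->|zys]; last first.
  by rewrite mulrCA; apply: mulU' => //; apply: hU.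
rewrite mulrA -exprS; move: le; rewrite leq_eqVlt => /orP[/eqP ->|le]; last first.
  by rewrite -[_ * u]mul1r -(rmorph1 iota); apply: cspan_mem => //; apply: memU'.
have -> : y ^+ e.+1 = \sum_(i < e.+1) iota (- p`_i) * y ^+ i.
  move/eqP: py; rewrite horner_coef se sp big_ord_recr /= !coef_map.
  have -> : p`_e.+1 = 1 by have /monicP := mp; rewrite lead_coefE sp.
  rewrite /= rmorph1 mul1r => /eqP; rewrite addrC addr_eq0 => /eqP ->.
  by rewrite -sumrN; apply: eq_bigr => i _; rewrite coef_map rmorphN mulNr.
rewrite mulr_suml; apply: cspan_sum => i _; rewrite -mulrA.
by apply: cspan_mem => //; apply: memU' => //; rewrite -ltnS.
Qed.

End CoefficientSpan.

Section Degree.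
Variables (k : fieldType) (d : nat).
Implicit Types (r : mpoly d k).

(** Partial degrees instead of the total degree: the monomials allowed fill a box with [(N + 1) ^ d]
    points. *)
Definition deg_le N r : Prop := {in msupp r, forall m : multinom d, forall i, (m i <= N)%N}.

Lemma deg_le_ex r : exists N, deg_le N r.
Proof.
exists (mmeasure (@mdeg d) r) => m mr i; apply: leq_trans (ltnW (msize_mdeg_lt mr)).
by rewrite mdegE (bigD1 i) //= leq_addr.
Qed.

Lemma deg_le_mono M N r : (M <= N)%N -> deg_le M r -> deg_le N r.
Proof. by move=> MN h m mr i; apply: leq_trans MN; apply: h. Qed.

Lemma deg_leM M N p q : deg_le M p -> deg_le N q -> deg_le (M + N) (p * q).
Proof.
move=> hp hq m /msuppM_le /allpairsP[[m1 m2] /= [m1p m2q ->]] i.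
by rewrite mnmDE leq_add // ?hp ?hq.
Qed.

Lemma deg_le1 N : deg_le N 1.
Proof. by move=> m; rewrite msupp1 inE => /eqP -> i; rewrite mnm0E. Qed.

Lemma cspan_deg (D : comNzRingType) (f : {rmorphism mpoly d k -> D}) U x :
  cspan f (@anyr _) U x -> exists N, cspan f (deg_le N) U x.
Proof.
elim=> [|r u y _ uU _ [N IH]]; first by exists 0%N; apply: cspan0.
have [M rM] := deg_le_ex r; exists (maxn M N); apply: cspanS => //.
  by apply: deg_le_mono rM; rewrite leq_maxl.
by apply: cspan_sub IH => // r'; apply: deg_le_mono; rewrite leq_maxr.
Qed.

End Degree.

Section FractionField.
Variables (R : realType) (k : fieldType) (A : algType k) (Z : central_subdomain A).

HB.instance Definition _ := GRing.RMorphism.copy (@of_csd k A Z) (@tofrac (csd Z)).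

Lemma csd_frac_alg (c : k) : c%:A = of_csd c%:A :> csd_frac Z.
Proof. exact: mulr1. Qed.

Lemma of_csd_eq0 (z : csd Z) : (of_csd z == 0) = (z == 0).
Proof. by rewrite -(rmorph0 (@of_csd k A Z)) (inj_eq (@of_csd_inj _ _ _)). Qed.

Variables (d : nat) (t : 'I_d -> csd Z).
Local Notation kappa := (in_alg (csd Z)).
Local Notation iota := (mmap kappa t).
Hypotheses (ind_t : algindep kappa t) (alg_t : forall x, algebraic_elt iota x).

(** Multiplied by the [n]-th power of the denominator [r], a word of length at most [n] becomes a
    combination of [U] with coefficients of partial degrees at most [N * n]; the list [L] counts
    these. *)
Lemma csd_frac_growth (V : seq (csd_frac Z)) (r : mpoly d k) U N :
  r != 0 -> deg_le N r -> 1 \in U ->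
  {in V, forall v, exists2 y, of_csd (iota r) * v = of_csd y &
     {in U, forall u, cspan iota (deg_le N) U (y * u)}} ->
  forall n, (span_dim (awords V n) <= size U * (N * n + 1) ^ d)%N.
Proof.
move=> r0 rN U1 hV n; pose q := of_csd (iota r).
have q0 : q != 0 by rewrite of_csd_eq0 (iota_neq0 (algindep_inj ind_t)).
have hn : {in awords V n, forall x, exists2 y, q ^+ n * x = of_csd y & cspan iota (deg_le (N * n)) U y}.
  elim: n => [|n IH] x.
    rewrite inE => /eqP ->; exists 1; first by rewrite rmorph1 mul1r.
    by rewrite -[1]mul1r -[X in X * _](rmorph1 iota); apply: cspan_mem => //; apply: deg_le1.
  rewrite /awords wordsS mem_cat => /orP[/IH [y qy Uy]|/allpairsP[[v w] [/= /hV[z vz Uz] /IH[y qy Uy] ->]]].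
    (* A word that is not lengthened still receives the extra factor [r], hence the degree bound on
       [r] itself. *)
    exists (iota r * y); first by rewrite exprS -mulrA qy rmorphM.
    by apply: cspanZ Uy => r' r'N; rewrite mulnS addnC; apply: deg_leM.
  exists (z * y); first by rewrite rmorphM /= -qy -vz exprS mulrACA.
  apply: cspanM Uy => p u pN uU; rewrite mulnS addnC.
  by apply: cspanZ (Uz u uU) => r' r'N; rewrite mulrC; apply: deg_leM.
pose M := (N * n)%N.
pose L : seq (csd_frac Z)^o := 
  [seq of_csd (monomial t (fun i => (a : {ffun 'I_d -> 'I_M.+1}) i) * u) / q ^+ n
  | a <- enum {: {ffun 'I_d -> 'I_M.+1}}, u <- U].
suff h : {in awords V n, forall x, kspan L x}.
  apply: leq_trans (span_dim_le h) _; rewrite size_allpairs -cardE card_ffun !card_ord.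
  by rewrite mulnC addn1.
move=> x /hn[y qy Uy]; have -> : x = of_csd y / q ^+ n by rewrite -qy mulrC mulKf ?expf_neq0.
elim: Uy => [|p u z pM uU _ IH]; first by rewrite rmorph0 mul0r; apply: kspan0.
rewrite rmorphD mulrDl; apply: kspanD => //.
rewrite /mmap mulr_suml rmorph_sum mulr_suml big_seq; apply: kspan_sum => m mp.
pose a : {ffun 'I_d -> 'I_M.+1} := [ffun i => inord (m i)].
have -> : of_csd (kappa (mcoeff m p) * mmap1 t m * u) / q ^+ n =
    (mcoeff m p)%:A *: (of_csd (monomial t (fun i => a i) * u) / q ^+ n : (csd_frac Z)^o).
  rewrite -[RHS]/(_ * _) csd_frac_alg -mulrA rmorphM -mulrA; congr (_ * (of_csd (_ * _) / _)).
  by apply: eq_bigr => i _; rewrite ffunE inordK // ltnS; apply: pM.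
apply: kspanZ; apply: kspan_mem; apply/allpairsP; exists (a, u); split=> //.
by rewrite mem_enum.
Qed.

Lemma csd_frac_common_denominator (V : seq (csd_frac Z)) :
  exists2 s : csd Z, s != 0 & {in V, forall v, exists z, of_csd s * v = of_csd z}.
Proof.
elim: V => [|v V [s s0 IH]]; first by exists 1; rewrite ?oner_neq0.
have [e [n [e0 en]]] := csd_fracP v.
exists (e * s) => [|w]; first by rewrite mulf_neq0.
rewrite inE => /orP[/eqP ->|/IH[z sz]].
  by exists (s * n); rewrite [e * s]mulrC !rmorphM /= -mulrA en.
by exists (e * z); rewrite !rmorphM /= -mulrA sz.
Qed.

Lemma GKdim_csd_frac_le : (GKdim_alg R (csd_frac Z) <= d%:R%:E)%E.
Proof.
apply/ereal_supP => _ [V _ <-].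
have [s s0 hs] := csd_frac_common_denominator V.
(* The common denominator [s] in [Z] divides an element of the polynomial ring, which replaces
   it. *)
have [b _ [r r0 sb]] := algebraic_multiple (algindep_inj ind_t) (alg_t s) s0.
have hz0 i : exists z : csd Z, (i < size V)%N -> of_csd (iota r) * V`_i = of_csd z.
  case: (ltnP i (size V)) => [iV|]; last by exists 0.
  have [z sz] := hs _ (mem_nth 0 iV); exists (b * z) => _.
  by rewrite -sb [s * b]mulrC !rmorphM /= -mulrA sz.
have [zs hz] := choice hz0.
(* A further factor [c] makes the numerators integral, so that they act on one finite module [U];
   the final denominator is [c * r]. *)
have [c c0 hc] := algebraic_common_denominator (size V) (fun i => alg_t (zs i)).
pose ys := [seq iota c * zs i | i <- seq.iota 0 (size V)].
have [|U U1 hU] := @integral_module _ _ iota ys.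
  by move=> _ /mapP[i + ->]; rewrite mem_iota => /andP[_ /hc].
pose p := c * r; have p0 : p != 0 by rewrite mulf_neq0.
have [N1 pN1] := deg_le_ex p.
have [N2 hN2] : exists N, forall y u, y \in ys -> u \in U -> cspan iota (deg_le N) U (y * u).
  suff [N hN] : exists N, {in [seq y * u | y <- ys, u <- U], forall x, cspan iota (deg_le N) U x}.
    by exists N => y u yys uU; apply/hN/allpairsP; exists (y, u).
  have : {in [seq y * u | y <- ys, u <- U], forall x, cspan iota (@anyr _) U x}.
    by move=> _ /allpairsP[[y u] [/= yys uU ->]]; apply: hU.
  elim: [seq y * u | y <- ys, u <- U] => [|x s' IH] h; first by exists 0%N.
  have [N1' h1] := cspan_deg (h x (mem_head _ _)).
  have [|N2' h2] := IH; first by move=> y ys'; apply: h; rewrite inE ys' orbT.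
  exists (maxn N1' N2') => y; rewrite inE => /orP[/eqP ->|/h2].
    by apply: cspan_sub h1 => // r'; apply: deg_le_mono; rewrite leq_maxl.
  by apply: cspan_sub => // r'; apply: deg_le_mono; rewrite leq_maxr.
pose N := maxn N1 N2.
rewrite gk_growthE; apply: (@growth_poly _ _ (size U) N d).
apply: (@csd_frac_growth V p U N) => //.
  by apply: deg_le_mono pN1; rewrite leq_maxl.
move=> v vV; have iV : (index v V < size V)%N by rewrite index_mem.
exists (iota c * zs (index v V)).
  by rewrite !rmorphM /= -hz // nth_index // mulrA.
move=> u uU; apply: cspan_sub (hN2 _ u _ uU) => //.
  by move=> r'; apply: deg_le_mono; rewrite leq_maxr.
by apply/mapP; exists (index v V) => //; rewrite mem_iota.
Qed.

End FractionField.

(** * Separating transcendence bases *)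

Section Congruence.
Variables (k : fieldType) (D : comNzRingType) (kappa : {rmorphism k -> D}).

Lemma ideal_prop_exp I (x y : D) n : ideal_prop I -> I (x - y) -> I (x ^+ n - y ^+ n).
Proof. by case=> _ _ IM h; rewrite subrXX mulrC; apply: IM. Qed.

Lemma mmap_congr I n (x y : 'I_n -> D) p : ideal_prop I ->
  (forall i, I (x i - y i)) -> I (mmap kappa x p - mmap kappa y p).
Proof.
move=> idI h; have [I0 ID IM] := idI.
rewrite /mmap -sumrB; apply: ideal_prop_sum => // m _ _; rewrite -mulrBr; apply: (IM).
rewrite /mmap1; elim/big_rec2: _ => [|i a b _ IH]; first by rewrite subrr.
have -> : x i ^+ m i * b - y i ^+ m i * a =
  x i ^+ m i * (b - a) + a * (x i ^+ m i - y i ^+ m i) by ring.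
by apply: ID; apply: IM => //; apply: ideal_prop_exp.
Qed.

Lemma pow_taylor (x y : D) n : exists q,
  x ^+ n = y ^+ n + (x - y) * (y ^+ n.-1 *+ n) + (x - y) ^+ 2 * q.
Proof.
elim: n => [|n [q IH]]; first by exists 0; rewrite mulr0n !mulr0 !addr0.
exists (y ^+ n.-1 *+ n + x * q); rewrite exprS IH -pred_Sn.
have -> : y ^+ n *+ n.+1 = y ^+ n + y * (y ^+ n.-1 *+ n).
  by rewrite mulrS mulrnAr; case: n {IH} => [|n]; rewrite ?mulr0n // -exprS.
by rewrite [y ^+ n.+1]exprS; ring.
Qed.

(** Only one coordinate moves and only the linear coefficient is named, so no factorial is divided
    by and any characteristic is allowed. The expansion serves to show that a substituted polynomial
    is nonzero and to solve a relation locally for one variable. *)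
Lemma mmap_taylor n (x y : 'I_n -> D) (j : 'I_n) p :
  (forall i, i != j -> x i = y i) -> exists q,
  mmap kappa x p = mmap kappa y p + (x j - y j) * mmap kappa y (mderiv j p) + (x j - y j) ^+ 2 * q.
Proof.
move=> xy; elim/mpolyind: p => [|c m p _ _ [q IH]].
  by exists 0; rewrite mderiv0 !raddf0 !mulr0 !addr0.
have [q' mq'] := pow_taylor (x j) (y j) (m j).
pose C := \prod_(i < n | i != j) y i ^+ m i.
have mapX : mmap1 x m = x j ^+ m j * C.
  rewrite /mmap1 (bigD1 j) //=; congr (_ * _).
  by apply: eq_bigr => i ij; rewrite xy.
have mapY : mmap1 y m = y j ^+ m j * C by rewrite /mmap1 (bigD1 j).
have mapD : (m j)%:R * mmap1 y (mnm_sub m (mnm1 j)) = (y j ^+ (m j).-1 *+ m j) * C.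
  rewrite /mmap1 (bigD1 j) //= mnmBE mnm1E eqxx subn1 mulrA mulr_natl; congr (_ * _).
  by apply: eq_bigr => i ij; rewrite mnmBE mnm1E eq_sym (negbTE ij) subn0.
exists (kappa c * q' * C + q).
rewrite mderivD mderivZ mderivX !rmorphD /= !mmapZ !mmapX rmorph_nat mapX mapY mapD IH mq'.
by ring.
Qed.

End Congruence.

Section LocalGenerators.
Variables (D : comNzRingType) (m : D -> Prop).
Hypotheses (idm : ideal_prop m) (m1 : ~ m 1) (prm : forall a b, m (a * b) -> m a \/ m b).

(** Membership in the ideal that the [g j] generate in the localization at [m], with the denominator
    [u] cleared. *)
Definition locgen d (g : 'I_d -> D) (x : D) : Prop :=
  exists2 u, ~ m u & exists c : 'I_d -> D, u * x = \sum_j c j * g j.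

Lemma not_primeM a b : ~ m a -> ~ m b -> ~ m (a * b).
Proof. by move=> ha hb /prm[]. Qed.

Lemma locgen_ideal d (g : 'I_d -> D) : ideal_prop (locgen g).
Proof.
split=> [|a b [u mu [c uc]] [v mv [e ve]]|a b [u mu [c uc]]].
- by exists 1 => //; exists (fun=> 0); rewrite mulr0 big1 // => i _; rewrite mul0r.
- exists (u * v); first exact: not_primeM.
  exists (fun j => v * c j + u * e j); rewrite mulrDr mulrAC uc -mulrA ve.
  by rewrite mulr_suml mulr_sumr -big_split; apply: eq_bigr => j _ /=; ring.
- exists u => //; exists (fun j => a * c j); rewrite mulrCA uc mulr_sumr.
  by apply: eq_bigr => j _; rewrite mulrA.
Qed.

Lemma locgen_mem d (g : 'I_d -> D) j : locgen g (g j).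
Proof.
exists 1 => //; exists (fun i => (i == j)%:R); rewrite mul1r (bigD1 j) //= eqxx mul1r.
by rewrite big1 ?addr0 // => i /negbTE ->; rewrite mul0r.
Qed.

Lemma locgen_unit d (g : 'I_d -> D) u x : ~ m u -> locgen g (u * x) -> locgen g x.
Proof.
move=> mu [v mv [c vc]]; exists (v * u); first exact: not_primeM.
by exists c; rewrite -mulrA.
Qed.

End LocalGenerators.

Section SeparatingBasis.
Variables (k : closedFieldType) (D : idomainType) (kappa : {rmorphism k -> D}).

Lemma kappa_eq0 c : kappa c = 0 -> c = 0.
Proof. by move/eqP; rewrite fmorph_eq0 => /eqP. Qed.

Lemma closed_nth_root n (a : k) : (0 < n)%N -> exists b, b ^+ n = a.
Proof.
move=> n0; have [x xE] := @solve_monicpoly k n (fun i => if i == 0%N then a else 0) n0.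
exists x; rewrite xE; case: n n0 {xE} => // n _.
by rewrite big_ord_recl /= mulr1 big1 ?addr0 // => i _; rewrite mul0r.
Qed.

(* A relation all of whose partial derivatives vanish is a [p]-th power. *)
Lemma minimal_relation_separable n (x : 'I_n -> D) f :
  f != 0 -> mmap kappa x f = 0 ->
  (forall g, g != 0 -> mmap kappa x g = 0 -> (mmeasure (@mdeg n) f <= mmeasure (@mdeg n) g)%N) ->
  exists j, mmap kappa x (mderiv j f) != 0.
Proof.
move=> f0 fx fmin; apply: contrapT => /forallNP noj.
have small g : mmap kappa x g = 0 -> (mmeasure (@mdeg n) g < mmeasure (@mdeg n) f)%N -> g = 0.
  move=> gx lt_gf; apply/eqP/negPn/negP => g0.
  by have := fmin g g0 gx; rewrite leqNgt lt_gf.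
have deriv0 j : mderiv j f = 0.
  apply: small; first by apply/eqP/negPn/negP => h; apply: (noj j).
  have sf : (0 < mmeasure (@mdeg n) f)%N by rewrite lt0n msize_poly_eq0.
  rewrite msizeE -(prednK sf) ltnS; apply/bigmax_leqP_seq => m mf _.
  rewrite -ltnS prednK //; apply: leq_ltn_trans (@msize_mdeg_lt _ _ f (mnm_add m (mnm1 j)) _).
    by rewrite mdegD mdeg1 addn1.
  move: mf; rewrite !mcoeff_msupp mcoeff_mderiv; apply: contraNneq => ->.
  by rewrite mul0rn.
have chr m j : m \in msupp f -> (0 < m j)%N -> (m j)%:R = 0 :> k.
  move=> mf mj; have := congr1 (mcoeff (mnm_sub m (mnm1 j))) (deriv0 j).
  rewrite mcoeff0 mcoeff_mderiv submK; last by rewrite lep1mP -lt0n.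
  rewrite mnmBE mnm1E eqxx subn1 prednK // => E.
  have /eqP : mcoeff m f * (m j)%:R = 0 by rewrite mulr_natr.
  by rewrite mulf_eq0 mcoeff_eq0 mf /= => /eqP.
have [[m0 [j0 [m0f m0j]]]|const] := pselect (exists m j, m \in msupp f /\ (0 < fun_of_multinom m j)%N); last first.
  have fC : f = mpolyC n (mcoeff (mnm0) f).
    apply/mpolyP => m; rewrite mcoeffC; have [->|m0] := eqVneq m mnm0; first by rewrite mulr1.
    rewrite mulr0; apply: memN_msupp_eq0; apply/negP => mf; apply: const; exists m.
    have /existsP[j mj] : [exists j, m j != 0%N].
      rewrite -negb_forall; apply: contra m0 => /forallP h; apply/eqP/mnmP => j.
      by rewrite (eqP (h j)) mnm0E.
    by exists j; rewrite lt0n.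
  move: fx f0; rewrite fC mmapC => /kappa_eq0 ->.
  by rewrite mpolyC0 eqxx.
have [p chp] : exists p, p \in [pchar k].
  by apply: (natf0_pchar m0j); rewrite (chr _ _ m0f m0j).
have prp : prime p := pcharf_prime chp; have p0 := prime_gt0 prp.
have dvd m j : m \in msupp f -> (p %| m j)%N.
  move=> mf; have [->|/chr mj] := posnP (m j); first exact: dvdn0.
  by rewrite (dvdn_pcharf chp) mj.
have [rt rtE] := choice (fun a => closed_nth_root a p0).
pose q (m : multinom n) : multinom n := Multinom [tuple (m i %/ p)%N | i < n].
have qE m i : q m i = (m i %/ p)%N by rewrite multinomE tnth_mktuple.
have qdeg m : m \in msupp f -> (mdeg (q m) * p = mdeg m)%N.
  move=> mf; rewrite !mdegE big_distrl; apply: eq_bigr => i _.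
  by rewrite /= qE divnK ?dvd.
have qinj m m' : m \in msupp f -> m' \in msupp f -> q m = q m' -> m = m'.
  move=> mf m'f qq; apply/mnmP => i.
  by rewrite -(divnK (dvd m i mf)) -(divnK (dvd m' i m'f)) -!qE qq.
(* [h] is the [p]-th root of [f], built from [p]-th roots of the coefficients. Being a relation of
   smaller degree it vanishes by minimality, against its coefficient at [q m0]. *)
pose h := \sum_(m <- msupp f) rt (mcoeff m f) *: mpolyX k (q m).
have hcoef m' : mcoeff m' h = \sum_(m <- msupp f | q m == m') rt (mcoeff m f).
  rewrite raddf_sum /= [RHS]big_mkcond; apply: eq_bigr => m _.
  by rewrite mcoeffZ mcoeffX; case: eqP => _; rewrite ?mulr1 ?mulr0.
have h0 : h = 0.
  apply: small.
    have chD : p \in [pchar D] by apply: (rmorph_pchar kappa).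
    apply/eqP; have : mmap kappa x h ^+ p == 0.
      rewrite -(pFrobenius_autE chD) /h (raddf_sum (mmap kappa x)) (raddf_sum (pFrobenius_aut chD)) /= -[X in _ == X]fx [X in _ == X]/mmap.
      apply/eqP/eq_big_seq => m mf /=.
      rewrite mmapZ mmapX rmorphM /= !pFrobenius_autE -rmorphXn rtE; congr (_ * _).
      by rewrite /mmap1 -prodrXl; apply: eq_bigr => i _; rewrite -exprM qE divnK ?dvd.
    by rewrite expf_eq0 p0.
  rewrite msizeE; have f1 : (1 < mmeasure (@mdeg n) f)%N.
    apply: leq_ltn_trans (msize_mdeg_lt m0f); rewrite mdegE (bigD1 j0) //=.
    exact: leq_trans m0j (leq_addr _ _).
  rewrite -(prednK (ltnW f1)) ltnS; apply/bigmax_leqP_seq => m' m'h _.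
  rewrite -ltnS prednK ?(ltnW f1) //; have [m mf qm] : exists2 m, m \in msupp f & q m = m'.
    apply: contrapT => nm; move: m'h; rewrite mcoeff_msupp hcoef big_seq_cond big_pred0 ?eqxx //.
    by move=> m; apply/negP => /andP[mf /eqP qm]; apply: nm; exists m.
  have := qdeg m mf; have := prime_gt1 prp; have := msize_mdeg_lt mf; rewrite qm.
  case: (mdeg m') => // e; nia.
have := hcoef (q m0); rewrite h0 mcoeff0 big_mkcond (bigD1_seq m0) ?msupp_uniq //= eqxx.
rewrite big1_seq => [|m /andP[mm0 mf]].
  rewrite addr0 => /esym E; have := rtE (mcoeff m0 f); rewrite E expr0n eqn0Ngt p0 /= => /esym/eqP.
  by rewrite mcoeff_eq0 m0f.
by case: eqP => // /(qinj _ _ mf m0f) mE; rewrite mE eqxx in mm0.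
Qed.

End SeparatingBasis.

Section SeparatingTranscendenceBasis.
Variables (k : closedFieldType) (D : idomainType) (kappa : {rmorphism k -> D}).

Lemma minimal_relation n (z : 'I_n -> D) : ~ algindep kappa z ->
  exists2 f, f != 0 /\ mmap kappa z f = 0 &
  forall g, g != 0 -> mmap kappa z g = 0 -> (mmeasure (@mdeg n) f <= mmeasure (@mdeg n) g)%N.
Proof.
move=> /existsNP[f0 /not_implyP[f0z /eqP f00]].
have ex : exists e, `[< exists g, [/\ g != 0, mmap kappa z g = 0 & mmeasure (@mdeg n) g = e] >].
  by exists (mmeasure (@mdeg n) f0); apply/asboolP; exists f0.
case: (ex_minnP ex) => e /asboolP[f [f1 fz <-]] emin; exists f => // g g0 gz.
by apply: emin; apply/asboolP; exists g.
Qed.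

(* Substituting a variable for [z j] in [f] gives a polynomial with root [z j];
   it is nonzero because its linear Taylor coefficient there is the derivative. *)
Lemma algebraic_relation (R : idomainType) (iota : {rmorphism R -> D}) n (z : 'I_n -> D) f j :
  injective iota -> (forall c, algebraic_elt iota (kappa c)) ->
  (forall i, i != j -> algebraic_elt iota (z i)) ->
  mmap kappa z f = 0 -> mmap kappa z (mderiv j f) != 0 -> algebraic_elt iota (z j).
Proof.
move=> iinj kalg zalg fz dfz.
pose h i : {poly D} := if i == j then 'X else (z i)%:P.
pose p := mmap (polyC \o kappa) h f.
have mapC g : mmap (polyC \o kappa) (fun i => (z i)%:P) g = (mmap kappa z g)%:P.
  rewrite /mmap rmorph_sum; apply: eq_bigr => m _ /=; rewrite rmorphM; congr (_ * _).
  by rewrite /mmap1 rmorph_prod; apply: eq_bigr => i _; rewrite rmorphXn.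
have [q pE] : exists q, p = ('X - (z j)%:P) * (mmap kappa z (mderiv j f))%:P + ('X - (z j)%:P) ^+ 2 * q.
  have [|q] := @mmap_taylor k {poly D} (polyC \o kappa) n h (fun i => (z i)%:P) j f.
    by move=> i ij; rewrite /h (negbTE ij).
  by rewrite -/p !mapC fz polyC0 add0r /h eqxx => ->; exists q.
apply: (@algebraic_root _ _ iota iinj p).
- apply: contra_neq dfz => p0; apply/eqP.
  have : ('X - (z j)%:P) * ((mmap kappa z (mderiv j f))%:P + ('X - (z j)%:P) * q) = 0.
    by rewrite mulrDr mulrA -expr2 -pE.
  move/eqP; rewrite mulf_eq0 polyXsubC_eq0 /= => /eqP/(congr1 (horner_eval (z j))).
  by rewrite /horner_eval !hornerE subrr mul0r addr0 => ->.
- have algD (p1 p2 : {poly D}) : (forall i, algebraic_elt iota p1`_i) ->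
    (forall i, algebraic_elt iota p2`_i) -> forall i, algebraic_elt iota (p1 + p2)`_i.
    by move=> a1 a2 i; rewrite coefD; apply: algebraic_add.
  have alg0 : algebraic_elt iota 0 by rewrite -(rmorph0 iota); apply: algebraic_iota.
  have alg1 : algebraic_elt iota 1 by rewrite -(rmorph1 iota); apply: algebraic_iota.
  have algM (p1 p2 : {poly D}) : (forall i, algebraic_elt iota p1`_i) ->
    (forall i, algebraic_elt iota p2`_i) -> forall i, algebraic_elt iota (p1 * p2)`_i.
    move=> a1 a2 i; rewrite coefM; apply: big_ind => // [x y|l _].
      exact: algebraic_add.
    exact: algebraic_mul.
  have algC c : algebraic_elt iota c -> forall i, algebraic_elt iota (c%:P : {poly D})`_i.
    by move=> ac i; rewrite coefC; case: ifP.
  apply: (big_ind (fun g : {poly D} => forall i, algebraic_elt iota g`_i)); [|exact: algD|].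
    by move=> i; rewrite coef0.
  move=> m _; apply: (algM); first exact/algC/kalg.
  apply: (big_ind (fun g : {poly D} => forall i, algebraic_elt iota g`_i)); [exact: (algC 1)|exact: algM|].
  move=> i _; elim: (fun_of_multinom m i) => [|e IHe]; first exact: (algC 1).
  rewrite exprS; apply: (algM) => //; rewrite /h; case: (eqVneq i j) => [_ l|ij]; last exact/algC/zalg.
  by rewrite coefX; case: eqP.
- by rewrite pE /root !hornerE subrr expr0n !mul0r addr0.
Qed.

Lemma algebraic_var n (z : 'I_n -> D) i : algebraic_elt (mmap kappa z) (z i).
Proof.
have -> : z i = mmap kappa z (mpolyX k (mnm1 i)) by rewrite mmapX mmap1U.
exact: algebraic_iota.
Qed.

(** Induction on [n]: a minimal relation with nonzero partial derivative at [j] lets [z j] be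
    dropped, and this derivative becomes a factor of [w]. Where [w] lies outside [m], the relation
    can be solved for [z j] as in the implicit function theorem, so the other coordinates generate
    locally. *)
Lemma separating_basis n (z : 'I_n -> D) : exists d (s : 'I_d -> 'I_n),
  [/\ algindep kappa (z \o s),
      forall i, algebraic_elt (mmap kappa (z \o s)) (z i)
    & exists2 w, w != 0 & forall (m : D -> Prop) (mu : 'I_n -> k), prime_prop m -> ~ m w ->
        (forall i, m (z i - kappa (mu i))) ->
        forall i, locgen m (fun j => z (s j) - kappa (mu (s j))) (z i - kappa (mu i))].
Proof.
elim: n z => [|n IH] z; have [iz|dz] := pselect (algindep kappa z).
1,3: exists _, id; split=> [||] //;
     [move=> i; exact: (algebraic_var (z \o id))
     |exists 1; rewrite ?oner_neq0 // => m mu [idm m1 prm] _ _ i; exact: (locgen_mem m1)].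
  by have [f [f0 fz] fmin] := minimal_relation dz; have [[]] := minimal_relation_separable f0 fz fmin.
have [f [f0 fz] fmin] := minimal_relation dz.
have [j dfz] := minimal_relation_separable f0 fz fmin.
have [d [s [is' algs [w w0 hw]]]] := IH (z \o lift j).
exists d, (lift j \o s); split=> //.
  have zalg i : i != j -> algebraic_elt (mmap kappa (z \o (lift j \o s))) (z i).
    by rewrite eq_sym => /unlift_some[i' -> _]; apply: algs.
  move=> i; have [->|/zalg //] := eqVneq i j.
  apply: (algebraic_relation _ _ zalg fz dfz) => [|c]; first exact: algindep_inj.
  have -> : kappa c = mmap kappa (z \o (lift j \o s)) (mpolyC d c) by rewrite mmapC.
  exact: algebraic_iota.
exists (w * mmap kappa z (mderiv j f)); first exact: mulf_neq0.
move=> m mu prm mw hmu; have [idm m1 pm] := prm; have [m0 mD mM] := idm.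
have mw' : ~ m w by move=> h; apply: mw; rewrite mulrC; apply: mM.
have mdf : ~ m (mmap kappa z (mderiv j f)) by move=> h; apply: mw; apply: mM.
set L := locgen m _; have idL : ideal_prop L by apply: locgen_ideal.
have Lz i : i != j -> L (z i - kappa (mu i)).
  rewrite eq_sym => /unlift_some[i' -> _]; apply: (hw m (mu \o lift j)) => // i0; exact: hmu.
move=> i; have [->|/Lz //] := eqVneq i j.
(* With [z j] replaced by its value, the Taylor expansion gives [f(y) = - u * (z j - mu j)], where
   [u] is the derivative modulo [m], hence outside [m]. Modulo [L] this is the scalar [f(mu)], which
   is zero because it lies in [m]. *)
pose y i := if i == j then kappa (mu j) else z i.
have [|q yE] := @mmap_taylor k D kappa n.+1 y z j f.
  by move=> i' ij; rewrite /y (negbTE ij).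
pose u := mmap kappa z (mderiv j f) + (kappa (mu j) - z j) * q.
have mu' : ~ m u.
  move=> hu; apply: mdf; have := mD _ _ hu (mM q _ (hmu j)).
  have -> // : u + q * (z j - kappa (mu j)) = mmap kappa z (mderiv j f) by rewrite /u; ring.
apply: (locgen_unit pm mu').
have fyE : mmap kappa y f = - (u * (z j - kappa (mu j))).
  by rewrite yE fz /u /y eqxx; ring.
suff Lfy : L (mmap kappa y f).
  by have [_ _ LM] := idL; have := LM (-1) _ Lfy; rewrite fyE mulN1r opprK.
have c0 : meval mu f = 0.
  apply/eqP/negPn/negP => c0; apply: m1.
  have := mM (kappa (meval mu f)^-1) _ (mmap_congr kappa f idm hmu).
  rewrite fz sub0r mulrN -[mmap _ _ _]/(mmap kappa (kappa \o mu) f) mmap_const -rmorphM mulVf //.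
  by rewrite rmorph1 => /(mM (-1)); rewrite mulrNN mulr1.
have := mmap_congr kappa f idL (_ : forall i, L (y i - kappa (mu i))).
rewrite -[mmap _ (fun i => kappa _) _]/(mmap kappa (kappa \o mu) f) mmap_const c0 rmorph0 subr0.
apply=> i'; rewrite /y; have [->|/Lz //] := eqVneq i' j.
by rewrite subrr; have [L0 _ _] := idL.
Qed.

End SeparatingTranscendenceBasis.

(** * The lower bound *)

Section SpanDimBasis.
Variables (K : fieldType) (A : algType K) (M : lmodType A).

Lemma span_dim_indep (s : seq M) :
  exists2 x : 'I_(span_dim s) -> M, indep x & forall i, x i \in s.
Proof.
pose P (I : {set 'I_(size s)}) := `[< lin_indep (tnth (in_tuple s)) I >].
have P0 : P finset.set0 by apply/asboolP => c _ i; rewrite finset.in_set0.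
case: (@arg_maxnP _ finset.set0 P (fun I : {set 'I_(size s)} => #|I|) P0) => I PI Imax.
have -> : span_dim s = #|I|.
  apply/eqP; rewrite eqn_leq (@leq_bigmax_cond _ P (fun I : {set 'I_(size s)} => #|I|)) // andbT.
  by apply/bigmax_leqP => J PJ; apply: Imax.
exists (fun i : 'I_#|I| => s`_(enum_val i)); first by apply: lin_indep_enum; apply/asboolP.
by move=> i; apply: mem_nth.
Qed.

End SpanDimBasis.

Section TensorEmbedding.
Variables (k : fieldType) (A : algType k) (Z : central_subdomain A).
Local Notation AQ := (frac_tensor Z).

Definition tens_of (a : A) : AQ := \pi_AQ [:: (1, a)].

Lemma tens_ofD a b : tens_of (a + b) = tens_of a + tens_of b.
Proof.
rewrite -[RHS]/(tens_add _ _) tens_addE; apply/tens_piP => G f [fl fr fz].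
by rewrite /tens_eval !big_cons !big_nil !addr0 fr.
Qed.

Lemma tens_of_zmod : zmod_morphism tens_of.
Proof.
move=> a b; apply: (addIr (tens_of b)); rewrite -tens_ofD subrK.
by rewrite -addrA addNr addr0.
Qed.

HB.instance Definition _ := GRing.isZmodMorphism.Build A AQ tens_of tens_of_zmod.

Lemma tens_of_monoid : monoid_morphism tens_of.
Proof.
split=> // a b; rewrite -[RHS]/(tens_mul _ _) tens_mulE; apply/tens_piP => G f bf.
by rewrite tens_eval_mul /tens_eval !big_seq1 /= mulr1.
Qed.

HB.instance Definition _ := GRing.isMonoidMorphism.Build A AQ tens_of tens_of_monoid.

Lemma tens_pi_sum s : \pi_AQ s = \sum_(x <- s) x.1 *: tens_of x.2.
Proof.
elim: s => [|x s IH]; first by rewrite big_nil.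
rewrite big_cons -IH -[x.1 *: _]/(tens_scale _ _) tens_scaleE -[RHS]/(tens_add _ _) tens_addE.
by rewrite /= mulr1; case: x.
Qed.

Lemma tens_of_csd (z : csd Z) a : tens_of (val z * a) = of_csd z *: tens_of a.
Proof.
rewrite -[RHS]/(tens_scale _ _) tens_scaleE; apply/tens_piP => G f [fl fr fz].
by rewrite /tens_eval /= !big_seq1 /= fz.
Qed.

(** The balanced germ map sends [tens_of a] to the germ of [t |-> t * a]. If that germ is zero, some
    nonzero [s] in [Z] kills [a], and [s] is not a zero divisor. *)
Lemma tens_of_inj : injective tens_of.
Proof.
apply: raddf_inj => a /tens_piP/(_ _ _ (@germ_map_balanced _ _ Z)).
rewrite /tens_eval big_seq1 big_nil -(raddf0 \pi_(Quotient.quot (germ_zmod Z))).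
move/eqP; rewrite -Quotient.idealrBE => /asboolP[s s0 /(_ 1)].
rewrite !fctE subr0 !mulr1 (@germ_numE _ _ _ _ _ s) ?mulr1 // => vs.
apply: (csd_regular (valP s) _ vs).
by apply: contraNneq s0 => sv; apply/eqP/val_inj; rewrite sv rmorph0.
Qed.

Lemma tens_denominator (u : AQ) : exists2 s : csd Z, s != 0 & exists a, of_csd s *: u = tens_of a.
Proof.
elim/quotW: u => l; rewrite tens_pi_sum; elim: l => [|[q a] l [s s0 [b sb]]].
  by exists 1; rewrite ?oner_neq0 //; exists 0; rewrite big_nil scaler0 raddf0.
have [e [n [e0 en]]] := csd_fracP q.
exists (e * s); first by rewrite mulf_neq0.
exists (val (s * n) * a + val e * b).
rewrite big_cons scalerDr tens_ofD !tens_of_csd -sb; congr (_ + _); last by rewrite scalerA -rmorphM.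
by rewrite scalerA !rmorphM /= en mulrAC mulrC mulrA.
Qed.

Lemma tens_denominator_seq (V : seq AQ) : exists2 s : csd Z, s != 0 &
  {in V, forall v, exists a, of_csd s *: v = tens_of a}.
Proof.
elim: V => [|v V [s s0 IH]]; first by exists 1; rewrite ?oner_neq0.
have [e e0 [a ea]] := tens_denominator v.
exists (e * s) => [|u]; first by rewrite mulf_neq0.
rewrite inE => /orP[/eqP ->|/IH[b sb]].
  by exists (val s * a); rewrite tens_of_csd -ea scalerA mulrC rmorphM.
by exists (val e * b); rewrite tens_of_csd -sb scalerA rmorphM.
Qed.

Lemma tens_scaleE_mul (c : csd_frac Z) (u : AQ^o) : c%:A *: u = c *: (u : AQ).
Proof. by rewrite -[LHS]/(_ * _) -scalerAl mul1r. Qed.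

End TensorEmbedding.

Section GKLowerBound.
Variables (R : realType) (k : fieldType) (A : algType k) (Z : central_subdomain A).
Local Notation AQ := (frac_tensor Z).
Local Notation kappa := (in_alg (csd Z)).
Variables (d : nat) (t : 'I_d -> csd Z).
Hypothesis ind_t : algindep kappa t.

Definition csd_indep n (a : 'I_n -> A) : Prop :=
  forall z : 'I_n -> csd Z, \sum_i val (z i) * a i = 0 -> forall i, z i = 0.

Lemma indep_csd_indep n (x : 'I_n -> AQ^o) (a : 'I_n -> A) (s : csd Z) : s != 0 ->
  indep x -> (forall i, of_csd s *: (x i : AQ) = tens_of Z (a i)) -> csd_indep a.
Proof.
move=> s0 ix xa z za i; apply/eqP; have := ix (fun i => of_csd (z i * s)).
have h : \sum_i (of_csd (z i * s))%:A *: x i = 0.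
  transitivity (tens_of Z (\sum_i val (z i) * a i)); last by rewrite za raddf0.
  rewrite raddf_sum; apply: eq_bigr => j _ /=.
  by rewrite tens_of_csd -xa tens_scaleE_mul rmorphM -scalerA.
by move=> /(_ h i)/eqP; rewrite of_csd_eq0 mulf_eq0 (negbTE s0) orbF.
Qed.

(** Regroup a relation over [k] by the [a i]: independence over [Z] makes each polynomial in [t]
    vanish, then algebraic independence makes its coefficients vanish. *)
Lemma monomial_products_indep n (a : 'I_n -> A) N : csd_indep a ->
  indep (fun i : 'I_#|{: {ffun 'I_d -> 'I_N} * 'I_n}| =>
    let ai := enum_val i in val (monomial t (fun j => ai.1 j)) * a ai.2 : A^o).
Proof.
move=> ia; apply: (@indep_enum _ _ A^o _
  (fun ai : {ffun 'I_d -> 'I_N} * 'I_n => val (monomial t (fun j => ai.1 j)) * a ai.2)).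
move=> c c0 [al i].
pose F i := \sum_(b : {ffun 'I_d -> 'I_N}) kappa (c (b, i)) * monomial t (fun j => b j).
suff h : \sum_i val (F i) * a i = 0.
  exact: (algindep_monomials (c := fun b => c (b, i)) ind_t (ia F h i)).
rewrite -[RHS]c0.
transitivity (\sum_(b : {ffun 'I_d -> 'I_N}) \sum_i'
    (c (b, i'))%:A * (val (monomial t (fun j => b j)) * a i')).
  rewrite exchange_big; apply: eq_bigr => i' _.
  rewrite /F raddf_sum mulr_suml; apply: eq_bigr => b _ /=.
  by rewrite -!scalerAl !mul1r.
by rewrite pair_bigA /=; apply: eq_bigr => -[b i'].
Qed.

(** Denominators are central, so a word of length [n] needs only [s ^+ n]. Having [val s] among the
    letters of [W] allows shorter words to be brought to the same denominator. *)
Lemma frac_tensor_words (V : seq AQ) (s : csd Z) (W : seq A) :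
  {in V, forall v, exists2 a, a \in W & of_csd s *: v = tens_of Z a} -> val s \in W ->
  forall n, {in awords V n, forall x : AQ, exists2 a,
    kspan (awords W n) a & of_csd s ^+ n *: x = tens_of Z a}.
Proof.
move=> VW sW; elim=> [|n IH] x.
  by rewrite inE => /eqP ->; exists 1; [apply: kspan_awords1|rewrite expr0 scale1r rmorph1].
rewrite /awords wordsS mem_cat => /orP[/IH[a an sa]|/allpairsP[[v w] [/= /VW[b bW sb] /IH[a an sa] ->]]].
  exists (val s * a); first by apply: (@kspan_wordsS _ _ A^o).
  by rewrite tens_of_csd -sa scalerA -exprS.
exists (b * a); first by apply: (@kspan_wordsS _ _ A^o).
rewrite rmorphM /= -sb -sa -[v *: w]/(v * w) exprS.
by rewrite -scalerAl -scalerAr scalerA.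
Qed.

Lemma GKdim_frac_tensor_le : (d%:R%:E + GKdim_alg R AQ <= GKdim_alg R A)%E.
Proof.
rewrite addeC -leeBrDr //; apply/ereal_supP => _ [V _ <-]; rewrite leeBrDr // addeC gk_growthE.
have [s s0 hs] := tens_denominator_seq V.
have [W0 hW0] : exists W0 : seq A, {in V, forall v, exists2 a, a \in W0 & of_csd s *: v = tens_of Z a}.
  elim: (V) hs => [|v V' IH] hs; first by exists [::].
  have [a va] := hs v (mem_head _ _).
  have [|W0 hW0] := IH; first by move=> u uV; apply: hs; rewrite inE uV orbT.
  exists (a :: W0) => u; rewrite inE => /orP[/eqP ->|/hW0[b bW ub]]; first by exists a; rewrite ?mem_head.
  by exists b => //; rewrite inE bW orbT.
pose W := val s :: W0 ++ [seq val (t j) | j <- enum 'I_d].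
have W0W : {subset W0 <= W} by move=> a aW; rewrite inE mem_cat aW orbT.
have tW j : val (t j) \in W by rewrite inE mem_cat (map_f (fun j => val (t j))) ?mem_enum // !orbT.
apply: le_trans (growth_le_GKdim_alg R W).
(* A monomial in [t] with exponents at most [n] takes [d * n] letters and the numerator it
   multiplies takes [n] more. *)
apply: (@growth_add _ _ _ d.+1) => // n.
  apply: (@span_dim_ge _ _ _ _ 1 (fun=> 1 : AQ^o)) => [c|_]; last exact: kspan_awords1.
  rewrite big_ord1 tens_scaleE_mul => /eqP c1 i; rewrite ord1; apply/eqP.
  apply: contraTT (oner_neq0 AQ) => c0; rewrite negbK -[1](scalerK c0) (eqP c1).
  by rewrite scaler0.
have [x ix xV] := span_dim_indep (awords V n).
have /choice[a ha] i : exists a, kspan (awords W n) a /\ of_csd s ^+ n *: (x i : AQ) = tens_of Z a.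
  have [|a aW sa] := @frac_tensor_words V s W _ (mem_head _ _) n _ (xV i); last by exists a.
  by move=> v /hW0[a /W0W aW va]; exists a.
have ia : csd_indep a.
  apply: (@indep_csd_indep _ x a (s ^+ n)) => //; first by rewrite expf_neq0.
  by move=> i; rewrite rmorphXn; have [] := ha i.
have iy := monomial_products_indep (N := n.+1) ia.
have -> : (n.+1 ^ d * span_dim (awords V n))%N =
    #|{: {ffun 'I_d -> 'I_n.+1} * 'I_(span_dim (awords V n))}|.
  by rewrite card_prod card_ffun !card_ord.
apply: span_dim_ge iy _ => i; rewrite mulSn addnC.
apply: (@kspan_awords_mul _ A); last by have [] := ha (enum_val i).2.
rewrite rmorph_prod; apply: (@kspan_words_leq _ _ _ _ _ (\sum_(j < d) 1 * n)).
  by rewrite sum_nat_const card_ord mul1n.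
apply: (@kspan_awords_prod k A) => j _.
apply: (@kspan_words_leq _ _ _ _ _ (1 * (enum_val i).1 j)).
  by rewrite leq_mul2l -ltnS ltn_ord.
by rewrite rmorphXn; apply/kspan_awords_exp/(kspan_awords_gen _ (tW j)).
Qed.

End GKLowerBound.

Section CentralSubdomainBasis.
Variables (R : realType) (k : closedFieldType) (A : algType k) (Z : central_subdomain A).
Local Notation kappa := (in_alg (csd Z)).

Lemma csd_affine_ind (P : csd Z -> Prop) : P 1 ->
  (forall c u v, P u -> P v -> P (c *: u + v)) -> (forall u v, P u -> P v -> P (u * v)) ->
  forall s : seq (csd Z), (forall S : {pred csd Z},
    GRing.subalg_closed S -> {subset s <= S} -> forall x, x \in S) ->
  {in s, forall x, P x} -> forall x, P x.
Proof.
move=> P1 PD PM s gen Ps x; pose S : {pred csd Z} := fun x => `[< P x >].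
have SP y : reflect (P y) (y \in S) by exact: asboolP.
apply/SP/gen => [|v vV]; last exact/SP/Ps.
by split=> [|c u v /SP ? /SP ?|u v /SP ? /SP ?]; apply/SP; [|apply: PD|apply: PM].
Qed.

Lemma csd_separating_basis : affine_algebra (csd Z) ->
  exists d (t : 'I_d -> csd Z), [/\ algindep kappa t,
    forall x, algebraic_elt (mmap kappa t) x
  & exists2 w, w != 0 & forall (m : csd Z -> Prop) (la : 'I_d -> k), prime_prop m -> ~ m w ->
      (forall x, exists c : k, m (x - kappa c)) -> (forall j, m (t j - kappa (la j))) ->
      forall x, m x -> locgen m (fun j => t j - kappa (la j)) x].
Proof.
move=> [s gen]; pose z := tnth (in_tuple s).
have [d [sg [it zalg [w w0 hw]]]] := @separating_basis k (csd Z) kappa _ z.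
exists d, (z \o sg); split=> //.
  have c1 : algebraic_elt (mmap kappa (z \o sg)) 1.
    by rewrite -(rmorph1 (mmap kappa (z \o sg))); apply: algebraic_iota.
  have cC (c : k) : algebraic_elt (mmap kappa (z \o sg)) (kappa c).
    have -> : kappa c = mmap kappa (z \o sg) (mpolyC d c) by rewrite mmapC.
    exact: algebraic_iota.
  apply: (csd_affine_ind c1 _ _ gen) => [c u v au av|u v|x /seq_tnthP[i ->]].
  - rewrite -[u]mul1r scalerAl; apply: algebraic_add => //; exact: (algebraic_mul (cC c) au).
  - exact: algebraic_mul.
  - exact: zalg.
exists w => // m la prm mw hm hla x mx; have [idm m1 pm] := prm; have [m0 mD mM] := idm.
have /choice[mu hmu] i := hm (z i).
have mC c : m (kappa c) -> c = 0.
  move=> mc; apply/eqP/negPn/negP => c0; apply: m1.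
  by have := mM (kappa c^-1) _ mc; rewrite -rmorphM mulVf // rmorph1.
have muE j : mu (sg j) = la j.
  apply/eqP; rewrite -subr_eq0; apply/eqP/mC.
  have := ideal_propB idm (hla j) (hmu (sg j)).
  by rewrite opprB addrC addrA subrK rmorphB.
have := hw m mu prm mw hmu; set g := (fun j => _); have -> : g = (fun j => (z \o sg) j - kappa (la j)).
  by apply/funext => j; rewrite /g muE.
set L := locgen m _ => Lz; have idL : ideal_prop L by exact: locgen_ideal.
have [L0 LD LM] := idL.
have Lm y : L y -> m y.
  move=> [u mu' [c uy]]; have : m (u * y).
    by rewrite uy; apply: ideal_prop_sum => // j _ _; apply: mM; apply: hla.
  by case/pm.
(* Elements congruent to a scalar modulo [L] form a subalgebra containing the generators of [Z], so
   every [x] is one. For [x] in [m] the scalar lies in [m], hence is zero. *)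
have [c xc] : exists c : k, L (x - kappa c).
  move: x {mx}; apply: (csd_affine_ind _ _ _ gen) => [|c u v [a ua] [b vb]|u v [a ua] [b vb]|y /seq_tnthP[i ->]].
  - by exists 1; rewrite rmorph1 subrr.
  - exists (c * a + b); have := LD _ _ (LM (kappa c) _ ua) vb.
    by rewrite rmorphD rmorphM mulrBr mulr_algl addrACA opprD.
  - exists (a * b); have := LD _ _ (LM v _ ua) (LM (kappa a) _ vb).
    by rewrite mulrBr mulrBr rmorphM [v * u]mulrC [v * kappa a]mulrC addrA subrK.
  - by exists (mu i); apply: Lz.
have : m (kappa c) by have := ideal_propB idm mx (Lm _ xc); rewrite subKr.
by move/mC => c0; move: xc; rewrite c0 rmorph0 subr0.
Qed.

Lemma algindep_csd_frac n (x : 'I_n -> csd Z) : algindep kappa x ->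
  (n%:R%:E <= GKdim_alg R (csd_frac Z))%E.
Proof.
move=> ix; apply: (@algindep_GKdim R k (csd_frac Z) n (fun i => of_csd (x i))) => p px.
apply: ix; apply/eqP; rewrite -of_csd_eq0 -[X in _ == X]px; apply/eqP.
rewrite /mmap rmorph_sum; apply: eq_bigr => m _; rewrite rmorphM; congr (_ * _).
  by rewrite /= csd_frac_alg.
by rewrite /mmap1 rmorph_prod; apply: eq_bigr => i _; rewrite rmorphXn.
Qed.

Lemma GKdim_csd_frac d (t : 'I_d -> csd Z) : algindep kappa t ->
  (forall x, algebraic_elt (mmap kappa t) x) -> GKdim_alg R (csd_frac Z) = d%:R%:E.
Proof.
by move=> it at_; apply/eqP; rewrite eq_le (GKdim_csd_frac_le R it at_) (algindep_csd_frac it).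
Qed.

End CentralSubdomainBasis.

(** * Free resolutions, grade and the upper bound *)

Section LinearSpan.
Variables (A : nzRingType) (M : lmodType A) (s : seq M).

Lemma lspan0 : lspan s 0.
Proof. by exists (fun=> 0); rewrite big1 // => i _; rewrite scale0r. Qed.

Lemma lspanD x y : lspan s x -> lspan s y -> lspan s (x + y).
Proof.
move=> [c ->] [e ->]; exists (fun i => c i + e i); rewrite -big_split.
by apply: eq_bigr => i _; rewrite scalerDl.
Qed.

Lemma lspanZ a x : lspan s x -> lspan s (a *: x).
Proof.
move=> [c ->]; exists (fun i => a * c i); rewrite scaler_sumr.
by apply: eq_bigr => i _; rewrite scalerA.
Qed.

Lemma lspan_mem x : x \in s -> lspan s x.
Proof.
move=> xs; have ix : (index x s < size s)%N by rewrite index_mem.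
exists (fun i => (i == index x s :> nat)%:R).
rewrite (bigD1 (Ordinal ix)) //= eqxx scale1r nth_index // big1 ?addr0 // => j.
by rewrite -val_eqE /= => /negbTE ->; rewrite scale0r.
Qed.

End LinearSpan.

Section FreeModule.
Variables (A : nzRingType) (T : choiceType) (N : lmodType A) (f : T -> N).

(** [malg T A] is used only as the free module on [T]; this is the universal map extending [f]. *)
Definition free_lift (g : malg T A) : N :=
  \sum_(x <- monalg.msupp g) monalg.mcoeff x g *: f x.

Lemma free_lift_incl (E : finSet T) g : fsubset (monalg.msupp g) E ->
  free_lift g = \sum_(x <- E) monalg.mcoeff x g *: f x.
Proof.
move=> sE; rewrite /free_lift (big_fset_incl _ sE) // => x xE xg.
by rewrite mcoeff_outdom // scale0r.
Qed.

Lemma free_lift_linear : linear free_lift.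
Proof.
move=> a g h; pose E := fsetU (monalg.msupp (a *: g + h)) (fsetU (monalg.msupp g) (monalg.msupp h)).
rewrite !(@free_lift_incl E) ?fsubsetUl //.
- rewrite scaler_sumr -big_split; apply: eq_bigr => x _ /=.
  by rewrite monalg.mcoeffD monalg.mcoeffZ scalerDl scalerA.
- by rewrite fsubsetU // fsubsetUr orbT.
- by rewrite fsubsetU // fsubsetUl orbT.
Qed.

HB.instance Definition _ := GRing.isLinear.Build A (malg T A) N *:%R free_lift free_lift_linear.

Lemma free_lift_gen x : free_lift (mkmalgU x 1) = f x.
Proof. by rewrite (free_lift_incl msuppU_le) big_seq_fset1 mcoeffUU scale1r. Qed.

End FreeModule.

Section FreeProjective.
Variables (A : nzRingType) (T : choiceType).

Lemma free_expand (g : malg T A) :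
  g = \sum_(x <- monalg.msupp g) monalg.mcoeff x g *: mkmalgU x 1.
Proof.
rewrite [LHS]monalgE; apply: eq_bigr => x _; apply/malgP => y.
by rewrite monalg.mcoeffZ !mcoeffU mulrnAr mulr1.
Qed.

Lemma free_projective : projective (malg T A).
Proof.
move=> X Y g f gs; have [h hE] := choice (fun x => gs (f (mkmalgU x 1))).
exists (free_lift h) => p; rewrite [in RHS](free_expand p) !linear_sum.
by apply: eq_bigr => x _; rewrite !linearZ /= hE.
Qed.

End FreeProjective.

Section MkLinear.
Variables (A : nzRingType) (U V : lmodType A) (f : U -> V).
Hypothesis flin : linear f.

Definition mklinear : {linear U -> V} :=
  HB.pack f (GRing.isLinear.Build A U V *:%R f flin).

Lemma mklinearE x : mklinear x = f x. Proof. by []. Qed.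

End MkLinear.

Section Kernel.
Variables (A : nzRingType) (U V : lmodType A) (f : {linear U -> V}).

Definition ker_pred : {pred U} := fun x => f x == 0.

Lemma ker_closed : submod_closed ker_pred.
Proof.
split=> [|a x y]; rewrite !unfold_in; first by rewrite linear0.
by move=> /eqP fx /eqP fy; rewrite linearP fx fy scaler0 addr0.
Qed.

Definition ker : submodClosed U :=
  HB.pack_for (submodClosed U) ker_pred (GRing.isSubmodClosed.Build A U ker_pred ker_closed).

Lemma ker_in x : (x \in ker) = (f x == 0). Proof. by []. Qed.

End Kernel.

Section FreeResolution.
Variables (A : nzRingType) (M : lmodType A).

(** Each free module has all elements of the previous syzygy as its basis, so no generators are
    chosen. [Ext_neq0] accepts any projective resolution, however large. *)
Fixpoint syzygy n : lmodType A :=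
  if n is n'.+1 then subm (ker (free_lift (@id (syzygy n')))) else M.

Definition syz_map n : {linear malg (syzygy n) A -> syzygy n} := free_lift (@id (syzygy n)).

Definition syz_val n (s : syzygy n.+1) : malg (syzygy n) A :=
  subm_val (s : subm (ker (free_lift (@id (syzygy n))))).

Lemma syz_val_linear n : linear (@syz_val n).
Proof. by []. Qed.

Lemma syz_val_eq0 n s : @syz_val n s = 0 -> s = 0.
Proof. by move=> s0; apply: val_inj. Qed.

Lemma syz_map_surj n s : exists z, syz_map n z = s.
Proof. by exists (mkmalgU s 1); apply: free_lift_gen. Qed.

Lemma syz_map_val n s : syz_map n (syz_val s) = 0.
Proof. by apply/eqP; apply: (valP (s : subm (ker (free_lift (@id (syzygy n)))))). Qed.

Lemma syz_val_surj n y : syz_map n y = 0 -> exists s, @syz_val n s = y.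
Proof.
move=> y0; have yk : y \in ker (free_lift (@id (syzygy n))) by rewrite ker_in; apply/eqP.
by exists (Subm yk).
Qed.

Lemma syz_diff_linear n : linear (fun y => @syz_val n (syz_map n.+1 y)).
Proof. by move=> a x y; rewrite linearP syz_val_linear. Qed.

Lemma syz_exact n y : syz_map n y = 0 <-> exists z, syz_val (syz_map n.+1 z) = y.
Proof.
split=> [/syz_val_surj[s <-]|[z <-]]; last exact: syz_map_val.
by have [z <-] := syz_map_surj s; exists z.
Qed.

Lemma syz_exactS n y : syz_val (syz_map n.+1 y) = 0 <-> exists z, syz_val (syz_map n.+2 z) = y.
Proof.
by rewrite -syz_exact; split=> [/syz_val_eq0 //|->].
Qed.

Definition free_resolution : proj_resolution M :=
  @ProjResolution A M (fun n => malg (syzygy n) A) (fun n => mklinear (@syz_diff_linear n))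
    (syz_map 0) (fun n => @free_projective _ _) (syz_map_surj (n := 0)) (@syz_exact 0) syz_exactS.

End FreeResolution.

Section ExtStep.
Variables (A : nzRingType) (M : lmodType A) (P : proj_resolution M).

(** With the resolution fixed, the long exact sequence becomes a statement about cochains on one
    complex. *)
Definition Ext_at j (L : lmodType A) : Prop :=
  exists f : {linear P j -> L}, cocycle f /\ ~ coboundary f.

(* The piece Ext^j(M, L) -> Ext^j(M, L') -> Ext^(j+1)(M, L) of the long exact
   sequence of 0 -> L -> L -> L' -> 0, whose first map is [x]. *)
Lemma Ext_at_quotient j (L L' : lmodType A) (x : A) (p : {linear L -> L'}) :
  (forall a, x * a = a * x) -> (forall l : L, x *: l = 0 -> l = 0) ->
  (forall y, exists l, p l = y) -> (forall l, p l = 0 <-> exists l', l = x *: l') ->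
  Ext_at j L' -> Ext_at j L \/ Ext_at j.+1 L.
Proof.
move=> xC xreg psurj pker [f [fco fcob]].
apply: contrapT => /not_orP[nj nj1]; apply: fcob.
have [f' f'E] := @pr_projective _ _ P j L L' p f psurj.
have xinj (l l' : L) : x *: l = x *: l' -> l = l'.
  by move=> e; apply/eqP; rewrite -subr_eq0; apply/eqP/xreg; rewrite scalerBr e subrr.
have dz z : p (f' (pr_diff P j z)) = 0 by rewrite f'E fco.
(* The lift [f'] fails to be a cocycle by a multiple of [x]; dividing by the regular [x] gives [g],
   which represents the connecting class. *)
have [g gE] := choice (fun z => (pker _).1 (dz z)).
have glin : linear g.
  move=> a u v; apply: xinj; rewrite -gE !linearP !gE scalerDr !scalerA xC.
  by [].
have gco : cocycle (mklinear glin).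
  move=> z; rewrite mklinearE; apply: xreg; rewrite -gE.
  have -> : pr_diff P j (pr_diff P j.+1 z) = 0 by apply/pr_exactS; exists z.
  by rewrite linear0.
have [h hE] : coboundary (mklinear glin).
  by apply: contrapT => ncob; apply: nj1; exists (mklinear glin).
(* As [g] is the coboundary of [h], this correction of the lift is a cocycle, and its image is still
   [f]. *)
pose f2 y := f' y - x *: h y.
have f2lin : linear f2.
  move=> a u v; rewrite /f2 !linearP scalerBr scalerDr opprD addrACA !scalerA xC.
  by [].
have f2co : cocycle (mklinear f2lin).
  by move=> z; rewrite mklinearE /f2 gE -hE mklinearE subrr.
have {}nj : coboundary (mklinear f2lin).
  by apply: contrapT => ncob; apply: nj; exists (mklinear f2lin).
have fE y : f y = p (f2 y).
  rewrite /f2 linearB f'E /=; have -> : p (x *: h y) = 0 by apply/pker; exists (h y).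
  by rewrite subr0.
case: j f {fco f' f'E dz g gE glin gco h hE nj1} f2 f2lin f2co nj fE => [|i] f f2 f2lin f2co /=.
  by move=> nj fE y; rewrite fE (_ : f2 y = 0) ?linear0 //; apply: nj.
move=> [g2 g2E] fE; have plin : linear (fun y => p (g2 y)) by move=> a u v; rewrite !linearP.
by exists (mklinear plin) => y; rewrite fE mklinearE -g2E.
Qed.

Lemma Ext_at0 (L : lmodType A) (h : {linear M -> L}) x : h x <> 0 -> Ext_at 0 L.
Proof.
move=> hx; have hlin : linear (fun y => h (pr_aug P y)) by move=> a u v; rewrite !linearP.
exists (mklinear hlin); split=> [z|cob].
  rewrite mklinearE; have -> : pr_aug P (pr_diff P 0 z) = 0 by apply/pr_exact0; exists z.
  by rewrite linear0.
by have [y yx] := pr_surj P x; apply: hx; rewrite -yx -(mklinearE hlin) cob.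
Qed.

End ExtStep.

Section Quotients.
Variables (A : nzRingType) (M V : lmodType A) (N : submodClosed M).

Lemma lquot_pi_linear : linear (lquot_pi N).
Proof. by move=> a x y; rewrite lquot_piD lquot_piZ. Qed.

Definition lquot_map : {linear M -> lquot N} := mklinear lquot_pi_linear.

Lemma lquot_map_surj q : exists x, lquot_map x = q.
Proof. by exists (repr (q : Quotient.quot (submod_zmod N))); apply: lquot_piK. Qed.

Lemma lquot_map_eq0 x : lquot_map x = 0 <-> x \in N.
Proof. by rewrite -[X in _ <-> X \in _]subr0 -lquot_pi_eq -(linear0 lquot_map). Qed.

Lemma lquot_lift (f : {linear M -> V}) : (forall x, x \in N -> f x = 0) ->
  exists h : {linear lquot N -> V}, forall x, h (lquot_map x) = f x.
Proof.
move=> fN; pose rep (q : lquot N) : M := repr (q : Quotient.quot (submod_zmod N)).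
have fE x : f (rep (lquot_map x)) = f x.
  apply/eqP; rewrite -subr_eq0 -linearB; apply/eqP/fN/lquot_pi_eq.
  exact: lquot_piK.
have hlin : linear (fun q => f (rep q)).
  move=> a u v; have [x <-] := lquot_map_surj u; have [y <-] := lquot_map_surj v.
  by rewrite -linearP !fE linearP.
by exists (mklinear hlin) => x; apply: fE.
Qed.

End Quotients.

Section Noetherian.
Variable A : nzRingType.

(** The chain condition in terms of sequences: it passes to quotients at once and directly supplies
    the linear dependency used in [many_killed_double]. *)
Definition noetherian_module (L : lmodType A) : Prop :=
  forall b : nat -> L, exists n (c : nat -> A), b n = \sum_(i < n) c i *: b i.

Lemma noetherian_module_surj (L L' : lmodType A) (p : {linear L -> L'}) :
  (forall y, exists x, p x = y) -> noetherian_module L -> noetherian_module L'.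
Proof.
move=> ps nL b; have [b' b'E] := choice (fun n => ps (b n)).
have [n [c bc]] := nL b'; exists n, c.
by rewrite -b'E bc linear_sum; apply: eq_bigr => i _; rewrite linearZ /= b'E.
Qed.

Section Span.
Variables (L : lmodType A) (b : nat -> L).

Definition init_span n x := exists c : nat -> A, x = \sum_(i < n) c i *: b i.

Lemma init_span_mono m n x : (m <= n)%N -> init_span m x -> init_span n x.
Proof.
move=> mn [c ->]; exists (fun i => if (i < m)%N then c i else 0).
rewrite (big_ord_widen n (fun i => c i *: b i)) // big_mkcond /=.
by apply: eq_bigr => i _; case: ifP; rewrite ?scale0r.
Qed.

Lemma init_spanP n a x y : init_span n x -> init_span n y -> init_span n (a *: x + y).
Proof.
move=> [c ->] [d ->]; exists (fun i => a * c i + d i).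
rewrite scaler_sumr -big_split; apply: eq_bigr => i _.
by rewrite scalerDl scalerA.
Qed.

Definition init_span_pred : {pred L} := fun x => `[< exists n, init_span n x >].

Lemma init_span_closed : submod_closed init_span_pred.
Proof.
split=> [|a x y /asboolP[m mx] /asboolP[n ny]]; apply/asboolP.
  by exists 0%N, (fun=> 0); rewrite big_ord0.
exists (maxn m n); apply: init_spanP.
  exact: (init_span_mono (leq_maxl _ _) mx).
exact: (init_span_mono (leq_maxr _ _) ny).
Qed.

Definition init_span_submod : submodClosed L :=
  HB.pack_for (submodClosed L) init_span_pred
    (GRing.isSubmodClosed.Build A L init_span_pred init_span_closed).

End Span.

(** The initial spans have a submodule as their union, and its finitely many generators already lie
    in one of them. *)
Lemma left_noetherian_module : left_noetherian A -> noetherian_module A^o.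
Proof.
move=> nA b; have [s sP] := nA (init_span_submod b).
have [N hN] : exists N, {in s, forall x, init_span b N x}.
  have : {in s, forall x, exists n, init_span b n x}.
    move=> x xs; have : x \in init_span_submod b.
      exact/sP/lspan_mem.
    by move/asboolP.
  elim: (s) => [|x l IH] h; first by exists 0%N.
  have [m mx] := h x (mem_head _ _).
  have [|n hn] := IH; first by move=> y yl; apply: h; rewrite inE yl orbT.
  exists (maxn m n) => y; rewrite inE => /orP[/eqP ->|/hn].
    exact: (init_span_mono (leq_maxl _ _)).
  exact: (init_span_mono (leq_maxr _ _)).
exists N; have : b N \in init_span_submod b.
  apply/asboolP; exists N.+1, (fun i => (i == N)%:R).
  rewrite big_ord_recr /= eqxx scale1r big1 ?add0r // => i _.
  by rewrite (ltn_eqF (ltn_ord i)) scale0r.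
move/sP => [c ->]; apply: (big_ind (init_span b N)).
- by exists (fun=> 0); rewrite big1 // => i _; rewrite scale0r.
- by move=> x y hx hy; rewrite -[x]scale1r; apply: init_spanP.
- move=> i _; rewrite -[_ *: _]addr0; apply: init_spanP.
    by apply: hN; apply: mem_nth.
  by exists (fun=> 0); rewrite big1 // => j _; rewrite scale0r.
Qed.

End Noetherian.

(** * A nonzero vector killed by all of [m] *)

Section CommonKernel.
Variables (k : closedFieldType) (A : algType k) (Z : central_subdomain A) (L : lmodType A).
Hypothesis nL : noetherian_module L.
Variable y : k -> csd Z.
Hypothesis ykills : forall la, exists2 b : L, b <> 0 & val (y la) *: b = 0.

Lemma csd_scaleC (z : csd Z) a (l : L) : val z *: (a *: l) = a *: (val z *: l).
Proof. by rewrite !scalerA (csd_central _ (valP z)). Qed.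

Lemma fresh_scalar (E : seq k) : exists la, la \notin E.
Proof.
have /closed_nonrootP[la] : \prod_(e <- E) ('X - e%:P) != 0.
  by apply: monic_neq0; apply: monic_prod_XsubC.
by rewrite root_prod_XsubC; exists la.
Qed.

Definition killed (S : seq k) (b : L) : Prop := {in S, forall la, val (y la) *: b = 0}.

(* Applying [y la] with [la] in the last index set to a dependency among the
   [d i] shortens it. *)
Lemma dependency_common_kernel (S : nat -> seq k) n (d : nat -> L) :
  (forall i, (i < n)%N -> killed (S i) (d i)) -> \sum_(i < n) d i = 0 ->
  (exists2 i, (i < n)%N & d i <> 0) ->
  exists i j b, [/\ (i < j < n)%N, b <> 0, killed (S i) b & killed (S j) b].
Proof.
elim: n d => [|n IH] d dS sd [i0]; first by rewrite ltn0.
move=> i0n di0; have [dn|dn] := pselect (d n = 0).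
  have [|||i [j [b [/andP[ij jn] b0 bi bj]]]] := IH d.
  - by move=> i iln; apply: dS; apply: ltnW.
  - by move: sd; rewrite big_ord_recr /= dn addr0.
  - exists i0 => //; move: i0n; rewrite ltnS leq_eqVlt => /orP[/eqP i0n|//].
    by rewrite i0n in di0.
  by exists i, j, b; split=> //; rewrite ij ltnW.
have [all0|/existsNP[la /not_implyP[laS /existsNP[i /not_implyP[iln ni]]]]] :=
    pselect (forall la, la \in S n -> forall i, (i < n)%N -> val (y la) *: d i = 0).
  have [i iln di] : exists2 i, (i < n)%N & d i <> 0.
    apply: contrapT => nex; apply: dn; move: sd; rewrite big_ord_recr /= big1 ?add0r // => i _.
    by apply: contrapT => di; apply: nex; exists i.
  exists i, n, (d i); split=> //; first by rewrite iln ltnS leqnn.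
    exact/dS/ltnW.
  by move=> la laS; apply: all0.
have [|||i' [j [b [/andP[ij jn] b0 bi bj]]]] := IH (fun i => val (y la) *: d i).
- move=> i' iln' mu muS /=; rewrite csd_scaleC dS ?scaler0 //; exact: ltnW.
- have := congr1 (fun l => val (y la) *: l) sd.
  by rewrite big_ord_recr scaler0 scalerDr scaler_sumr (dS n (ltnSn n) la laS) addr0.
- by exists i.
by exists i', j, b; split=> //; rewrite ij ltnW.
Qed.

(** The forbidden list [E] makes it possible to produce pairwise disjoint sets of scalars one after
    another. *)
Definition many_killed t : Prop := forall E : seq k,
  exists S (b : L), [/\ uniq S, (t <= size S)%N, {in S, forall la, la \notin E}, b <> 0 & killed S b].

Lemma many_killed1 : many_killed 1.
Proof.
move=> E; have [la laE] := fresh_scalar E; have [b b0 yb] := ykills la.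
by exists [:: la], b; split=> // mu; rewrite inE => /eqP ->.
Qed.

(** Choose infinitely many disjoint sets [S n], each with a killed vector [b n]. Noetherianity gives
    a dependency among the [b n], which forces two of the sets to kill a common vector; being
    disjoint, their sizes add up. *)
Lemma many_killed_double t : many_killed t -> many_killed (t + t).
Proof.
move=> mt E; have [f hf] := choice (fun E' => mt E').
pose ex n := iter n (fun E' => E' ++ f E') E.
have [b hb] := choice (fun n => hf (ex n)).
pose S n := f (ex n).
have exS i n : (i < n)%N -> {subset S i <= ex n}.
  elim: n => // n IH; rewrite ltnS leq_eqVlt => /orP[/eqP ->|/IH sub] la laS.
    by rewrite /ex iterS mem_cat laS orbT.
  by rewrite /ex iterS mem_cat sub.
have Eex n : {subset E <= ex n}.
  by elim: n => // n IH la laE; rewrite /ex iterS mem_cat IH.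
have [n [c bc]] := nL b.
(* The last term [- b n] both balances the sum and is the nonzero entry that the dependency lemma
   asks for. *)
have [|||i [j [b' [/andP[ij jn] b0 bi bj]]]] :=
    @dependency_common_kernel S n.+1 (fun i => if (i < n)%N then c i *: b i else - b i).
- move=> i iln la laS; have [_ _ _ _ /(_ la laS) kb] := hb i.
  by case: ifP => _; rewrite ?scalerN ?csd_scaleC kb ?scaler0 ?oppr0.
- rewrite big_ord_recr /= ltnn bc; apply/eqP; rewrite subr_eq0; apply/eqP.
  by apply: eq_bigr => i _; rewrite ltn_ord.
- exists n => //; rewrite ltnn => /eqP; rewrite oppr_eq0 => /eqP.
  by have [_ _ _ b0 _] := hb n.
have [ui si di _ _] := hb i; have [uj sj dj _ _] := hb j.
exists (S i ++ S j), b'; split=> //.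
- rewrite cat_uniq ui uj andbT; apply/hasPn => la laS.
  by apply: contra (dj la laS) => laSi; apply: exS laSi.
- by rewrite size_cat leq_add.
- move=> la; rewrite mem_cat => /orP[laS|laS].
    by apply: contra (di la laS); apply: Eex.
  by apply: contra (dj la laS); apply: Eex.
- by move=> la; rewrite mem_cat => /orP[/bi|/bj].
Qed.

Lemma many_killed_all t : many_killed t.
Proof.
have [n tn] : exists n, (t <= 2 ^ n)%N by exists t; apply/ltnW/ltn_expl.
have : many_killed (2 ^ n).
  elim: n {tn} => [|n IH]; first exact: many_killed1.
  by rewrite expnS mul2n -addnn; apply: many_killed_double.
move=> h E; have [S [b [uS sS SE b0 kb]]] := h E.
by exists S, b; split=> //; apply: leq_trans sS.
Qed.

End CommonKernel.

Section CommonKernelFinite.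
Variables (k : closedFieldType) (A : algType k) (Z : central_subdomain A) (L : lmodType A).
Hypothesis nL : noetherian_module L.

(* If every combination [sum la^i m_i] has a kernel, some nonzero [b] is killed
   by as many of them as there are [m_i], and inverting a Vandermonde matrix
   shows that the [m_i] themselves kill [b]. *)
Lemma common_kernel (ms : seq (csd Z)) :
  (forall c : nat -> k, exists2 b : L, b <> 0 & val (\sum_(i < size ms) c i *: ms`_i) *: b = 0) ->
  exists2 b : L, b <> 0 & {in ms, forall z, val z *: b = 0}.
Proof.
move=> h; pose y la := \sum_(i < size ms) la ^+ i *: ms`_i.
have hy la : exists2 b : L, b <> 0 & val (y la) *: b = 0 by apply: (h (fun i => la ^+ i)).
have [S [b [uS sS _ b0 kb]]] := many_killed_all nL hy (size ms) [::].
exists b => //; set t := size ms in y hy sS kb *.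
pose a : 'rV[k]_t := \row_j S`_j.
have Vu : Vandermonde t a \in unitmx.
  rewrite unitmxE unitfE det_Vandermonde; apply/prodf_neq0 => i _; apply/prodf_neq0 => j ij.
  by rewrite !mxE subr_eq0 nth_uniq ?(leq_trans (ltn_ord _) sS) // gtn_eqF.
move=> z /(nthP 0)[l lt <-]; pose lo := Ordinal lt.
have hj (j : 'I_t) : \sum_(i < t) (S`_j ^+ i)%:A *: (val ms`_i *: b) = 0.
  have := kb _ (mem_nth 0 (leq_trans (ltn_ord j) sS)).
  rewrite /y raddf_sum scaler_suml => e; rewrite -[RHS]e; apply: eq_bigr => i _.
  by rewrite scalerA -scalerAl mul1r.
transitivity (\sum_(i < t) ((Vandermonde t a *m invmx (Vandermonde t a)) i lo)%:A *: (val ms`_i *: b)).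
  rewrite mulmxV // (bigD1 lo) //= mxE eqxx !scale1r big1 ?addr0 // => i /negbTE il.
  by rewrite mxE il !scale0r.
under eq_bigr do rewrite mxE.
transitivity (\sum_(j < t) (invmx (Vandermonde t a) j lo)%:A *: (\sum_(i < t) (S`_j ^+ i)%:A *: (val ms`_i *: b))); last first.
  by rewrite big1 // => j _; rewrite hj scaler0.
under [RHS]eq_bigr do rewrite scaler_sumr.
rewrite exchange_big; apply: eq_bigr => i _.
rewrite !scaler_suml; apply: eq_bigr => j _.
have scalA (c1 c2 : k) (l' : L) : (c1 * c2)%:A *: l' = c1%:A *: (c2%:A *: l').
  by rewrite [RHS]scalerA -scalerAl mul1r scalerA.
by rewrite !mxE mulrC scalA.
Qed.

End CommonKernelFinite.

(** * The grade of [A/mA] *)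

Section Grade.
Variables (k : closedFieldType) (A : algType k) (Z : central_subdomain A).
Variable m : idealr (csd Z).
Local Notation kappa := (in_alg (csd Z)).
Local Notation Abar := (lquot (ext_ideal m)).

Lemma ext_ideal_mem (z : csd Z) a : z \in m -> (val z * a : A^o) \in ext_ideal m.
Proof. by move=> zm; apply/asboolP; exists [:: (z, a)]; rewrite /= zm big_seq1. Qed.

Lemma ext_ideal_kills (L : lmodType A) (b : L) : (forall z, z \in m -> val z *: b = 0) ->
  forall x, x \in ext_ideal m -> x *: b = 0.
Proof.
move=> mb x /asboolP[s [/allP sm ->]]; rewrite scaler_suml big_seq big1 // => y /sm ym.
by rewrite -scalerA csd_scaleC mb ?scaler0.
Qed.

(** Each of the finitely many generators of the left ideal [mA] is a finite sum of products [z * a]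
    with [z] in [m]; the elements [z] that occur suffice, since they are central. *)
Lemma ext_ideal_generators : left_noetherian A -> exists2 ms : seq (csd Z),
  {subset ms <= m} & forall x, x \in ext_ideal m ->
    exists a : nat -> A, x = \sum_(i < size ms) val ms`_i * a i.
Proof.
move=> nA; have [s sP] := nA (ext_ideal m).
have [ms msm hms] : exists2 ms : seq (csd Z), {subset ms <= m} &
    {in s, forall x, exists2 t : seq (csd Z * A), all (fun y => y.1 \in ms) t &
      x = \sum_(y <- t) val y.1 * y.2}.
  have : {in s, forall x, x \in ext_ideal m}.
    by move=> x xs; apply/sP/lspan_mem.
  elim: s {sP} => [|x s IH] h; first by exists [::].
  have [|ms msm hms] := IH; first by move=> y ys; apply: h; rewrite inE ys orbT.
  have /asboolP[t [/allP tm xt]] := h x (mem_head _ _).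
  exists ([seq y.1 | y <- t] ++ ms) => [z|y].
    by rewrite mem_cat => /orP[/mapP[y /tm ym ->]|/msm].
  rewrite inE => /orP[/eqP ->|/hms[t' /allP t'm yt]].
    exists t => //; apply/allP => u ut.
    by rewrite mem_cat (map_f (fun y : csd Z * A => y.1)).
  by exists t' => //; apply/allP => u /t'm um; rewrite mem_cat um orbT.
exists ms => // x /sP[c ->]; pose Q x := exists a : nat -> A, x = \sum_(i < size ms) val ms`_i * a i.
have Q0 : Q 0 by exists (fun=> 0); rewrite big1 // => i _; rewrite mulr0.
have QD x1 x2 : Q x1 -> Q x2 -> Q (x1 + x2).
  move=> [a1 ->] [a2 ->]; exists (fun i => a1 i + a2 i); rewrite -big_split.
  by apply: eq_bigr => i _; rewrite mulrDr.
have QM a x1 : Q x1 -> Q (a * x1).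
  move=> [a1 ->]; exists (fun i => a * a1 i); rewrite mulr_sumr; apply: eq_bigr => i _.
  by rewrite !mulrA (csd_central _ (valP ms`_i)).
apply: (big_ind Q) => // i _; apply: (QM).
have [t /allP tms ->] := hms _ (mem_nth 0 (ltn_ord i)); rewrite big_seq.
apply: (big_ind Q) => // -[z a] /tms /= zms; exists (fun j => if j == index z ms then a else 0).
have iz : (index z ms < size ms)%N by rewrite index_mem.
rewrite (bigD1 (Ordinal iz)) //= eqxx nth_index // big1 ?addr0 // => j.
by rewrite -val_eqE /= => /negbTE ->; rewrite mulr0.
Qed.

Lemma ext_ideal_kernel : left_noetherian A -> exists2 ms : seq (csd Z),
  {subset ms <= m} & forall (L : lmodType A) (b : L), {in ms, forall z, val z *: b = 0} ->
    forall z, z \in m -> val z *: b = 0.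
Proof.
move=> /ext_ideal_generators[ms msm hms]; exists ms => // L b msb z zm.
have [a] := hms _ (ext_ideal_mem 1 zm); rewrite mulr1 => ->; rewrite scaler_suml big1 // => i _.
by rewrite -scalerA csd_scaleC msb ?scaler0 // mem_nth.
Qed.

Definition csd_ann (L : lmodType A) (z : csd Z) : Prop := forall l : L, val z *: l = 0.

Lemma csd_ann_ideal L : ideal_prop (@csd_ann L).
Proof.
split=> [l|a b ha hb l|a b hb l]; first by rewrite rmorph0 scale0r.
  by rewrite rmorphD scalerDl ha hb addr0.
by rewrite rmorphM -scalerA hb scaler0.
Qed.

Section Multiples.
Variables (L : lmodType A) (z : csd Z).

Definition multiples_pred : {pred L} := fun x => `[< exists l, x = val z *: l >].

Lemma multiples_closed : submod_closed multiples_pred.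
Proof.
split=> [|a x y /asboolP[l ->] /asboolP[l' ->]]; apply/asboolP.
  by exists 0; rewrite scaler0.
by exists (a *: l + l'); rewrite scalerDr csd_scaleC.
Qed.

Definition multiples : submodClosed L :=
  HB.pack_for (submodClosed L) multiples_pred
    (GRing.isSubmodClosed.Build A L multiples_pred multiples_closed).

Lemma multiplesP x : x \in multiples <-> exists l, x = val z *: l.
Proof. by split=> [/asboolP|h]; last apply/asboolP. Qed.

End Multiples.

Lemma regular_chain_snoc r x I (z : csd Z) J :
  regular_chain r x I -> ideal_prop J -> (forall a, I r (z * a) -> I r a) ->
  (forall a, I r a -> J a) -> J z -> ~ J 1 ->
  exists x' I', regular_chain r.+1 x' I' /\ forall a, I' r.+1 a <-> J a.
Proof.
move=> [Iid Ireg I1] idJ zreg IJ Jz J1.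
exists (fun i => if (i < r)%N then x i else z), (fun i => if (i <= r)%N then I i else J).
split; last by rewrite ltnn.
split=> [i _|i|]; [by case: ifP => [/Iid|] //| |by rewrite ltnn].
rewrite ltnS leq_eqVlt => /orP[/eqP ->|ir]; first by rewrite /= eqxx ltnn.
by rewrite /= ir orbT; apply: Ireg.
Qed.

Hypothesis nA : left_noetherian A.
Hypothesis m_proper : exists a : A, a \notin ext_ideal m.
Variable d : nat.
Hypothesis algindep_le : forall r (x : 'I_r -> csd Z), algindep kappa x -> (r <= d)%N.
Local Notation P := (free_resolution Abar).

Lemma kills_Abar z (q : Abar) : z \in m -> val z *: q = 0.
Proof.
have [a <-] := lquot_map_surj q => zm.
by rewrite -linearZ; apply/lquot_map_eq0; apply: ext_ideal_mem.
Qed.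

(** [e] is fuel: a chain longer than [d] would contradict [algindep_le]. The module [L] is kept
    between [A] and [A/mA] by the surjections [p] and [q], and the last hypothesis carries a nonzero
    Ext from [L] back to [A] at the cost of at most [r] degrees, one for each regular element. *)
Lemma Ext_regular_chain e (L : lmodType A) r x I (p : {linear A^o -> L}) (q : {linear L -> Abar}) :
  (d < r + e)%N -> (forall l, exists a, p a = l) -> (forall y, exists l, q l = y) ->
  regular_chain r x I -> (forall z, I r z <-> csd_ann L z) ->
  (forall j, Ext_at P j L -> exists2 j', (j' <= j + r)%N & Ext_at P j' A^o) ->
  exists r' (x' : 'I_r' -> csd Z) j, [/\ algindep kappa x', (j <= r')%N & Ext_at P j A^o].
Proof.
elim: e L r x I p q => [|e IH] L r x I p q.
  rewrite addn0 => dr _ _ rc _ _; have := algindep_le (regular_chain_algindep (kappa := kappa) rc).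
  by rewrite leqNgt dr.
move=> dr ps qs rc Iann tr.
have nL : noetherian_module L := noetherian_module_surj ps (left_noetherian_module nA).
have [[z zm zreg]|nreg] := pselect (exists2 z : csd Z, z \in m & forall l : L, val z *: l = 0 -> l = 0).
  pose L' := lquot (multiples L z); pose pi : {linear L -> L'} := lquot_map (multiples L z).
  have pis : forall l', exists l, pi l = l' by exact: lquot_map_surj.
  have pi0 l : pi l = 0 <-> exists l', l = val z *: l'.
    by split=> [/lquot_map_eq0/multiplesP//|h]; apply/lquot_map_eq0/multiplesP.
  have [|q' q'E] := @lquot_lift _ _ _ (multiples L z) q.
    by move=> l /multiplesP[l' ->]; rewrite linearZ; apply: kills_Abar.
  have plin : linear (fun a => pi (p a)) by move=> a u v; rewrite !linearP.
  have qs' y : exists l, q' l = y by have [l <-] := qs y; exists (pi l); apply: q'E.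
  have [|||||x' [I' [rc' I'ann]]] := @regular_chain_snoc r x I z (csd_ann L') rc.
  - exact: csd_ann_ideal.
  - move=> a /Iann za; apply/Iann => l; apply: zreg.
    by have := za l; rewrite rmorphM -scalerA.
  - by move=> a /Iann aL l'; have [l <-] := pis l'; rewrite -linearZ aL linear0.
  - move=> l'; have [l <-] := pis l'; rewrite -linearZ.
    by apply/pi0; exists l.
  (* The new quotient still surjects onto [A/mA], which is nonzero, so [1] does not annihilate
     it. *)
  - have [a am] := m_proper; move=> ann1; move/negP: am; apply.
    suff /lquot_map_eq0 : lquot_map (ext_ideal m) a = 0 by [].
    have [l <-] := qs' (lquot_map (ext_ideal m) a).
    by have := ann1 l; rewrite rmorph1 scale1r => ->; rewrite linear0.
  apply: (IH L' r.+1 x' I' (mklinear plin) q') => //.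
  - by rewrite addSnnS.
  - by move=> l'; have [l <-] := pis l'; have [a <-] := ps l; exists a.
  - move=> j /(@Ext_at_quotient A Abar P j L L' (val z) pi) []//.
    + by move=> a; apply: csd_central (valP z).
    + by move=> /tr[j' jj' ej']; exists j' => //; rewrite addnS ltnW.
    + by move=> /tr[j' jj' ej']; exists j' => //; rewrite addnS -addSn.
(* No element of [m] is regular on [L]. A vector [b] killed by all of [m] then gives the map
   [1 |-> b] from [A/mA] to [L], hence a nonzero Ext in degree 0. *)
have [ms msm hms] := ext_ideal_kernel nA.
have [c|b b0 msb] := @common_kernel k A Z L nL ms.
  have cm : \sum_(i < size ms) c i *: ms`_i \in m.
    apply: rpred_sum => i _; rewrite -[ms`_i]mul1r scalerAl.
    by apply: idealMr; apply/msm/mem_nth.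
  apply: contrapT => nb; apply: nreg; exists (\sum_(i < size ms) c i *: ms`_i) => // l zl.
  by apply: contrapT => l0; apply: nb; exists l.
have mb := hms L b msb.
have flin : linear (fun a : A^o => a *: b) by move=> a u v; rewrite scalerDl scalerA.
have [|h hE] := @lquot_lift _ _ _ (ext_ideal m) (mklinear flin).
  by move=> a am; apply: ext_ideal_kills mb _ am.
have [|j' jr ej'] := tr 0%N.
  apply: (@Ext_at0 _ _ P L h (lquot_map (ext_ideal m) 1)).
  by rewrite hE mklinearE scale1r.
by exists r, (fun i => x i), j'; split=> //; apply: (regular_chain_algindep (kappa := kappa) rc).
Qed.

Lemma Ext_le_algindep : exists r (x : 'I_r -> csd Z) j,
  [/\ algindep kappa x, (j <= r)%N & Ext_at P j A^o].
Proof.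
have idlin : linear (id : A^o -> A^o) by [].
apply: (@Ext_regular_chain d.+1 A^o 0 (fun=> 0) (fun=> csd_ann A^o) (mklinear idlin) (lquot_map (ext_ideal m))) => //.
- by move=> a; exists a.
- exact: lquot_map_surj.
- split=> // [i _|]; first exact: csd_ann_ideal.
  by move=> /(_ 1) /eqP; rewrite rmorph1 scale1r oner_eq0.
- by move=> j ej; exists j; rewrite ?addn0.
Qed.

End Grade.

Section GKdimEquality.
Variables (R : realType) (k : closedFieldType) (A : algType k) (Z : central_subdomain A).
Hypotheses (A_noetherian : noetherian_ring A) (Z_affine : affine_algebra (csd Z)).
Hypothesis A_CM : Cohen_Macaulay R A.

Lemma GKdim_alg_eq (m : prime_idealr (csd Z)) : good_ideal R m ->
  GKdim_alg R A = (GKdim_alg R (frac_tensor Z) + GKdim_alg R (csd_frac Z))%E.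
Proof.
case=> _ _ mp gkm; have [d [t [it at_ _]]] := csd_separating_basis Z_affine.
have gd := GKdim_csd_frac R it at_.
have ald r (x : 'I_r -> csd Z) : algindep (in_alg (csd Z)) x -> (r <= d)%N.
  by move=> /(algindep_csd_frac R); rewrite gd lee_fin ler_nat.
have [r [x [j [ix jr ej]]]] := Ext_le_algindep A_noetherian.1 mp ald.
apply/eqP; rewrite eq_le; apply/andP; split; last first.
  by rewrite gd addeC; apply: GKdim_frac_tensor_le it.
have Mfg : fin_gen (lquot (ext_ideal m)).
  exists [:: lquot_map (ext_ideal m) 1] => q; have [a <-] := lquot_map_surj q.
  exists (fun=> a); transitivity (a *: lquot_map (ext_ideal m) 1); last by rewrite big_ord1.
  by rewrite -linearZ; congr (lquot_map _ _); apply/esym/mulr1.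
have Mnz : exists q : lquot (ext_ideal m), q <> 0.
  have [a am] := mp; exists (lquot_map (ext_ideal m) a) => /lquot_map_eq0 h.
  by rewrite h in am.
(* The dimension of the fibre is bounded by the choice of [m]; the grade is at most [j <= r <= d],
   and [d] is the dimension of [Q(Z)]. *)
rewrite (A_CM Mfg Mnz) addeC; apply: leeD => //.
rewrite gd; apply: (@le_trans _ _ (j%:R : R)%:E).
  apply: ereal_inf_lbound; exists j => //.
  by exists (free_resolution (lquot (ext_ideal m))).
by rewrite lee_fin ler_nat (leq_trans jr) // (ald r x).
Qed.

End GKdimEquality.

(** * Generic specializations *)

Section GenericPoint.
Variable k : closedFieldType.

Definition subst_first d (c : k) : mpoly d.+1 k -> mpoly d k :=
  mmap (@mpolyC d k) (fun i => if unlift ord0 i is Some j then mpolyX k (mnm1 j) else mpolyC d c).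

Definition cons_point d (c : k) (la : 'I_d -> k) (i : 'I_d.+1) : k :=
  if unlift ord0 i is Some j then la j else c.

Lemma meval_cons d c la (p : mpoly d.+1 k) :
  meval (cons_point c la) p = meval la (subst_first c p).
Proof.
rewrite [in RHS]/subst_first [in RHS]/mmap raddf_sum mevalE; apply: eq_bigr => m _ /=.
rewrite mevalM mevalC; congr (_ * _); rewrite /mmap1 rmorph_prod; apply: eq_bigr => i _.
rewrite rmorphXn /= /cons_point; congr (_ ^+ _).
by case: unlift => [j|]; rewrite ?mevalXU ?mevalC.
Qed.

Definition tail_mnm d (m : multinom d.+1) : multinom d := Multinom [tuple m (lift ord0 j) | j < d].

Lemma subst_first_coef d c (p : mpoly d.+1 k) m' :
  mcoeff m' (subst_first c p) =
  (\sum_(m <- msupp p | tail_mnm m == m') mcoeff m p *: 'X^(m ord0)).[c].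
Proof.
rewrite /subst_first /mmap raddf_sum /= horner_sum [RHS]big_mkcond; apply: eq_bigr => m _.
rewrite mul_mpolyC mcoeffZ hornerZ hornerXn.
have -> : mmap1 (fun i => if unlift ord0 i is Some j then mpolyX k (mnm1 j) else mpolyC d c) m =
    (c ^+ m ord0) *: mpolyX k (tail_mnm m).
  rewrite /mmap1 big_ord_recl unlift_none -rmorphXn -mul_mpolyC; congr (_ * _).
  rewrite mpolyXE_id; apply: eq_bigr => j _; rewrite liftK; congr (_ ^+ _).
  by rewrite multinomE tnth_mktuple.
by rewrite mcoeffZ mcoeffX; case: eqP => _; rewrite ?mulr1 ?mulr0.
Qed.

(** Viewed as a polynomial in the other variables, [p] has a nonzero coefficient in [k[X_0]]; every
    [c] that annihilates [p] is a root of it. *)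
Lemma subst_first_roots d (p : mpoly d.+1 k) : p != 0 ->
  exists2 q : {poly k}, q != 0 & forall c, subst_first c p = 0 -> root q c.
Proof.
move=> p0; have [m0 m0p] : exists m0, m0 \in msupp p.
  by case E : (msupp p) => [|m s]; [move: p0; rewrite -msupp_eq0 E | exists m; rewrite mem_head].
exists (\sum_(m <- msupp p | tail_mnm m == tail_mnm m0) mcoeff m p *: 'X^(m ord0)).
  apply/eqP => /(congr1 (fun q : {poly k} => q`_(m0 ord0))); rewrite coef0 coef_sum.
  rewrite big_mkcond (bigD1_seq m0) ?msupp_uniq //= eqxx coefZ coefXn eqxx mulr1.
  rewrite big1_seq ?addr0 => [/eqP|m /andP[mm0 _]]; first by rewrite mcoeff_eq0 m0p.
  case: eqP => // tm; rewrite coefZ coefXn; case: eqP => [e0|]; last by rewrite mulr0.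
  case/eqP: mm0; apply/mnmP => i; case: (unliftP ord0 i) => [j ->|-> //].
  by have := congr1 (fun m' : multinom d => m' j) tm; rewrite !multinomE !tnth_mktuple.
by move=> c c0; rewrite /root -subst_first_coef c0 mcoeff0.
Qed.

(** Countably many finite sets of roots cannot cover [k]. *)
Lemma generic_scalar (q : nat -> {poly k}) : ~ countable [set: k]%classic ->
  (forall i, q i != 0) -> exists c, forall i, ~~ root (q i) c.
Proof.
move=> unc q0; apply: contrapT => nex; apply: unc.
apply: (@sub_countable _ _ _ (\bigcup_(i in [set: nat]) [set c | root (q i) c])%classic).
  apply: subset_card_le => c _; apply: contrapT => nc; apply: nex; exists c => i.
  by apply/negP => qc; apply: nc; exists i.
apply: bigcup_countable; first exact: countableP.
move=> i _; have [s qs] := closed_field_poly_normal (q i).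
apply: (@sub_countable _ _ _ [set` s]%classic); last by apply/finite_set_countable/finite_seqP; exists s.
apply: subset_card_le => c /=; rewrite qs rootZ ?lead_coef_eq0 //.
by rewrite root_prod_XsubC.
Qed.

Lemma generic_point d (r : nat -> mpoly d k) : ~ countable [set: k]%classic ->
  (forall i, r i != 0) -> exists la, forall i, meval la (r i) != 0.
Proof.
move=> unc; elim: d r => [|d IH] r r0.
  exists (fun=> 0) => i; have := r0 i; rewrite [r i]nvar0_mpolyC mevalC.
  by apply: contra_neq => ->; rewrite mpolyC0.
have ex i : exists q : {poly k}, q != 0 /\ forall c, subst_first c (r i) = 0 -> root q c.
  by have [q q0 qr] := subst_first_roots (r0 i); exists q.
have [q qr] := choice ex.
have [c hc] := generic_scalar unc (fun i => (qr i).1).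
have [i|la hla] := IH (fun i => subst_first c (r i)).
  by apply/eqP => h; have := (qr i).2 c h; rewrite (negbTE (hc i)).
by exists (cons_point c la) => i; rewrite meval_cons.
Qed.

End GenericPoint.

(** * Chains of primes of [Z] over a generic point *)

Section PrimeAvoiding.
Variable D : idomainType.

(** An ideal maximal among those that contain [J] and miss the multiplicative set [T] is prime. *)
Lemma exists_prime_avoiding (J : D -> Prop) (T : D -> Prop) :
  ideal_prop J -> T 1 -> (forall a b, T a -> T b -> T (a * b)) -> (forall a, J a -> ~ T a) ->
  exists m : D -> Prop, [/\ prime_prop m, forall a, J a -> m a & forall a, m a -> ~ T a].
Proof.
move=> [J0 JD JM] T1 TM JT.
(* [X] becomes an ideal only together with [J], so that the empty union of an empty chain is
   admissible in Zorn's lemma. *)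
pose Q (X : set D) := ideal_prop (fun a => X a \/ J a) /\ forall a, X a \/ J a -> ~ T a.
have [F FQ Ftot|X [[idX XT] Xmax]] := @Zorn_bigcup D Q.
  have memF X a : F X -> X a \/ J a -> (\bigcup_(Y in F) Y)%classic a \/ J a.
    by move=> FX [Xa|]; [left; exists X|right].
  split; last by move=> a [[X FX Xa]|]; [have [_ h] := FQ _ FX; apply: h; left|exact: JT].
  split=> [|a b|a b]; first by right.
  - move=> [[X FX Xa]|Ja] [[Y FY Yb]|Jb]; last by right; apply: JD.
    + have [XY|YX] := Ftot _ _ FX FY.
        have [[_ YD _] _] := FQ _ FY; apply: (memF Y) => //; apply: YD; left=> //; exact: XY.
      have [[_ XD _] _] := FQ _ FX; apply: (memF X) => //; apply: XD; left=> //; exact: YX.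
    + by have [[_ XD _] _] := FQ _ FX; apply: (memF X) => //; apply: XD; [left|right].
    + by have [[_ YD _] _] := FQ _ FY; apply: (memF Y) => //; apply: YD; [right|left].
  - move=> [[X FX Xb]|Jb]; last by right; apply: JM.
    by have [[_ _ XM] _] := FQ _ FX; apply: (memF X) => //; apply: XM; left.
pose m a := X a \/ J a; have [m0 mD mM] : ideal_prop m by [].
have meetT a : ~ m a -> exists u b, m u /\ T (u + b * a).
  move=> ma; apply: contrapT => nT.
  pose Y : set D := fun x => exists u b, m u /\ x = u + b * a.
  have JY x : J x -> Y x by move=> Jx; exists x, 0; rewrite mul0r addr0; split=> //; right.
  have mY x : m x -> Y x by move=> mx; exists x, 0; rewrite mul0r addr0.
  have Ya : Y a by exists 0, 1; rewrite mul1r add0r.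
  have YE x : Y x \/ J x -> Y x by case=> // /JY.
  apply: (Xmax Y).
    split=> [x Xx|h]; first by apply: mY; left.
    by apply: ma; left; apply: h.
  split; last by move=> x /YE[u [b [mu ->]]] Tx; apply: nT; exists u, b.
  split=> [|x y /YE[u [b [mu ->]]] /YE[v [c [mv ->]]]|x y /YE[u [b [mu ->]]]]; left; first exact: mY.
    by exists (u + v), (b + c); split; [apply: (mD)|ring].
  by exists (x * u), (x * b); split; [apply: (mM)|ring].
exists m; split=> //; last by move=> a Ja; right.
split=> // [h|a b mab]; first exact: XT h T1.
apply: contrapT => /not_orP[/meetT[u [c [mu Tu]]] /meetT[v [e [mv Tv]]]].
apply: (XT ((u + c * a) * (v + e * b))); last exact: TM.
have -> : (u + c * a) * (v + e * b) = (v + e * b) * u + ((c * a) * v + (c * e) * (a * b)) by ring.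
by apply: (mD); [|apply: (mD)]; apply: (mM).
Qed.

End PrimeAvoiding.

Section GoingUp.
Variables (R D : idomainType) (iota : {rmorphism R -> D}).

(** For a prime [Q]: integrality of [w] over the localization of [R] at [Q], with the denominators
    collected in the leading coefficient [c]. *)
Definition integral_outside (Q : R -> Prop) (w : D) : Prop :=
  exists (c : R) n (a : nat -> R), ~ Q c /\ iota c * w ^+ n + \sum_(l < n) iota (a l) * w ^+ l = 0.

(* If [iota y = q + iota x * w] with [q] in [p], the equation of [w], multiplied
   by [x ^+ n] and read modulo [p], puts [c * y ^+ n] in [P + R x]. *)
Lemma going_up (p : D -> Prop) (P Q : R -> Prop) (x : R) :
  prime_prop p -> (forall f, p (iota f) -> P f) -> prime_prop Q -> (forall f, P f -> Q f) -> Q x ->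
  (forall w, integral_outside Q w) ->
  exists p' : D -> Prop, [/\ prime_prop p', forall a, p a -> p' a, p' (iota x)
    & forall f, p' (iota f) -> Q f].
Proof.
move=> [idp p1 pp] pP [[Q0 QD QM] Q1 Qp] PQ Qx wint; have [p0 pD pM] := idp.
pose J a := exists u w, p u /\ a = u + iota x * w.
pose T a := exists2 f, ~ Q f & a = iota f.
have [||||m [prm Jm mT]] := @exists_prime_avoiding D J T.
- split=> [|a b [u [w [pu ->]]] [v [e [pv ->]]]|a b [u [w [pu ->]]]].
  + by exists 0, 0; rewrite mulr0 addr0.
  + by exists (u + v), (w + e); split; [apply: (pD)|ring].
  + by exists (a * u), (a * w); split; [apply: (pM)|ring].
- by exists 1; rewrite ?rmorph1.
- move=> _ _ [f Qf ->] [g Qg ->]; exists (f * g); last by rewrite rmorphM.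
  by move=> /Qp[].
- move=> _ [u [w [pu ->]]] [y Qy yE]; apply: Qy.
  have [c [n [a [Qc wE]]]] := wint w.
  have xw : p (iota x * w - iota y) by have := pM (-1) _ pu; rewrite -yE mulN1r opprD addrCA subrr addr0.
  pose r := \sum_(l < n) a l * x ^+ (n - l).-1 * y ^+ l.
  have : p (iota (c * y ^+ n + x * r)).
    have E : iota (c * y ^+ n + x * r) = iota c * iota y ^+ n
        + \sum_(l < n) iota (a l) * iota x ^+ (n - l) * iota y ^+ l.
      rewrite rmorphD !rmorphM rmorphXn; congr (_ + _).
      rewrite rmorph_sum mulr_sumr; apply: eq_bigr => l _; rewrite !rmorphM !rmorphXn.
      have : (0 < n - l)%N by rewrite subn_gt0.
      by case: (n - l)%N => // e _; rewrite exprS; ring.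
    have E2 : iota c * (iota x * w) ^+ n + \sum_(l < n) iota (a l) * iota x ^+ (n - l) * (iota x * w) ^+ l = 0.
      transitivity (iota x ^+ n * (iota c * w ^+ n + \sum_(l < n) iota (a l) * w ^+ l)); last by rewrite wE mulr0.
      rewrite mulrDr mulr_sumr exprMn; congr (_ + _); first by ring.
      apply: eq_bigr => l _; rewrite exprMn.
      have -> : iota x ^+ n = iota x ^+ (n - l) * iota x ^+ l by rewrite -exprD subnK // ltnW.
      by ring.
    have sub e : p ((iota x * w) ^+ e - iota y ^+ e) by apply: ideal_prop_exp.
    have : p (iota c * ((iota x * w) ^+ n - iota y ^+ n)
        + \sum_(l < n) (iota (a l) * iota x ^+ (n - l)) * ((iota x * w) ^+ l - iota y ^+ l)).
      apply: (pD); first exact: (pM).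
      by apply: ideal_prop_sum => // l _ _; apply: (pM).
    rewrite mulrBr; under eq_bigr do rewrite mulrBr.
    rewrite sumrB addrACA E2 add0r -opprD -E => /(pM (-1)).
    by rewrite mulN1r opprK.
  move=> /pP/PQ Qcy; have : Q (c * y ^+ n).
    by have := QD _ _ Qcy (QM (- r) _ Qx); rewrite mulNr [r * x]mulrC addrK.
  move/Qp => [//|]; elim: (n) => [/Q1 //|e IH]; rewrite exprS => /Qp[//|]; exact: IH.
exists m; split=> //.
- by move=> a pa; apply: Jm; exists a, 0; rewrite mulr0 addr0.
- by apply: Jm; exists 0, 1; rewrite mulr1 add0r.
- by move=> f mf; apply: contrapT => Qf; apply: (mT _ mf); exists f.
Qed.

End GoingUp.

Section SpecializationChain.
Variables (k : closedFieldType) (d : nat) (la : 'I_d -> k).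
Local Notation R := (mpoly d k).

Definition partial_eval i : R -> R :=
  mmap (@mpolyC d k) (fun j : 'I_d => if (j < i)%N then mpolyC d (la j) else mpolyX k (mnm1 j)).

HB.instance Definition _ i := GRing.RMorphism.copy (partial_eval i)
  (mmap (@mpolyC d k) (fun j : 'I_d => if (j < i)%N then mpolyC d (la j) else mpolyX k (mnm1 j))).

Lemma partial_evalX i j : partial_eval i (mpolyX k (mnm1 j)) =
  if (j < i)%N then mpolyC d (la j) else mpolyX k (mnm1 j).
Proof. by rewrite /partial_eval mmapX mmap1U. Qed.

Lemma partial_evalC i c : partial_eval i (mpolyC d c) = mpolyC d c.
Proof. by rewrite /partial_eval mmapC. Qed.

Lemma meval_partial_eval i f : meval la (partial_eval i f) = meval la f.
Proof.
rewrite /partial_eval /mmap raddf_sum /= mevalE; apply: eq_bigr => m _.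
rewrite mevalM mevalC; congr (_ * _); rewrite /mmap1 rmorph_prod; apply: eq_bigr => j _.
by rewrite rmorphXn /=; case: ifP => _; rewrite ?mevalC ?mevalXU.
Qed.

Lemma partial_eval0 f : partial_eval 0 f = f.
Proof.
rewrite [RHS]mpolyE /partial_eval /mmap; apply: eq_bigr => m _.
by rewrite mul_mpolyC /mmap1 -mpolyXE_id.
Qed.

(* The kernel of [partial_eval i] is the prime [(X_0 - la 0, ..., X_(i-1) - la (i-1))]. *)
Definition spec_prime i (f : R) : Prop := partial_eval i f = 0.

Lemma spec_prime_prime i : prime_prop (spec_prime i).
Proof.
rewrite /spec_prime; split=> [||a b]; last first.
- by rewrite rmorphM => /eqP; rewrite mulf_eq0 => /orP[]/eqP; [left|right].
- by rewrite rmorph1 => /eqP; rewrite oner_eq0.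
split=> [|a b ha hb|a b hb]; rewrite ?raddf0 //; first by rewrite raddfD /= ha hb addr0.
by rewrite rmorphM /= hb mulr0.
Qed.

Lemma partial_eval_comp i f : partial_eval i.+1 (partial_eval i f) = partial_eval i.+1 f.
Proof.
rewrite [X in partial_eval i.+1 X = _]/partial_eval [X in partial_eval i.+1 X = _]/mmap raddf_sum /=.
rewrite [RHS]/partial_eval [RHS]/mmap; apply: eq_bigr => m _.
rewrite rmorphM /= partial_evalC; congr (_ * _); rewrite /mmap1 rmorph_prod; apply: eq_bigr => j _.
rewrite rmorphXn /=; congr (_ ^+ _); case: ifP => ji; last by rewrite partial_evalX.
by rewrite partial_evalC ltnW.
Qed.

Lemma spec_primeS i f : spec_prime i f -> spec_prime i.+1 f.
Proof. by rewrite /spec_prime -partial_eval_comp => ->; rewrite raddf0. Qed.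

Lemma spec_prime_meval i f : spec_prime i f -> meval la f = 0.
Proof. by rewrite -(meval_partial_eval i) => ->; rewrite raddf0. Qed.

Lemma spec_prime_last f : meval la f = 0 -> spec_prime d f.
Proof.
move=> f0; rewrite /spec_prime /partial_eval.
have -> : (fun j : 'I_d => if (j < d)%N then mpolyC d (la j) else mpolyX k (mnm1 j)) = @mpolyC d k \o la.
  by apply/funext => j; rewrite ltn_ord.
by rewrite mmap_const f0 raddf0.
Qed.

Definition spec_var (j : 'I_d) : R := mpolyX k (mnm1 j) - mpolyC d (la j).

Lemma spec_var_in (j : 'I_d) : spec_prime j.+1 (spec_var j).
Proof. by rewrite /spec_prime raddfB /= partial_evalX partial_evalC ltnSn subrr. Qed.

Lemma spec_var_notin (j : 'I_d) : ~ spec_prime j (spec_var j).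
Proof.
rewrite /spec_prime raddfB /= partial_evalX partial_evalC ltnn => /(congr1 (mcoeff (mnm1 j))).
by rewrite mcoeffB mcoeffX mcoeffC mcoeff0 eqxx mnm1_eq0 mulr0 subr0 => /eqP; rewrite oner_eq0.
Qed.

End SpecializationChain.

Section GenericChain.
Variables (k : closedFieldType) (A : algType k) (Z : central_subdomain A).
Local Notation kappa := (in_alg (csd Z)).
Variables (d : nat) (t : 'I_d -> csd Z).
Local Notation iota := (mmap kappa t).
Hypotheses (ind_t : algindep kappa t) (alg_t : forall x, algebraic_elt iota x).
Hypothesis Z_affine : affine_algebra (csd Z).

(** Finite generation of [Z] makes it integral over [k[t]] with a single [c] inverted, so going up
    costs the generic point only one more hypersurface. *)
Lemma integral_localization : exists2 c, c != 0 & forall w : csd Z,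
  exists N, integralOver iota (iota (c ^+ N) * w).
Proof.
have [s gen] := Z_affine.
have [c c0 hc] := algebraic_common_denominator (size s) (fun i => alg_t s`_i).
exists c => //; apply: (csd_affine_ind _ _ _ gen).
- by exists 0%N; rewrite expr0 rmorph1 mul1r; apply: integral1.
- move=> a u v [M Mu] [N Nv]; exists (M + N)%N; rewrite mulrDr; apply: integral_add.
    have -> : iota (c ^+ (M + N)) * (a *: u) = iota (mpolyC d a * c ^+ N) * (iota (c ^+ M) * u).
      by rewrite exprD !rmorphM /= mmapC mulr_algl -!scalerAr -!scalerAl; congr (_ *: _); ring.
    exact: integral_iotaM.
  by rewrite exprD rmorphM -mulrA; apply: integral_iotaM.
- move=> u v [M Mu] [N Nv]; exists (M + N)%N.
  by rewrite exprD rmorphM mulrACA; apply: integral_mul.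
- move=> x /(nthP 0)[i ilt <-]; exists 1%N; rewrite expr1; exact: hc.
Qed.

Lemma integral_outside_localization c N w (Q : mpoly d k -> Prop) :
  (forall n, ~ Q (c ^+ n)) -> integralOver iota (iota (c ^+ N) * w) -> integral_outside iota Q w.
Proof.
move=> Qc [p mp]; rewrite /root => /eqP pw.
have [n sp] : exists n, size p = n.+1.
  by exists (size p).-1; rewrite prednK // size_poly_gt0 monic_neq0.
exists (c ^+ (N * n)), n, (fun l => p`_l * c ^+ (N * l)); split=> //.
move: pw; rewrite horner_coef size_map_poly_id0; last by rewrite (monicP mp) rmorph1 oner_eq0.
rewrite sp big_ord_recr /= addrC => pw; rewrite -[RHS]pw; congr (_ + _).
  rewrite coef_map /=; have -> : p`_n = 1 by have /monicP := mp; rewrite lead_coefE sp.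
  by rewrite rmorph1 mul1r exprMn -rmorphXn -exprM.
apply: eq_bigr => l _; rewrite coef_map /= rmorphM -mulrA exprMn; congr (_ * (_ * _)).
by rewrite exprM rmorphXn.
Qed.

(** Each [S n] divides a nonzero [r n] in [k[t]]; a prime of [Z] lying over a point with [r n]
    nonzero there cannot contain [S n]. *)
Lemma generic_chain (S : nat -> csd Z) : ~ countable [set: k]%classic -> (forall n, S n != 0) ->
  exists (la : 'I_d -> k) (p : nat -> csd Z -> Prop),
  [/\ forall i, (i <= d)%N -> prime_prop (p i),
      forall i : 'I_d, [/\ forall a, p i a -> p i.+1 a, p i.+1 (t i - kappa (la i))
        & ~ p i (t i - kappa (la i))],
      forall n, ~ p d (S n)
    & forall x, exists c, p d (x - kappa c)].
Proof.
move=> unc S0; have [c0 c00 hc0] := integral_localization.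
have iinj := algindep_inj ind_t.
have ex n : exists r, r != 0 /\ exists b, S n * b = iota r.
  by have [b _ [r r0 rb]] := algebraic_multiple iinj (alg_t (S n)) (S0 n); exists r; split=> //; exists b.
have [r hr] := choice ex.
(* Index 0 is reserved for the denominator [c0] of integrality; [r n] sits at index [n.+1]. *)
have [i|la hla] := @generic_point k d (fun n => if n is n'.+1 then r n' else c0) unc.
  by case: i => [//|n]; have [] := hr n.
have wint i w : integral_outside iota (spec_prime la i) w.
  have [N wN] := hc0 w; apply: integral_outside_localization wN => n /spec_prime_meval.
  by rewrite rmorphXn => /eqP; rewrite expf_eq0 (negbTE (hla 0%N)) andbF.
have xE i : iota (spec_var la i) = t i - kappa (la i).
  by rewrite /spec_var raddfB /= mmapX mmap1U mmapC.
have [p [pp pP pS]] : exists p : nat -> csd Z -> Prop,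
    [/\ forall i, (i <= d)%N -> prime_prop (p i),
        forall i, (i <= d)%N -> forall f, p i (iota f) -> spec_prime la i f
      & forall i : 'I_d, (forall a, p i a -> p i.+1 a) /\ p i.+1 (t i - kappa (la i))].
  suff : forall e, (e <= d)%N -> exists p : nat -> csd Z -> Prop,
    [/\ forall i, (i <= e)%N -> prime_prop (p i),
        forall i, (i <= e)%N -> forall f, p i (iota f) -> spec_prime la i f
      & forall i : 'I_d, (i < e)%N -> (forall a, p i a -> p i.+1 a) /\ p i.+1 (t i - kappa (la i))].
    by move=> /(_ d (leqnn d))[p [h1 h2 h3]]; exists p; split=> // i; apply: h3.
  elim=> [_|e IH ed].
    exists (fun _ a => a = 0); split=> [i _|i|i]; last by rewrite ltn0.
      split=> [||a b /eqP]; last by rewrite mulf_eq0 => /orP[]/eqP; [left|right].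
        by split=> // [a b -> ->|a b ->]; rewrite ?addr0 ?mulr0.
      by move/eqP; rewrite oner_eq0.
    rewrite leqn0 => /eqP -> f f0; rewrite /spec_prime partial_eval0; apply: iinj.
    by rewrite f0 raddf0.
  have [p [h1 h2 h3]] := IH (ltnW ed); pose o := Ordinal ed.
  have [p' [prp' pp' p'x p'P]] := going_up (h1 e (leqnn e)) (h2 e (leqnn e)) (spec_prime_prime la e.+1)
    (@spec_primeS _ _ la e) (spec_var_in la o) (wint e.+1).
  exists (fun i => if (i <= e)%N then p i else p'); split=> [i|i|i].
  - by case: ifP => [ie _|_ _]; [apply: h1|].
  - rewrite leq_eqVlt ltnS => /orP[/eqP ->|ie]; first by rewrite ltnn.
    by rewrite ie; apply: h2.
  - rewrite ltnS; case: (ltngtP i e) => // ie _; first exact: h3.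
    have -> : i = o by apply: ord_inj.
    by rewrite -xE.
have [[m0 mD mM] m1 pm] := pp d (leqnn d).
have mono l e a : (l <= e)%N -> (e <= d)%N -> p l a -> p e a.
  elim: e => [|e IH]; first by rewrite leqn0 => /eqP ->.
  rewrite leq_eqVlt => /orP[/eqP -> //|le] ed pl.
  have [+ _] := pS (Ordinal ed); apply; apply: (IH le) => //; exact: ltnW.
have pd (i : 'I_d) : p d (t i - kappa (la i)) by have [_] := pS i; apply: mono.
exists la, p; split=> //.
- move=> i; have [h1 h2] := pS i; split=> //; rewrite -xE => /(pP i (ltnW (ltn_ord i))).
  exact: spec_var_notin.
- move=> n Sn; have [_ [b Sb]] := hr n; have : p d (iota (r n)) by rewrite -Sb mulrC; apply: mM.
  by move=> /(pP d (leqnn d))/spec_prime_meval /eqP; apply/negP; apply: (hla n.+1).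
(* Modulo [p d] the coefficients of the equation of [x] become their values at [la]. So [x] is a
   root of a nonzero polynomial [g] over [k]; [g] splits, and the prime [p d] contains one of the
   factors [x - z]. *)
move=> x; have [c [n [a [Qc xE']]]] := wint d x.
have iC f : p d (iota f - kappa (meval la f)).
  by rewrite -mmap_const; apply: mmap_congr.
pose g : {poly k} := meval la c *: 'X^n + \sum_(l < n) meval la (a l) *: 'X^l.
have gE : p d ((map_poly kappa g).[x]).
  have -> : (map_poly kappa g).[x] = kappa (meval la c) * x ^+ n + \sum_(l < n) kappa (meval la (a l)) * x ^+ l.
    rewrite rmorphD /= map_polyZ map_polyXn hornerD hornerZ hornerXn; congr (_ + _).
    rewrite rmorph_sum horner_sum; apply: eq_bigr => l _ /=.
    by rewrite map_polyZ map_polyXn hornerZ hornerXn.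
  have -> : kappa (meval la c) * x ^+ n + \sum_(l < n) kappa (meval la (a l)) * x ^+ l =
    - ((iota c - kappa (meval la c)) * x ^+ n + \sum_(l < n) (iota (a l) - kappa (meval la (a l))) * x ^+ l).
    rewrite mulrBl; under [in RHS]eq_bigr do rewrite mulrBl.
    by rewrite sumrB addrACA xE' add0r -opprD opprK.
  rewrite -mulN1r; apply: (mM); apply: (mD); first by rewrite mulrC; apply: (mM).
  by apply: ideal_prop_sum => // l _ _; rewrite mulrC; apply: (mM).
have g0 : g != 0.
  apply: contra_notN Qc => /eqP gz; apply: spec_prime_last.
  have := congr1 (fun h : {poly k} => h`_n) gz; rewrite coef0 coefD coefZ coefXn eqxx mulr1.
  rewrite coef_sum big1 ?addr0 // => l _; rewrite coefZ coefXn.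
  by rewrite gtn_eqF ?mulr0.
have [s gs] := closed_field_poly_normal g.
move: gE; rewrite gs map_polyZ hornerZ rmorph_prod horner_prod /= => /pm[lc|].
  have : kappa (lead_coef g)^-1 * kappa (lead_coef g) = 1 by rewrite -rmorphM mulVf ?lead_coef_eq0 // rmorph1.
  by move=> h; case: m1; rewrite -h; apply: (mM).
elim: (s) => [|z s' IH]; first by rewrite big_nil => /m1.
rewrite big_cons => /pm[|/IH //]; rewrite map_polyXsubC hornerXsubC => h.
by exists z.
Qed.

End GenericChain.

(** * Local rings *)

Section IdealPacking.
Variables (D : comNzRingType) (P : D -> Prop).

Definition ideal_pred : {pred D} := fun x => `[< P x >].

Lemma ideal_predP x : reflect (P x) (x \in ideal_pred).
Proof. exact: asboolP. Qed.

Hypotheses (idP : ideal_prop P) (P1 : ~ P 1).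

Lemma ideal_pred_closed : idealr_closed ideal_pred.
Proof.
have [P0 PD PM] := idP; split=> [||a u v /ideal_predP Pu /ideal_predP Pv]; apply/ideal_predP => //.
by apply: PD => //; apply: PM.
Qed.

Definition ideal_of : idealr D :=
  HB.pack_for (idealr D) (ideal_pred : D -> bool) (isIdealr.Build D ideal_pred ideal_pred_closed).

Lemma ideal_ofP x : x \in ideal_of <-> P x.
Proof. by split=> [/ideal_predP|h]; last exact/ideal_predP. Qed.

End IdealPacking.

Section PrimePacking.
Variables (D : comNzRingType) (P : D -> Prop).
Hypothesis prP : prime_prop P.

Lemma prime_pred_closed : idealr_closed (ideal_pred P).
Proof. by have [idP P1 _] := prP; apply: ideal_pred_closed. Qed.

Lemma prime_pred_prime : prime_idealr_closed (ideal_pred P).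
Proof.
have [_ _ pP] := prP; move=> u v /ideal_predP/pP[Pu|Pv]; apply/orP.
  by left; apply/ideal_predP.
by right; apply/ideal_predP.
Qed.

Definition prime_of : prime_idealr D :=
  HB.pack_for (prime_idealr D) (ideal_pred P : D -> bool)
    (isIdealr.Build D (ideal_pred P) prime_pred_closed)
    (isPrimeIdealrClosed.Build D (ideal_pred P) prime_pred_prime).

Lemma prime_ofP x : x \in prime_of <-> P x.
Proof. by split=> [/ideal_predP|h]; last exact/ideal_predP. Qed.

End PrimePacking.

Lemma prime_idealr_prop (D : comNzRingType) (m : prime_idealr D) : prime_prop (fun x => x \in m).
Proof.
split=> [||a b]; last by rewrite prime_idealrM => /orP.
  by split=> [|a b|a b]; [exact: rpred0|exact: rpredD|exact: idealMr].
by rewrite idealr1.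
Qed.

Section LocalRing.
Variables (D : idomainType) (m : prime_idealr D).
Local Notation Dm := (local_ring m).

Lemma loc_of_subproof (z : D) : tofrac z \in loc_pred m.
Proof. by apply/asboolP; exists z, 1; rewrite idealr1 tofrac1 divr1. Qed.

Definition loc_of (z : D) : Dm := LocalRing (loc_of_subproof z).

Lemma loc_ofB : zmod_morphism loc_of.
Proof. by move=> a b; apply: val_inj; rewrite /= tofracB. Qed.

HB.instance Definition _ := GRing.isZmodMorphism.Build D Dm loc_of loc_ofB.

Lemma loc_ofM : monoid_morphism loc_of.
Proof. by split=> [|a b]; apply: val_inj; rewrite /= ?tofracM ?tofrac1. Qed.

HB.instance Definition _ := GRing.isMonoidMorphism.Build D Dm loc_of loc_ofM.

Lemma loc_of_inj : injective loc_of.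
Proof. by move=> a b /(congr1 val)/eqP; rewrite /= tofrac_eq => /eqP. Qed.

Lemma notin_neq0 s : s \notin m -> s != 0.
Proof. by apply: contraNneq => ->; apply: rpred0. Qed.

Lemma loc_fracP (q : Dm) : exists a s, s \notin m /\ loc_of s * q = loc_of a.
Proof.
have /asboolP[a [s [sm qE]]] := valP q; exists a, s; split=> //.
by apply: val_inj; rewrite /= qE mulrC divfK // tofrac_eq0 notin_neq0.
Qed.

Lemma loc_of_unit s : s \notin m -> exists u, u * loc_of s = 1.
Proof.
move=> sm; have us : (tofrac s)^-1 \in loc_pred m.
  by apply/asboolP; exists 1, s; rewrite tofrac1 div1r.
exists (LocalRing us); apply: val_inj => /=.
by rewrite mulVf // tofrac_eq0 notin_neq0.
Qed.

Definition loc_ideal (P : D -> Prop) (q : Dm) : Prop :=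
  exists a s, [/\ s \notin m, P a & loc_of s * q = loc_of a].

Lemma loc_ideal_of (P : D -> Prop) z : P z -> loc_ideal P (loc_of z).
Proof. by exists z, 1; rewrite idealr1 rmorph1 mul1r. Qed.

Lemma loc_idealE (P : D -> Prop) z : prime_prop P -> (forall a, P a -> a \in m) ->
  loc_ideal P (loc_of z) -> P z.
Proof.
move=> [_ _ pP] Pm [a [s [sm Pa]]]; rewrite -rmorphM => /loc_of_inj E.
by move: Pa; rewrite -E => /pP[/Pm|//]; rewrite (negbTE sm).
Qed.

Lemma loc_ideal_prime (P : D -> Prop) : prime_prop P -> (forall a, P a -> a \in m) ->
  prime_prop (loc_ideal P).
Proof.
move=> prP Pm; have [[P0 PD PM] P1 pP] := prP.
split=> [||q1 q2 [c [u [um Pc uq]]]].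
- split=> [|q1 q2 [a [s [sm Pa sq]]] [b [t [tm Pb tq]]]|q1 q2 [b [t [tm Pb tq]]]].
  + by exists 0, 1; rewrite idealr1 raddf0 mulr0.
  + exists (t * a + s * b), (s * t); split.
    * by rewrite prime_idealrM negb_or sm.
    * by apply: PD; apply: PM.
    * by rewrite rmorphD !rmorphM /= -sq -tq; ring.
  + have [a [s [sm sq]]] := loc_fracP q1; exists (a * b), (s * t); split.
    * by rewrite prime_idealrM negb_or sm.
    * exact: PM.
    * by rewrite !rmorphM /= -sq -tq; ring.
- by rewrite -(rmorph1 loc_of) => /(loc_idealE prP Pm).
- have [a [s [sm sq]]] := loc_fracP q1; have [b [t [tm tq]]] := loc_fracP q2.
  have : P (u * (a * b)).
    have -> : u * (a * b) = (s * t) * c.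
      by apply: loc_of_inj; rewrite !rmorphM /= -sq -tq -uq; ring.
    exact: PM.
  move=> /pP[/Pm|/pP[Pa|Pb]]; first by rewrite (negbTE um).
    by left; exists a, s.
  by right; exists b, t.
Qed.

Definition loc_max : prime_idealr Dm :=
  prime_of (loc_ideal_prime (prime_idealr_prop m) (fun a (h : a \in m) => h)).

Lemma notin_loc_max q : q \notin loc_max -> exists u, u * q = 1.
Proof.
have [a [s [sm sq]]] := loc_fracP q => qM.
have am : a \notin m.
  by apply: contra qM => am; apply/prime_ofP; exists a, s.
have [u ua] := loc_of_unit am; exists (u * loc_of s).
by rewrite -mulrA sq.
Qed.

Lemma proper_sub_loc_max (M : idealr Dm) : {subset M <= loc_max}.
Proof.
move=> q qM; apply/negPn/negP => /notin_loc_max[u uq].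
by have := idealMr u qM; rewrite uq idealr1.
Qed.

(** The chain [p] extends to the localization. Conversely, clearing denominators in elements of
    [C i.+1] outside [C i] turns a chain of primes of the localization into a regular chain of [D],
    whose length is bounded by assumption. *)
Lemma krull_dim_local_ring d (p : nat -> D -> Prop) :
  (forall i, (i <= d)%N -> prime_prop (p i)) ->
  (forall i, (i < d)%N -> (forall a, p i a -> p i.+1 a) /\ exists2 x, p i.+1 x & ~ p i x) ->
  (forall a, p d a -> a \in m) ->
  (forall n x I, @regular_chain D n x I -> (n <= d)%N) ->
  krull_dim Dm d.
Proof.
move=> pp pS pm regd.
have psub i a : (i <= d)%N -> p i a -> a \in m.
  suff mono e : (i <= e)%N -> (e <= d)%N -> p i a -> p e a by move=> id /(mono _ id (leqnn d))/pm.
  elim: e => [|e IH]; first by rewrite leqn0 => /eqP ->.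
  rewrite leq_eqVlt => /orP[/eqP -> //|ie] ed pa.
  by have [h _] := pS e ed; apply: h; apply: IH => //; apply: ltnW.
split.
  (* A chain assigns a prime to every index, so it is made constant beyond [d]. *)
  have pr i : prime_prop (loc_ideal (p (minn i d))).
    by apply: loc_ideal_prime => [|a]; [apply: pp|apply: psub]; rewrite geq_minr.
  exists (fun i => prime_of (pr i)) => i id.
  have [sub [x px npx]] := pS i id.
  have mi : minn i d = i by apply/minn_idPl/ltnW.
  have mi1 : minn i.+1 d = i.+1 by apply/minn_idPl.
  split=> [q /prime_ofP[a [s [sm Pa sq]]]|].
    apply/prime_ofP; exists a, s; split=> //; rewrite mi1; apply: sub.
    by rewrite mi in Pa.
  exists (loc_of x); first by apply/prime_ofP/loc_ideal_of; rewrite mi1.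
  apply/negP => /prime_ofP; rewrite mi => /loc_idealE xp; apply: npx; apply: xp.
    exact/pp/ltnW.
  by move=> a; apply: psub; apply: ltnW.
move=> n C Cch.
have ex i : exists x, (i < n)%N -> loc_of x \in C i.+1 /\ loc_of x \notin C i.
  case: (ltnP i n) => [lt_in|]; last by exists 0.
  have [_ [q qC1 qC]] := Cch i lt_in; have [a [s [sm sq]]] := loc_fracP q.
  exists a => _; split; first by rewrite -sq; apply: idealMr.
  rewrite -sq prime_idealrM negb_or qC andbT; have [u us] := loc_of_unit sm.
  by apply/negP => /(idealMr u); rewrite us idealr1.
have [x hx] := choice ex.
apply: (regd n x (fun i a => loc_of a \in C i)); split=> [i _|i lt_in|].
- split=> [|a b|a b]; first by rewrite raddf0 rpred0.
    by rewrite raddfD; apply: rpredD.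
  by rewrite rmorphM; apply: idealMr.
- have [h1 h2] := hx i lt_in; have [sub _] := Cch i lt_in; split=> // [a|a]; last exact: sub.
  by rewrite rmorphM prime_idealrM (negbTE h2).
- by rewrite rmorph1 idealr1.
Qed.

Lemma regular_local_ring_point d (g : 'I_d -> D) :
  left_noetherian Dm -> krull_dim Dm d -> (forall j, g j \in m) ->
  (forall x, x \in m -> locgen (fun x => x \in m) g x) -> regular_local_ring Dm.
Proof.
move=> nD kd gm ggen; split=> //; exists loc_max; split.
- by move=> J _; apply: proper_sub_loc_max.
- move=> M' M'max q; apply/idP/idP; first exact: proper_sub_loc_max.
  by apply: (M'max loc_max); apply: proper_sub_loc_max.
exists [seq loc_of (g j) | j <- enum 'I_d]; rewrite size_map size_enum_ord; split=> // q.
split=> [/prime_ofP[a [s [sm am sq]]]|[c ->]].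
  have [u /negP um [c uc]] := ggen a am.
  have [v vs] := loc_of_unit sm; have [w wu] := loc_of_unit um.
  have -> : q = v * w * loc_of (u * a).
    by rewrite rmorphM /= -sq -[LHS]mul1r -vs -[in LHS](mul1r v) -wu; ring.
  rewrite uc rmorph_sum mulr_sumr; apply: (big_ind (lspan _)) => [||j _].
  - exact: lspan0.
  - by move=> q1 q2; apply: lspanD.
  rewrite rmorphM mulrA; apply: (@lspanZ _ Dm^o); apply: lspan_mem.
  by apply: map_f; rewrite mem_enum.
apply: rpred_sum => i _; apply: idealMr; apply/prime_ofP.
have /mapP[j _ ->] := mem_nth (0 : Dm^o) (ltn_ord i).
exact/loc_ideal_of/gm.
Qed.

End LocalRing.

(** * Fibres over generic points *)

Section LocalizedFunctional.
Variables (k : closedFieldType) (A : algType k) (Z : central_subdomain A).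
Variable w : nat -> A.
Hypothesis w0 : w 0 = 1.

Definition dependent i : Prop := exists (s : csd Z) (z : nat -> csd Z),
  s != 0 /\ val s * w i = \sum_(j < i) val (z j) * w j.

(** The relations are fixed once and for all before [m] is chosen: the [sp i] are the countably many
    elements that [m] has to avoid, with value 1 where there is no relation. *)
Lemma dependent_denominators : exists (sp : nat -> csd Z) (zz : nat -> nat -> csd Z),
  (forall i, sp i != 0) /\
  forall i, dependent i -> val (sp i) * w i = \sum_(j < i) val (zz i j) * w j.
Proof.
have ex i : exists sz : csd Z * (nat -> csd Z), sz.1 != 0 /\
    (dependent i -> val sz.1 * w i = \sum_(j < i) val (sz.2 j) * w j).
  have [[s [z [s0 sz]]]|nd] := pselect (dependent i); first by exists (s, z).
  by exists (1, fun=> 0); rewrite oner_neq0.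
have [sz hsz] := choice ex.
by exists (fun i => (sz i).1), (fun i => (sz i).2); split=> i; have [] := hsz i.
Qed.

Lemma csd_sum_recr n (z : nat -> csd Z) : \sum_(i < n.+1) val (z i) * w i =
  \sum_(i < n) val (z i) * w i + val (z n) * w n.
Proof. by rewrite big_ord_recr. Qed.

Lemma not_dependent_coef n (z : nat -> csd Z) : ~ dependent n ->
  \sum_(i < n.+1) val (z i) * w i = 0 -> z n = 0.
Proof.
move=> nd /eqP; rewrite big_ord_recr /= addrC addr_eq0 => /eqP E.
apply/eqP/negPn/negP => zn; apply: nd; exists (z n), (fun j => - z j); split=> //.
by rewrite E -sumrN; apply: eq_bigr => j _; rewrite raddfN mulNr.
Qed.

Lemma pivots_indep n (z : nat -> csd Z) : (forall i, (i < n)%N -> dependent i -> z i = 0) ->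
  \sum_(i < n) val (z i) * w i = 0 -> forall i, (i < n)%N -> z i = 0.
Proof.
elim: n => // n IH zd zw i.
have zn : z n = 0.
  have [/zd|nd] := pselect (dependent n); first by apply.
  exact: not_dependent_coef zw.
rewrite ltnS leq_eqVlt => /orP[/eqP -> //|]; apply: IH => [j jn|]; first exact/zd/ltnW.
by move: zw; rewrite csd_sum_recr zn rmorph0 mul0r addr0.
Qed.

Variables (sp : nat -> csd Z) (zz : nat -> nat -> csd Z).
Hypothesis sp0 : forall i, sp i != 0.
Hypothesis spE : forall i, dependent i -> val (sp i) * w i = \sum_(j < i) val (zz i j) * w j.

(** Values of a functional on the [w i]: 1 on [w 0], 0 on every later independent word, and the
    value forced by the chosen relation on a dependent one; [l] holds the values found so far. *)
Definition ell_step i (l : seq (csd_frac Z)) : csd_frac Z :=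
  if `[< dependent i >] then (\sum_(j < i) of_csd (zz i j) * l`_j) / of_csd (sp i) else (i == 0%N)%:R.

Fixpoint ell_seq n : seq (csd_frac Z) :=
  if n is n'.+1 then rcons (ell_seq n') (ell_step n' (ell_seq n')) else [::].

Definition ell i : csd_frac Z := (ell_seq i.+1)`_i.

Lemma size_ell_seq n : size (ell_seq n) = n.
Proof. by elim: n => //= n IH; rewrite size_rcons IH. Qed.

Lemma ell_seqE n i : (i < n)%N -> (ell_seq n)`_i = ell i.
Proof.
elim: n => // n IH; rewrite ltnS leq_eqVlt => /orP[/eqP -> //|lt_in].
by rewrite /= nth_rcons size_ell_seq lt_in IH.
Qed.

Lemma ellE i : ell i = if `[< dependent i >] then
  (\sum_(j < i) of_csd (zz i j) * ell j) / of_csd (sp i) else (i == 0%N)%:R.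
Proof.
rewrite /ell /= nth_rcons size_ell_seq ltnn eqxx /ell_step; case: ifP => // _.
by congr (_ / _); apply: eq_bigr => j _; rewrite ell_seqE.
Qed.

Lemma ell0 : ell 0 = 1.
Proof.
rewrite ellE; case: asboolP => // -[s [z [s0]]]; rewrite big_ord0 w0 mulr1 => vs.
by case/eqP: s0; apply/val_inj; rewrite vs rmorph0.
Qed.

Lemma ell_dependent i : dependent i ->
  of_csd (sp i) * ell i = \sum_(j < i) of_csd (zz i j) * ell j.
Proof.
by move=> di; rewrite ellE asboolT // mulrC divfK // of_csd_eq0.
Qed.

(** The functional is well defined: after multiplication by [sp n], the last term of a relation is
    either zero or can be replaced by earlier words, and [ell] satisfies the same replacement. *)
Lemma ell_relation n (z : nat -> csd Z) :
  \sum_(i < n) val (z i) * w i = 0 -> \sum_(i < n) of_csd (z i) * ell i = 0.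
Proof.
elim: n z => [|n IH] z zw; first by rewrite big_ord0.
have [dn|nd] := pselect (dependent n); last first.
  have zn := not_dependent_coef nd zw.
  move: zw; rewrite csd_sum_recr big_ord_recr /= zn !rmorph0 !mul0r !addr0; exact: IH.
have : \sum_(i < n) val (sp n * z i + z n * zz n i) * w i = 0.
  have := congr1 (fun a => val (sp n) * a) zw; rewrite mulr0 csd_sum_recr mulrDr => E.
  rewrite -[RHS]E [val (sp n) * (val (z n) * w n)]mulrA -(csd_central _ (valP (z n))) -mulrA (spE dn).
  rewrite !mulr_sumr -big_split; apply: eq_bigr => i _.
  by rewrite rmorphD !rmorphM mulrDl !mulrA.
move/(IH (fun i => sp n * z i + z n * zz n i)) => E; apply: (mulfI (_ : of_csd (sp n) != 0)); first by rewrite of_csd_eq0.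
rewrite mulr0 -[RHS]E big_ord_recr mulrDr /= mulrCA (ell_dependent dn) !mulr_sumr -big_split.
by apply: eq_bigr => i _; rewrite rmorphD !rmorphM /=; ring.
Qed.

Definition ell_rel a q : Prop := exists n (z : nat -> csd Z),
  a = \sum_(i < n) val (z i) * w i /\ q = \sum_(i < n) of_csd (z i) * ell i.

Lemma ell_rel_widen n N (z : nat -> csd Z) : (n <= N)%N -> exists z' : nat -> csd Z,
  \sum_(i < n) val (z i) * w i = \sum_(i < N) val (z' i) * w i /\
  \sum_(i < n) of_csd (z i) * ell i = \sum_(i < N) of_csd (z' i) * ell i.
Proof.
move=> nN; exists (fun i => if (i < n)%N then z i else 0); split.
  rewrite (big_ord_widen N (fun i => val (z i) * w i)) // big_mkcond.
  by apply: eq_bigr => i _; case: ifP; rewrite // rmorph0 mul0r.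
rewrite (big_ord_widen N (fun i => of_csd (z i) * ell i)) // big_mkcond /=.
by apply: eq_bigr => i _; case: ifP; rewrite // rmorph0 mul0r.
Qed.

Lemma ell_relP (c : csd Z) a q b r : ell_rel a q -> ell_rel b r ->
  ell_rel (val c * a + b) (of_csd c * q + r).
Proof.
move=> [n [z [-> ->]]] [n' [z' [-> ->]]].
have [y [-> ->]] := ell_rel_widen z (leq_maxl n n'); have [y' [-> ->]] := ell_rel_widen z' (leq_maxr n n').
exists (maxn n n'), (fun i => c * y i + y' i); rewrite !mulr_sumr -!big_split; split.
  by apply: eq_bigr => i _; rewrite rmorphD rmorphM mulrDl mulrA.
by apply: eq_bigr => i _; rewrite rmorphD rmorphM mulrDl mulrA.
Qed.

Lemma ell_rel_unique a q r : ell_rel a q -> ell_rel a r -> q = r.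
Proof.
move=> hq hr; have := ell_relP (-1) hq hr; rewrite rmorphN1 mulN1r addNr rmorphN1 mulN1r => -[n [z [zw E]]].
by apply/eqP; rewrite eq_sym -subr_eq0 addrC E ell_relation.
Qed.

Variable m : prime_idealr (csd Z).
Hypothesis sp_m : forall i, sp i \notin m.
Hypothesis w_span : forall a, exists n (c : nat -> k), a = \sum_(i < n) (c i)%:A * w i.

Definition in_loc (q : csd_frac Z) : Prop := exists s b, s \notin m /\ of_csd s * q = of_csd b.

Lemma in_loc_local q : in_loc q -> exists x : local_ring m, val x = q.
Proof.
move=> [s [b [sm sq]]]; have qm : (q : {fraction csd Z}) \in loc_pred m.
  apply/asboolP; exists b, s; split=> //; rewrite -/(of_csd b) -sq mulrC mulKf //.
  by rewrite tofrac_eq0 (notin_neq0 sm).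
by exists (LocalRing qm).
Qed.

Lemma in_locD q r : in_loc q -> in_loc r -> in_loc (q + r).
Proof.
move=> [s [b [sm sq]]] [t [c [tm tr]]]; exists (s * t), (t * b + s * c).
by rewrite prime_idealrM negb_or sm rmorphD !rmorphM /= -sq -tr; split=> //; ring.
Qed.

Lemma in_locZ z q : in_loc q -> in_loc (of_csd z * q).
Proof. by move=> [s [b [sm sq]]]; exists s, (z * b); rewrite mulrCA sq rmorphM. Qed.

Lemma in_loc_sum n (F : nat -> csd_frac Z) :
  (forall i, (i < n)%N -> in_loc (F i)) -> in_loc (\sum_(i < n) F i).
Proof.
move=> h; apply: big_ind => [||i _]; [|exact: in_locD|exact: h].
by exists 1, 0; rewrite idealr1 rmorph0 mulr0.
Qed.

(** The recursion divides only by the [sp i], which are units at [m]. *)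
Lemma ell_in_loc i : in_loc (ell i).
Proof.
elim/ltn_ind: i => i IH; have [di|nd] := pselect (dependent i); last first.
  rewrite ellE asboolF //; exists 1, (i == 0%N)%:R.
  by rewrite idealr1 rmorph1 mul1r rmorph_nat.
have [s [b [sm sb]]] : in_loc (of_csd (sp i) * ell i).
  rewrite ell_dependent //; apply: (@in_loc_sum i (fun j => of_csd (zz i j) * ell j)) => j ji.
  exact/in_locZ/IH.
by exists (s * sp i), b; rewrite prime_idealrM negb_or sm sp_m rmorphM -mulrA.
Qed.

Lemma localized_functional : exists Lf : A -> csd_frac Z,
  [/\ forall (c : csd Z) a b, Lf (val c * a + b) = of_csd c * Lf a + Lf b,
      Lf 1 = 1 & forall a, in_loc (Lf a)].
Proof.
have ex a : exists q, ell_rel a q.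
  have [n [c ->]] := w_span a; exists (\sum_(i < n) of_csd (c i)%:A * ell i), n, (fun i => (c i)%:A).
  by split=> //; apply: eq_bigr => i _; rewrite rmorph_alg.
have [Lf hLf] := choice ex; exists Lf; split=> [c a b||a].
- by apply: (ell_rel_unique (hLf _)); apply: ell_relP.
- apply: (ell_rel_unique (hLf _)); exists 1%N, (fun=> 1); rewrite !big_ord1 !rmorph1 !mul1r ell0.
  by rewrite w0.
- have [n [z [_ ->]]] := hLf a.
  by apply: (@in_loc_sum n (fun i => of_csd (z i) * ell i)) => i _; apply/in_locZ/ell_in_loc.
Qed.

End LocalizedFunctional.

Section FunctionalConsequences.
Variables (k : closedFieldType) (A : algType k) (Z : central_subdomain A) (m : prime_idealr (csd Z)).
Variable Lf : A -> csd_frac Z.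
Hypothesis LfP : forall (c : csd Z) a b, Lf (val c * a + b) = of_csd c * Lf a + Lf b.
Hypothesis Lf1 : Lf 1 = 1.
Hypothesis Lf_loc : forall a, in_loc m (Lf a).

Lemma Lf0 : Lf 0 = 0.
Proof. by have := LfP (-1) 0 0; rewrite mulr0 addr0 rmorphN1 mulN1r addNr; apply. Qed.

Lemma Lf_csd z a : Lf (val z * a) = of_csd z * Lf a.
Proof. by rewrite -[val z * a]addr0 LfP Lf0 addr0. Qed.

Lemma Lf_sum (I : Type) (r : seq I) (z : I -> csd Z) (a : I -> A) :
  Lf (\sum_(i <- r) val (z i) * a i) = \sum_(i <- r) of_csd (z i) * Lf (a i).
Proof. by elim: r => [|i r IH]; rewrite ?big_nil ?Lf0 // !big_cons LfP IH. Qed.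

(** Applying [Lf] to an expression of 1 as an element of [mA] would put 1 into the maximal ideal of
    the localization. *)
Lemma one_notin_ext_ideal : (1 : A) \notin ext_ideal m.
Proof.
apply/negP => /asboolP[s [/allP sm E]].
have := congr1 Lf E; rewrite Lf1 Lf_sum.
have : exists u b, [/\ u \notin m, b \in m & of_csd u * (\sum_(y <- s) of_csd y.1 * Lf y.2) = of_csd b].
  elim: s sm {E} => [|y s IH] sm.
    by exists 1, 0; rewrite idealr1 rpred0 big_nil mulr0 rmorph0.
  have [|u [b [um bm ub]]] := IH; first by move=> x xs; apply: sm; rewrite inE xs orbT.
  have [t [c [tm tc]]] := Lf_loc y.2; have ym := sm y (mem_head _ _).
  exists (u * t), (u * c * y.1 + t * b); split.
  - by rewrite prime_idealrM negb_or um.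
  - by apply: rpredD; apply: idealMr.
  - by rewrite big_cons rmorphD !rmorphM /= -tc -ub; ring.
move=> [u [b [um bm ub]]] E1; move: ub; rewrite -E1 mulr1 => /(@of_csd_inj _ _ _) ub.
by rewrite ub bm in um.
Qed.

(* [Z_m] is a direct summand of the localized algebra, via [Lf], so its ideals
   inherit finite generation from the ideals they generate in [A]. *)
Lemma local_ring_noetherian : left_noetherian A -> left_noetherian (local_ring m).
Proof.
move=> nA I; pose I0 (z : csd Z) := (loc_of m z : (local_ring m)^o) \in I.
have idI0 : ideal_prop I0.
  rewrite /I0; split=> [|a b|a b]; first by rewrite raddf0 rpred0.
    by rewrite raddfD; apply: rpredD.
  by rewrite rmorphM; apply: (@rpredZ _ _ I).
have [I1|I1] := pselect (I0 1).
  exists [:: 1] => x; split=> [_|_].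
    by exists (fun=> x); rewrite big_ord1 /=; apply/esym/mulr1.
  have := @rpredZ _ _ I x _ I1; rewrite rmorph1.
  by have -> : x *: (1 : (local_ring m)^o) = x by exact: mulr1.
pose J : idealr (csd Z) := ideal_of idI0 I1.
have [ms msI hms] := ext_ideal_generators J nA.
exists [seq loc_of m z | z <- ms] => q; split=> [qI|[c ->]]; last first.
  apply: rpred_sum => i _; apply: rpredZ.
  have /mapP[z zms ->] := mem_nth (0 : (local_ring m)^o) (ltn_ord i).
  by have /ideal_ofP := msI z zms.
have [a [s [sm sq]]] := loc_fracP q.
have aI : a \in J.
  by apply/ideal_ofP; rewrite /I0 -sq; apply: (@rpredZ _ _ I).
have [b bE] := hms _ (ext_ideal_mem 1 aI).
have [L hL] := choice (fun i => in_loc_local (Lf_loc (b i))).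
have aE : loc_of m a = \sum_(i < size ms) L i * loc_of m ms`_i.
  apply: val_inj; rewrite rmorph_sum.
  have := congr1 Lf bE; rewrite Lf_csd Lf1 mulr1 Lf_sum => aE.
  rewrite -[LHS]/(of_csd a) aE; apply: eq_bigr => i _.
  by rewrite rmorphM mulrC; congr (_ * _); apply/esym/hL.
have [u us] := loc_of_unit sm.
have -> : q = u * loc_of m a by rewrite -sq mulrA us mul1r.
rewrite aE mulr_sumr; apply: (big_ind (lspan _)) => [||i _].
- exact: lspan0.
- by move=> q1 q2; apply: lspanD.
by rewrite mulrA; apply: (@lspanZ _ (local_ring m)^o); apply/lspan_mem/map_f/mem_nth.
Qed.

End FunctionalConsequences.

(** * The fibre [A/mA] compared with the generic fibre *)

Section WordEnumeration.
Variables (K : fieldType) (A : algType K) (V : seq A).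
Hypothesis V1 : 1 \in V.

Lemma size_awordsS n : size (awords V n.+1) = (size (awords V n) + size V * size (awords V n))%N.
Proof. by rewrite /awords wordsS size_cat size_allpairs. Qed.

Lemma size_awords n : (n < size (awords V n))%N.
Proof.
elim: n => // n IH; rewrite size_awordsS.
have : (0 < size V)%N by case: (V) V1.
case: (size V) => // v _; rewrite mulSn addnA; apply: leq_trans (leq_addr _ _).
apply: (@leq_trans (n.+1 + n.+1)); last exact: (leq_add IH IH).
by rewrite addnS ltnS addSn ltnS leq_addr.
Qed.

Lemma size_awords_mono m n : (m <= n)%N -> (size (awords V m) <= size (awords V n))%N.
Proof.
elim: n => [|n IH]; first by rewrite leqn0 => /eqP ->.
rewrite leq_eqVlt => /orP[/eqP ->|/IH h]; first exact: leqnn.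
by apply: leq_trans h _; rewrite size_awordsS leq_addr.
Qed.

Lemma awords_prefix n p i : (n <= p)%N -> (i < size (awords V n))%N ->
  (awords V p)`_i = (awords V n)`_i.
Proof.
elim: p => [|p IH]; first by rewrite leqn0 => /eqP ->.
rewrite leq_eqVlt => /orP[/eqP -> //|np] isz; rewrite -(IH np isz) /awords wordsS nth_cat.
by rewrite (leq_trans isz) // size_awords_mono.
Qed.

(** The lists [awords V n] are prefixes of one another, and since [1 \in V] stage [i] has more than
    [i] entries. So this is one infinite sequence, with repetitions, of which every [awords V n] is
    an initial segment. *)
Definition word_enum i : A := (awords V i)`_i.

Lemma word_enumE n i : (i < size (awords V n))%N -> (awords V n)`_i = word_enum i.
Proof.
move=> isz; have isz' := size_awords i.
by rewrite /word_enum -(awords_prefix (leq_maxl n i) isz) -(awords_prefix (leq_maxr n i) isz').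
Qed.

Lemma word_enum0 : word_enum 0 = 1. Proof. by []. Qed.

Lemma word_enum_span : (forall a, exists n, kspan (awords V n) a) ->
  forall a, exists n (c : nat -> K), a = \sum_(i < n) (c i)%:A * word_enum i.
Proof.
move=> h a; have [n [c ->]] := h a; exists (size (awords V n)), c.
by apply: eq_bigr => i _; rewrite word_enumE.
Qed.

End WordEnumeration.

Section LinearImage.
Variables (K : fieldType) (A : algType K).

Lemma words_linear (M N : lmodType A) (f : {linear M -> N}) V (F : seq M) n :
  words V (map f F) n = map f (words V F n).
Proof.
elim: n => // n IH; rewrite !wordsS map_cat -IH; congr (_ ++ _).
rewrite map_allpairs IH allpairs_mapr.
by apply: eq_allpairs => v x; rewrite linearZ.
Qed.

Lemma span_dim_mono (M : lmodType A) (s t : seq M) :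
  {in s, forall x, kspan t x} -> (span_dim s <= span_dim t)%N.
Proof.
move=> st; have [x ix xs] := span_dim_indep s.
by apply: span_dim_ge ix _ => i; apply: st.
Qed.

Lemma kspan_linear (M N : lmodType A) (f : {linear M -> N}) (s : seq M) x :
  kspan s x -> kspan (map f s) (f x).
Proof.
move: x; apply: kspan_ind => [|x y fx fy|a x fx|x xs].
- by rewrite linear0; apply: kspan0.
- by rewrite linearD; apply: kspanD.
- by rewrite linearZ; apply: kspanZ.
- exact/kspan_mem/map_f.
Qed.

End LinearImage.

Section FibreDimension.
Variables (k : closedFieldType) (A : algType k) (Z : central_subdomain A).
Local Notation AQ := (frac_tensor Z).
Local Notation kappa := (in_alg (csd Z)).
Variable V : seq A.
Hypothesis V1 : 1 \in V.
Local Notation w := (word_enum V).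

Lemma awords_tens n : awords (map (tens_of Z) V) n = map (tens_of Z) (awords V n).
Proof.
elim: n => [|n IH]; first by rewrite /awords /= rmorph1.
rewrite /awords !wordsS map_cat -/(awords _ _) IH; congr (_ ++ _).
rewrite map_allpairs allpairs_mapl allpairs_mapr.
by apply: eq_allpairs => v x; rewrite -[_ *: _]/(_ * _) -rmorphM.
Qed.

Definition pivot_set N : {set 'I_N} := [set i : 'I_N | ~~ `[< dependent Z w i >]].

(** Words not dependent on earlier ones are independent over [Z], and clearing denominators in a
    relation shows that they remain so over [Q(Z)]. *)
Lemma card_pivots_le n (N := size (awords (map (tens_of Z) V) n)) :
  (#|pivot_set N| <= span_dim (awords (map (tens_of Z) V) n))%N.
Proof.
pose s := awords (map (tens_of Z) V) n.
apply: (@leq_bigmax_cond _ (fun I : {set 'I_(size s)} => `[< lin_indep (tnth (in_tuple s)) I >])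
  (fun I : {set 'I_(size s)} => #|I|)); apply/asboolP => c cE.
have [e e0 he] := csd_frac_common_denominator (codom c).
have /choice[z hz] i : exists z, of_csd e * c i = of_csd z by apply/he/codom_f.
have Nsz : N = size (awords V n) by rewrite /N awords_tens size_map.
have sE j : (j < N)%N -> s`_j = tens_of Z (w j).
  by rewrite Nsz => jN; rewrite /s awords_tens (nth_map 0) // word_enumE.
pose z' (i : nat) : csd Z := if insub i is Some o then (if o \in pivot_set N then z o else 0) else 0.
have z'E (o : 'I_N) : z' o = if o \in pivot_set N then z o else 0.
  by rewrite /z' valK.
have rel : \sum_(i < N) val (z' i) * w i = 0.
  apply: (@tens_of_inj _ _ Z); rewrite raddf0 raddf_sum.
  have := congr1 (fun u : AQ => of_csd e *: u) cE; rewrite scaler0 => E; rewrite -[RHS]E.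
  rewrite scaler_sumr [RHS]big_mkcond; apply: eq_bigr => i _; rewrite z'E.
  case: ifP => _; last by rewrite rmorph0 mul0r raddf0.
  rewrite /= tens_of_csd -hz tens_scaleE_mul scalerA; congr (_ *: _).
  by rewrite (tnth_nth 0) /= sE.
move=> i iP; have : z' i = 0.
  apply: (pivots_indep _ rel) => // j jN dj.
  rewrite -[j]/(nat_of_ord (Ordinal jN)) z'E ifF //.
  by rewrite finset.inE; apply/negbTE; rewrite negbK; apply/asboolP.
rewrite z'E iP => zi; have := hz i; rewrite zi rmorph0 => /eqP.
by rewrite mulf_eq0 of_csd_eq0 (negbTE e0) /= => /eqP.
Qed.

Variables (sp : nat -> csd Z) (zz : nat -> nat -> csd Z).
Hypothesis spE : forall i, dependent Z w i -> val (sp i) * w i = \sum_(j < i) val (zz i j) * w j.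
Variable m : prime_idealr (csd Z).
Hypothesis sp_m : forall i, sp i \notin m.
Hypothesis residue : forall x : csd Z, exists c : k, x - kappa c \in m.
Local Notation pi := (lquot_map (ext_ideal m)).

Lemma residue_scale (z : csd Z) c a : z - kappa c \in m -> pi (val z * a) = c%:A *: pi a.
Proof.
move=> zc; rewrite -linearZ; apply/eqP; rewrite -subr_eq0 -linearB; apply/eqP/lquot_map_eq0.
have -> : val z * a - c%:A *: (a : A^o) = val (z - kappa c) * a.
  by rewrite rmorphB mulrBl; congr (_ - _ * _); rewrite -[LHS](rmorph_alg (val : {lrmorphism csd Z -> A})).
exact: ext_ideal_mem.
Qed.

(** Modulo [m] the relation of a dependent word becomes a relation over [k], and the residue of its
    leading coefficient [sp i] is invertible; earlier words are spanned by induction. *)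
Lemma pivots_span N i : (i < N)%N ->
  kspan [seq pi (w (j : 'I_N)) | j <- enum (pivot_set N)] (pi (w i)).
Proof.
elim/ltn_ind: i => i IH iN; have [di|nd] := pselect (dependent Z w i); last first.
  apply: kspan_mem; apply/mapP; exists (Ordinal iN) => //.
  by rewrite mem_enum finset.inE; apply/asboolPn.
have [c sc] := residue (sp i).
have c0 : c != 0.
  by apply: contraNneq (sp_m i) => c0; move: sc; rewrite c0 rmorph0 subr0.
have -> : pi (w i) = c^-1%:A *: (c%:A *: pi (w i)).
  by rewrite scalerA -scalerAl mul1r scalerA mulVf // !scale1r.
apply: kspanZ; rewrite -(residue_scale _ sc) spE // linear_sum; apply: kspan_sum => j _.
have [e ze] := residue (zz i j); rewrite (residue_scale _ ze); apply: kspanZ.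
exact: IH (ltn_trans (ltn_ord j) iN).
Qed.

Lemma span_dim_fibre_le n :
  (span_dim (words V [:: pi 1%R] n) <= span_dim (awords (map (tens_of Z) V) n))%N.
Proof.
apply: leq_trans (card_pivots_le n); rewrite awords_tens size_map.
rewrite cardE -(size_map (fun j : 'I_(size (awords V n)) => pi (w j))).
apply: span_dim_le => x; rewrite -[[:: pi 1]]/(map pi [:: 1]) words_linear => /mapP[a + ->].
by move=> /(nthP 0)[i isz <-]; rewrite (word_enumE V1 isz); apply: pivots_span.
Qed.

Lemma GKdim_fibre_le (R : realType) : (forall a, exists n, kspan (awords V n) a) ->
  (GKdim R (lquot (ext_ideal m)) <= GKdim_alg R AQ)%E.
Proof.
move=> Vspan; apply/ereal_supP => _ [[V' F'] _ <-] /=; rewrite gk_growthE.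
have [a ha] := affine_awords_seq Vspan V'.
have [b hb] : exists b, {in F', forall y, kspan (words V [:: pi 1] b) y}.
  have [F [b hb <-]] : exists2 F : seq A^o, exists b, {in F, forall x, kspan (awords V b) x} & map pi F = F'.
    have [rep hrep] := choice (@lquot_map_surj A A^o (ext_ideal m)).
    exists (map rep F'); last by rewrite -map_comp map_id_in // => y _ /=; apply: hrep.
    exact: affine_awords_seq.
  exists b => _ /mapP[x xF ->]; rewrite -[[:: pi 1]]/(map pi [:: 1]) words_linear.
  exact/kspan_linear/hb.
apply: le_trans (growth_le_GKdim_alg R (map (tens_of Z) V)).
(* [a] may be 0, whereas a positive stretch factor is required. *)
apply: (@growth_le_affine _ _ _ a.+1 b) => // n; apply: leq_trans (span_dim_fibre_le _).
apply: span_dim_mono => x xn; apply: (kspan_words_change _ hb (kspan_mem xn)) => v vV.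
by apply: (kspan_words_leq (leqnSn a)); apply: ha.
Qed.

End FibreDimension.

Section GoodIdeal.
Variables (R : realType) (k : closedFieldType) (A : algType k) (Z : central_subdomain A).
Local Notation kappa := (in_alg (csd Z)).

Lemma good_ideal_exists : affine_algebra A -> left_noetherian A -> affine_algebra (csd Z) ->
  ~ countable [set: k]%classic -> exists m : prime_idealr (csd Z), good_ideal R m.
Proof.
move=> A_affine nA Z_affine unc.
have [d [t [it at_ [u u0 hu]]]] := csd_separating_basis Z_affine.
have [V0 hV0] := affine_awords A_affine.
pose V := 1 :: V0; have V1 : 1 \in V by apply: mem_head.
have Vspan a : exists n, kspan (awords V n) a.
  have [n an] := hV0 a; exists (1 * n + 0)%N; apply: (kspan_words_change _ _ an) => [v vV|y yF].
    by apply: kspan_awords_gen; rewrite // inE vV orbT.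
  exact: kspan_mem.
have [sp [zz [sp0 spE]]] := dependent_denominators Z (word_enum V).
(* Index 0 carries the element [u] outside which the [t j - la j] generate [m] locally; the
   denominators of the words follow. *)
have [|la [p [pp pS pn pres]]] := generic_chain it at_ Z_affine
    (S := fun n => if n is n'.+1 then sp n' else u) unc.
  by case.
have prm := pp d (leqnn d); pose m := prime_of prm.
have mP x : x \in m <-> p d x by apply: prime_ofP.
have sp_m i : sp i \notin m by apply/negP => /mP; apply: (pn i.+1).
have residue x : exists c : k, x - kappa c \in m by have [c xc] := pres x; exists c; apply/mP.
have wspan := word_enum_span V1 Vspan.
have [Lf [LfP Lf1 Lf_loc]] := localized_functional (word_enum0 V) sp0 spE sp_m wspan.
have mono l e a : (l <= e)%N -> (e <= d)%N -> p l a -> p e a.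
  elim: e => [|e IH]; first by rewrite leqn0 => /eqP ->.
  rewrite leq_eqVlt => /orP[/eqP -> //|le] ed pl.
  have [h _ _] := pS (Ordinal ed); apply: h; apply: (IH le) => //; exact: ltnW.
have pt (j : 'I_d) : p d (t j - kappa (la j)) by have [_ h _] := pS j; apply: mono h.
have ald n x I : @regular_chain (csd Z) n x I -> (n <= d)%N.
  move=> /(regular_chain_algindep (kappa := kappa))/(algindep_csd_frac R).
  by rewrite (GKdim_csd_frac R it at_) lee_fin ler_nat.
exists m; split.
- move=> J mJ x xJ; have [c xc] := residue x.
  have [c0|c0] := eqVneq c 0; first by move: xc; rewrite c0 rmorph0 subr0.
  have : kappa c \in J by rewrite -[kappa c](subKr x); apply: rpredB => //; apply: mJ.
  by move/(idealMr (kappa c^-1)); rewrite -rmorphM mulVf // rmorph1 idealr1.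
- apply: (@regular_local_ring_point _ m d (fun j => t j - kappa (la j))).
  + exact: (local_ring_noetherian LfP Lf1 Lf_loc nA).
  + apply: (@krull_dim_local_ring _ m d p pp) => [i id|a|]; last exact: ald.
      have [h1 h2 h3] := pS (Ordinal id); split=> //.
      by exists (t (Ordinal id) - kappa (la (Ordinal id))).
    by move/mP.
  + by move=> j; apply/mP.
  + have eqm : (fun x : csd Z => x \in m : Prop) = p d by apply/funext => x; apply/propext/mP.
    move=> x /mP px; rewrite eqm; apply: hu => //; exact: (pn 0%N).
- by exists 1; apply: (one_notin_ext_ideal LfP Lf1 Lf_loc).
- exact: (GKdim_fibre_le V1 spE sp_m residue).
Qed.

End GoodIdeal.

Theorem mainTheorem3 (R : realType) (k : closedFieldType) (A : algType k)
    (Z : central_subdomain A)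
    (A_affine : affine_algebra A)
    (A_noetherian : noetherian_ring A)
    (Z_affine : affine_algebra (csd Z))
    (gk_natural : GKdim_natural R A)
    (gk_exact : GKdim_exact R A)
    (gk_partitive : GKdim_finitely_partitive R A)
    (A_CM : Cohen_Macaulay R A) :
  ((exists m : prime_idealr (csd Z), good_ideal R m) ->
     GKdim_alg R A = (GKdim_alg R (frac_tensor Z) + GKdim_alg R (csd_frac Z))%E)
  /\
  (finitely_related A -> ~ countable [set: k]%classic ->
     exists m : prime_idealr (csd Z), good_ideal R m).
Proof.
split=> [[m]|_ unc].
  exact: (GKdim_alg_eq A_noetherian Z_affine A_CM).
exact: good_ideal_exists A_affine A_noetherian.1 Z_affine unc.
Qed.
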